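(* Suppose that $f\in C^\infty(\mathbb{R}^d)$ satisfies $$\|(1+|x|^2)^{n/2}\partial^\beta f\|_{L^2(\mathbb{R}^d)}\leq D_1D_2^{n+|\beta|}(n!)^{\nu}(|\beta|!)^{\mu}\quad\text{for all } n\in\mathbb{N}_0,\ \beta\in\mathbb{N}_0^d,$$ with some $D_1>0$, $D_2\geq 1$, $\nu\geq 0$, and $0\leq\mu<1$. Let $\delta\in[0,1]$ with $s:=\delta\nu+\mu<1$, and let $\rho\colon\mathbb{R}^d\to(0,\infty)$ be a measurable function satisfying $$\rho(x)\leq R(1+|x|^2)^{\delta/2}\quad\text{for all } x\in\mathbb{R}^d$$ with some $R\geq 1$ and $$\rho(x)\leq\eta|x|\quad\text{for all } |x|\geq r_0$$ with some $\eta\in(0,1)$ and some $r_0\geq 1$. Let $\omega\subset\mathbb{R}^d$ be any measurable set satisfying $$\frac{|B(x,\rho(x))\cap\omega|}{|B(x,\rho(x))|}\geq\frac{\gamma_0}{1+|x|^a}\quad\text{for all } x\in\mathbb{R}^d$$ with some $\gamma_0\in(0,1)$ and some $a>0$. Then, for every $\varepsilon\in(0,1]$, $$\|f\|_{L^2(\mathbb{R}^d)}^2\leq \mathrm{e}^{K\cdot\bigl(1+\log\frac{1}{\varepsilon}+D_2^{2/(1-s)}\bigr)^2}\|f\|_{L^2(\omega)}^2+\varepsilon D_1^2,$$ where $K\geq 1$ is a constant depending only on $\gamma_0,R,r_0,\eta,\nu,s,a$, and the dimension $d$.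
   Context: $B(x,\tau)$ denotes the open Euclidean ball of radius $\tau>0$ centered at $x\in\mathbb{R}^d$; $|A|$ denotes the Lebesgue measure of a measurable set $A\subset\mathbb{R}^d$, $|x|$ the Euclidean norm of $x\in\mathbb{R}^d$, and $|\beta|=\beta_1+\dots+\beta_d$ for a multi-index $\beta\in\mathbb{N}_0^d$. $\mathbb{N}_0=\{0,1,2,\dots\}$. *)

(* Defs.v *)
From HB Require Import structures.
From mathcomp Require Import all_boot all_order all_algebra.
From mathcomp Require Import all_classical all_reals all_analysis.
From mathcomp.real_closed Require Import complex.

Set Implicit Arguments.
Unset Strict Implicit.
Unset Printing Implicit Defensive.

Import Order.TTheory GRing.Theory Num.Theory.
Import numFieldNormedType.Exports.

Local Open Scope classical_set_scope.
Local Open Scope ring_scope.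

Lemma sigma_finite_prod d1 d2 (T1 : measurableType d1) (T2 : measurableType d2)
    (R : realType) (m1 : {sigma_finite_measure set T1 -> \bar R})
    (m2 : {sigma_finite_measure set T2 -> \bar R}) :
  sigma_finite setT (m1 \x m2)%E.
Proof.
have /sigma_finiteP[F [TF ndF Foo]] := sigma_finiteT m1.
have /sigma_finiteP[G [TG ndG Goo]] := sigma_finiteT m2.
exists (fun n => F n `*` G n).
  rewrite -setXTT TF TG predeqE => -[x y]; split.
    move=> [/= [n _ Fnx] [k _ Gky]]; exists (maxn n k) => //; split.
    - by move: x Fnx; exact/subsetPset/ndF/leq_maxl.
    - by move: y Gky; exact/subsetPset/ndG/leq_maxr.
  by move=> [n _ []/= ? ?]; split; exists n.
move=> k; have [? ?] := Foo k; have [? ?] := Goo k.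
split; first exact: measurableX.
by rewrite product_measure1E// lte_mul_pinfty// ge0_fin_numE.
Qed.

Section product_cons.
Context {R : realType} {dsp : measure_display} {T : measurableType dsp} {n : nat}.

Definition tcons (p : (T * n.-tuple T)%type) : n.+1.-tuple T := [tuple of p.1 :: p.2].

Lemma measurable_tcons : measurable_fun [set: (T * n.-tuple T)%type] tcons.
Proof. exact: measurable_cons. Qed.

Variables (m1 : {sigma_finite_measure set T -> \bar R}).
Variables (m2 : {sigma_finite_measure set (n.-tuple T) -> \bar R}).

Definition prod_tcons (A : set (n.+1.-tuple T)) : \bar R :=
  (m1 \x m2)%E (tcons @^-1` A).

Let mpre A : measurable A -> measurable (tcons @^-1` A).
Proof. by move=> mA; rewrite -[X in measurable X]setTI; exact: measurable_tcons. Qed.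

Let push0 : prod_tcons set0 = 0%E.
Proof. by rewrite /prod_tcons preimage_set0 measure0. Qed.

Let push_ge0 A : (0 <= prod_tcons A)%E.
Proof. exact: measure_ge0. Qed.

Let push_sigma_additive : semi_sigma_additive prod_tcons.
Proof.
move=> F mF tF mUF; rewrite /prod_tcons preimage_bigcup.
apply: (@measure_semi_sigma_additive _ _ _ (m1 \x m2)%E).
- by move=> i; exact: mpre.
- apply/trivIsetP => /= i j _ _ ij; rewrite -preimage_setI.
  by move/trivIsetP : tF => /(_ _ _ _ _ ij) ->//; rewrite preimage_set0.
- by rewrite -preimage_bigcup; exact: mpre.
Qed.

HB.instance Definition _ := isMeasure.Build _ _ _ prod_tcons
  push0 push_ge0 push_sigma_additive.

Let push_sigma_finite : sigma_finite setT prod_tcons.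
Proof.
have [F FT mF] := sigma_finite_prod m1 m2.
pose g (t : n.+1.-tuple T) : (T * n.-tuple T)%type := (thead t, [tuple of behead t]).
have gK : cancel tcons g.
  by move=> [x t]; congr pair; apply: val_inj.
have mg : measurable_fun [set: n.+1.-tuple T] g.
  apply/measurable_fun_pair => /=; first exact: measurable_tnth.
  exact: measurable_behead.
exists (fun k => g @^-1` F k).
  by rewrite -preimage_bigcup -FT preimage_setT.
move=> k; have [mFk Fk] := mF k; split.
  by rewrite -[X in measurable X]setTI; exact: mg.
rewrite /prod_tcons (_ : _ @^-1` _ = F k)//.
by apply/funext => p /=; rewrite gK.
Qed.

HB.instance Definition _ := @Measure_isSigmaFinite.Build _ _ _ prod_tcons push_sigma_finite.

End product_cons.

(* product of [n] copies of the one-dimensional Lebesgue measure, on the product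
   of the Borel sigma-algebras *)
Fixpoint lebesgue_tuple (R : realType) (n : nat) :
    {sigma_finite_measure set (n.-tuple (measurableTypeR R)) -> \bar R} :=
  if n is n'.+1 then
    prod_tcons (@lebesgue_measure R) (lebesgue_tuple R n')
  else \d_ [tuple].

Section lebesgue_rV.
Context {R : realType} {d : nat}.
Local Open Scope ereal_scope.

Definition lebesgue_outer (A : set 'rV[R]_d) : \bar R :=
  (lebesgue_tuple R d)^*%mu
    [set t : d.-tuple (measurableTypeR R) | A (\row_i tnth t i)].

Let outer0 : lebesgue_outer set0 = 0.
Proof. exact: outer_measure0. Qed.

Let outer_ge0 A : 0 <= lebesgue_outer A.
Proof. exact: outer_measure_ge0. Qed.

Let le_outer : {homo lebesgue_outer : A B / A `<=` B >-> A <= B}.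
Proof. by move=> A B AB; apply: le_outer_measure => t /= /AB. Qed.

Let outer_sigma : sigma_subadditive lebesgue_outer.
Proof.
move=> F; rewrite /lebesgue_outer.
apply: le_trans (outer_measure_sigma_subadditive _ _).
exact: le_outer_measure.
Qed.

HB.instance Definition _ := isOuterMeasure.Build R 'rV[R]_d lebesgue_outer
  outer0 outer_ge0 le_outer outer_sigma.

End lebesgue_rV.
Arguments lebesgue_outer R d A : clear implicits.

(* ['rV[R]_d] with the Caratheodory-measurable sets of [lebesgue_outer], i.e. all
   Lebesgue measurable sets (a complete sigma-algebra, larger than Borel) *)
Notation Rd R d := (caratheodory_type (lebesgue_outer R d)).

Section lebesgue_measure_Rd.
Context {R : realType} {d : nat}.
Local Open Scope ereal_scope.

Definition lebesgue (A : set (Rd R d)) : \bar R := lebesgue_outer R d A.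

Let measure0 : lebesgue set0 = 0.
Proof. exact: outer_measure0. Qed.

Let measure_ge0 A : 0 <= lebesgue A.
Proof. exact: outer_measure_ge0. Qed.

Let measure_semi_sigma_additive : semi_sigma_additive lebesgue.
Proof.
by move=> F mF tF mUF; exact: caratheodory_measure_sigma_additive.
Qed.

HB.instance Definition _ := isMeasure.Build _ _ _ lebesgue
  measure0 measure_ge0 measure_semi_sigma_additive.

End lebesgue_measure_Rd.
Arguments lebesgue R d A : clear implicits.

Lemma lebesgue_tuple_box (R : realType) n (A : 'I_n -> set (measurableTypeR R)) :
  (forall i, measurable (A i)) ->
  measurable [set t : n.-tuple (measurableTypeR R) | forall i, A i (tnth t i)] /\
  lebesgue_tuple R n [set t | forall i, A i (tnth t i)] =
    (\prod_(i < n) lebesgue_measure (A i))%E.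
Proof.
elim: n A => [|n ih] A mA.
  have -> : [set t : 0.-tuple (measurableTypeR R) | forall i, A i (tnth t i)] = setT.
    by apply/seteqP; split=> // t _ [].
  by split=> //=; rewrite big_ord0 diracT.
split.
  rewrite (_ : [set t | _] = \bigcap_(i in [set: 'I_n.+1]) ((@tnth _ _)^~ i @^-1` A i)).
    apply: fin_bigcap_measurable => // i _.
    by rewrite -[X in measurable X]setTI; exact: measurable_tnth.
  by apply/seteqP; split=> t /= At i => [_|]; exact: At.
have [mB muB] := ih (fun i => A (lift ord0 i)) (fun i => mA _).
rewrite /= /prod_tcons.
rewrite (_ : tcons @^-1` _ =
    A ord0 `*` [set t | forall i, A (lift ord0 i) (tnth t i)]).
  by rewrite product_measure1E// muB big_ord_recl.
apply/seteqP; split=> [[x t] /= At|[x t] /= [Ax At] i].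
  by split=> [|i]; [exact: (At ord0)|have := At (lift ord0 i); rewrite tnthS].
by case: (unliftP ord0 i) => [j|] ->//; rewrite tnthS.
Qed.

Lemma lebesgue_measurable_row (R : realType) d (A : set 'rV[R]_d) :
  measurable [set t : d.-tuple (measurableTypeR R) | A (\row_i tnth t i)] ->
  measurable (A : set (Rd R d)).
Proof.
move=> /(caratheodory_measurable_mu_ext (lebesgue_tuple R d)) mA.
suff : (lebesgue_outer R d).-caratheodory A by [].
by move=> X; exact: (mA [set t | X (\row_i tnth t i)]).
Qed.

Lemma lebesgue_box (R : realType) d (a b : 'I_d -> R) :
  (forall i, a i <= b i) ->
  measurable ([set x | forall i, a i < x 0 i <= b i] : set (Rd R d)) /\
  lebesgue R d [set x | forall i, a i < x 0 i <= b i] =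
    (\prod_i (b i - a i))%:E.
Proof.
move=> ab.
have [mA muA] := @lebesgue_tuple_box R d (fun i => `]a i, b i]%classic)
  (fun i => measurable_itv _).
set B := (X in measurable X).
have BE : [set t : d.-tuple (measurableTypeR R) | B (\row_i tnth t i)] =
    [set t | forall i, `]a i, b i]%classic (tnth t i)].
  by apply/seteqP; split=> t /= Bt i; have := Bt i; rewrite mxE in_itv.
split.
  apply: (@lebesgue_measurable_row R d B); by rewrite BE.
rewrite /lebesgue /lebesgue_outer BE measurable_mu_extE//.
rewrite -prodEFin; apply: (etrans muA).
apply: eq_bigr => i _; rewrite lebesgue_measure_itv/= lte_fin.
by case: ltgtP (ab i) => // -> _; rewrite subrr.
Qed.

(* the library norm on ['rV[R]_d] is the sup norm *)
Definition enorm (R : realType) (d : nat) (x : 'rV[R]_d) : R :=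
  Num.sqrt (\sum_i x 0 i ^+ 2).

Definition eball (R : realType) (d : nat) (x : 'rV[R]_d) (r : R) : set 'rV[R]_d :=
  [set y | enorm (y - x) < r].

(* Derivatives of complex-valued functions are taken componentwise: the library has
   no normed [R]-module structure on [R[i]]. The order in which [mpartial] applies the
   partial derivatives is immaterial on smooth functions. *)
Section derivatives.
Context {R : realType} {d : nat}.
Implicit Types (f : 'rV[R]_d -> R) (F : 'rV[R]_d -> R[i]) (b : 'I_d -> nat).

Definition partial (i : 'I_d) f : 'rV[R]_d -> R :=
  fun x => 'D_(delta_mx 0 i) f x.

Definition partials (s : seq 'I_d) f : 'rV[R]_d -> R := foldr partial f s.

(* every iterated partial derivative exists everywhere and is continuous *)
Definition smooth f := forall s : seq 'I_d,
  continuous (partials s f) /\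
  forall x i, derivable (partials s f) x (delta_mx 0 i).

Definition smoothC F := smooth (@complex.Re R \o F) /\ smooth (@complex.Im R \o F).

Definition mdeg b : nat := (\sum_i b i)%N.

Definition mpartial b f : 'rV[R]_d -> R :=
  partials (flatten [seq nseq (b i) i | i <- enum 'I_d]) f.

Definition mpartialC b F : 'rV[R]_d -> R[i] :=
  fun x => Complex (mpartial b (@complex.Re R \o F) x) (mpartial b (@complex.Im R \o F) x).

Definition l2norm (A : set 'rV[R]_d) F : \bar R :=
  'N[lebesgue R d]_2%:E[(fun x => (ComplexField.Normc.normc (F x))%:E) \_ A].

End derivatives.

(* Main.v *)
(** Outside the ball of radius [r = e^L], where [L = 1 + log(1/eps) + D2^(2/(1-s))], the hypothesis
    with [n = 1] makes [f] small. The ball of radius [r] is covered by slightly enlarged balls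
    [B(x, rho x)] whose originals overlap boundedly often (Besicovitch). In each of them [|f| <= t]
    on a large part of [omega], with [t] given by Chebyshev's inequality. By Fubini, any point [y]
    of the enlarged ball lies on a line that meets this part in a set of large one-dimensional
    measure; this set contains [N ~ L] well separated points, and Lagrange interpolation at these
    points bounds [|f y|] by [A t] plus a remainder involving derivatives of order [N]. Sobolev's
    inequality turns the hypotheses into pointwise bounds, in which the weight [(1+|x|^2)^(n/2)]
    with [n ~ delta N] compensates the factor [rho^N]; since [s < 1], the remainder is below [eps],
    while [A = e^(O(L^2))]. *)

Require Import Defs.
From HB Require Import structures.
From mathcomp Require Import all_boot all_order all_algebra.
From mathcomp Require Import all_classical all_reals all_analysis.
From mathcomp.real_closed Require Import complex.
From mathcomp Require Import measurable_realfun.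
From mathcomp Require Import ring lra.

Set Implicit Arguments.
Unset Strict Implicit.
Unset Printing Implicit Defensive.

Import Order.TTheory GRing.Theory Num.Theory.
Import numFieldNormedType.Exports.

Local Open Scope classical_set_scope.
Local Open Scope ring_scope.

(** * One-dimensional interpolation *)

Section interpolation.
Context {R : realType}.
Implicit Types (G : nat -> R -> R) (xs zs : seq R).

(** Two choices are constrained from both sides. The enlargement factor of the balls has to exceed 1
    for the covering and stay below [1 / eta]: otherwise an enlarged ball far out could reach the
    origin, and the weights at its points would not be comparable with the weight at its centre. The
    value [(3 - eta) / 2] does both. The order [N] costs about two factors [D2] per unit, one for
    the derivative and at most one for the weight, and gains [N!^(1 - s)]; the gain wins once [N]
    exceeds a multiple of [D2^(2 / (1 - s))]. This is why [L] contains that power and [N] is taken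
    proportional to [L]. The lines through [y] come from integrating over the pairs [(t, z)] that
    parametrize the points [y + t *: z], so no spherical measure occurs. Real and imaginary parts
    are interpolated separately, because the remainder rests on Rolle's theorem; a sublevel set of
    the modulus controls both at once. *)

Lemma Rolle_seq (f df : R -> R) (a : R) zs :
  (forall x : R, is_derive x 1 f (df x)) -> path <%R a zs ->
  {in a :: zs, forall z, f z = 0} ->
  exists ws, [/\ size ws = size zs, path <%R a ws,
    {in ws, forall w, w <= last a zs} & {in ws, forall w, df w = 0}].
Proof.
move=> dfP; elim: zs a => [|b zs ih] a /=; first by exists [::].
move=> /andP[ab pzs] fz.
have [ws [sws pws lws zws]] : exists ws, [/\ size ws = size zs, path <%R b ws,
    {in ws, forall w, w <= last b zs} & {in ws, forall w, df w = 0}].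
  by apply: ih => // z zz; apply: fz; rewrite inE zz orbT.
have [|||c] := @Rolle R f a b ab.
- by move=> x _; have [] := dfP x.
- apply: continuous_subspaceT => x; apply: differentiable_continuous.
  by apply/derivable1_diffP; have [] := dfP x.
- by rewrite !fz// !inE eqxx ?orbT.
move=> cab dfc; exists (c :: ws).
have bl : b <= last b zs.
  have := mem_last b zs; rewrite inE => /predU1P[->//|].
  by move=> /(allP (order_path_min lt_trans pzs))/ltW.
split; first by rewrite /= sws.
- rewrite /= (itvP cab)/=; case: (ws) pws => //= w s /andP[bw ->].
  by rewrite andbT (lt_trans _ bw)// (itvP cab).
- move=> w; rewrite inE => /predU1P[->|/lws//].
  by rewrite (le_trans _ bl)// (itvP cab).
- move=> w; rewrite inE => /predU1P[->|/zws//].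
  have [_ <-] := dfP c; by have [_ ->] := dfc.
Qed.

Lemma Rolle_iter G k (a : R) zs : (forall k (x : R), is_derive x 1 (G k) (G k.+1 x)) ->
  path <%R a zs -> {in a :: zs, forall z, G k z = 0} ->
  exists2 xi, a <= xi <= last a zs & G (k + size zs)%N xi = 0.
Proof.
move=> GP; move En : (size zs) => n; elim: n => [|n ih] in k a zs En *.
  by move/size0nil : En => -> _ /(_ a) /= Ga; exists a; rewrite ?lexx// addn0 Ga// mem_head.
move=> pzs /(Rolle_seq (GP k) pzs) [[|w ws] [sws pws lws zws]].
  by move: sws; rewrite En.
move: sws pws => /=; rewrite En => -[sws] /andP[aw pws].
have [xi /andP[wxi xil] Gxi] := ih k.+1 w ws sws pws zws.
exists xi; last by rewrite -Gxi addSnnS.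
rewrite (le_trans (ltW aw) wxi)/= (le_trans xil)// lws//.
exact: mem_last.
Qed.

Lemma derivn_size_le (p : {poly R}) n : (size p <= n.+1)%N ->
  p^`(n) = (p`_n *+ n`!)%:P.
Proof.
move=> sp; apply/polyP => i; rewrite coef_derivn coefC.
case: i => [|i]; first by rewrite addn0 ffactnn.
by rewrite nth_default ?mul0rn// (leq_trans sp)// addnS ltnS leq_addr.
Qed.

(** Lagrange interpolation with remainder, [G k] being the k-th derivative of [G 0]. Nodes within
    distance 1 of [x] make every factor of the nodal polynomial at most 1 at [x], and their
    separation bounds each Lagrange basis polynomial there by [h^-1 ^+ size xs]. *)
Lemma interpolation_bound G xs (D : set R) (x t h M : R) :
  (forall k (x : R), is_derive x 1 (G k) (G k.+1 x)) ->
  is_interval D -> 0 < h <= 1 -> 0 <= t -> pairwise (fun u v => u + h <= v) xs ->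
  D x -> {in xs, forall y, D y} -> {in xs, forall y, `|x - y| <= 1} ->
  {in xs, forall y, `|G 0 y| <= t} ->
  (forall y, D y -> `|G (size xs) y| <= M) ->
  `|G 0 x| <= (size xs)%:R * t * h^-1 ^+ size xs + M / (size xs)`!%:R.
Proof.
set N := size xs => GP iD /andP[h0 h1] t0 pxs Dx Dxs x1 Gt GM.
have M0 : 0 <= M by exact: le_trans (GM _ Dx).
have h1' : 1 <= h^-1 by rewrite invf_ge1.
have [xxs|xxs] := boolP (x \in xs).
  apply: (le_trans (Gt _ xxs)); apply: ler_wpDr; first by rewrite divr_ge0.
  rewrite -[leLHS]mul1r -[leLHS]mulr1; apply: ler_pM => //; rewrite ?mul1r//.
  - by apply: ler_peMl => //; rewrite ler1n /N; case: (xs) xxs.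
  - exact: exprn_ege1.
have sxs : sorted <%R xs.
  apply: sub_sorted (pairwise_sorted pxs) => u v; apply: lt_le_trans.
  by rewrite ltrDl.
have uxs : uniq xs by exact: lt_sorted_uniq.
have sep u v : u \in xs -> v \in xs -> u != v -> h <= `|u - v|.
  wlog uv : u v / u < v.
    move=> H ux vx uv; have : (u < v) || (v < u) by rewrite -neq_lt.
    by case/orP => ?; [|rewrite distrC]; apply: H => //; rewrite eq_sym.
  move=> ux vx _; rewrite ltr0_norm ?subr_lt0// opprB lerBrDl.
  have iu : index u xs \in gtn N by rewrite inE index_mem.
  have iv : index v xs \in gtn N by rewrite inE index_mem.
  have := (pairwiseP 0 pxs) _ _ iu iv; rewrite !nth_index//; apply.
  by rewrite -(lt_sorted_ltn_nth 0 sxs) ?nth_index.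
pose ell (y : R) : {poly R} := \prod_(z <- xs | z != y) ((y - z)^-1 *: ('X - z%:P)).
pose p := \sum_(y <- xs) (G 0 y) *: ell y.
pose w : {poly R} := \prod_(y <- xs) ('X - y%:P).
have wx0 : w.[x] != 0.
  rewrite horner_prod; rewrite prodf_seq_neq0; apply/allP => y yxs /=.
  by rewrite hornerXsubC subr_eq0; apply: contraNneq xxs => ->.
(* [x] is not a node here, so [w.[x]] can be divided by. The polynomial [q] agrees with [G 0] at [x]
   as well as at the nodes; [H 0 = G 0 - q] thus has [N + 1] zeros, and a zero of its N-th
   derivative identifies [c] with a value of [G N] divided by [N!]. *)
pose c := (G 0 x - p.[x]) / w.[x].
pose q := p + c *: w.
have ellE y z : y \in xs -> z \in xs -> (ell y).[z] = (z == y)%:R.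
  move=> yxs zxs; rewrite horner_prod; have [->|zy] := eqVneq z y.
    rewrite big1_seq// => u /andP[uy uxs']; rewrite hornerZ hornerXsubC mulVf//.
    by rewrite subr_eq0 eq_sym.
  by apply/eqP; rewrite prodf_seq_eq0; apply/hasP; exists z => //=; rewrite zy hornerZ hornerXsubC subrr mulr0 eqxx.
have pE z : z \in xs -> p.[z] = G 0 z.
  move=> zxs; rewrite horner_sum (bigD1_seq z)//= hornerZ ellE// eqxx mulr1.
  rewrite big1_seq ?addr0// => y /andP[yz yxs].
  by rewrite hornerZ ellE// eq_sym (negbTE yz) mulr0.
have size_ell y : y \in xs -> (size (ell y) <= N)%N.
  move=> yxs; rewrite /ell scaler_prod; apply: leq_trans (size_scale_leq _ _) _.
  rewrite -big_filter size_prod_XsubC size_filter.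
  rewrite /N -(count_predC (pred1 y) xs) -[ltnRHS]/(_ + _)%N.
  by rewrite -add1n leq_add// -has_count has_pred1.
have size_p : (size p <= N)%N.
  rewrite /p big_seq; apply: (big_ind (fun p : {poly R} => size p <= N)%N).
  - by rewrite size_poly0.
  - by move=> u v su sv; rewrite (leq_trans (size_polyD _ _))// geq_max su.
  - by move=> y /size_ell sy; rewrite (leq_trans (size_scale_leq _ _)).
have size_w : size w = N.+1 by rewrite /w size_prod_XsubC.
have size_q : (size q <= N.+1)%N.
  rewrite (leq_trans (size_polyD _ _))// geq_max (leq_trans size_p)//=.
  by rewrite (leq_trans (size_scale_leq _ _))// size_w.
have qN : q`_N = c.
  rewrite coefD coefZ nth_default// add0r.
  have /monicP : w \is monic by exact: monic_prod_XsubC.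
  by rewrite lead_coefE size_w/= => ->; rewrite mulr1.
pose H k y := G k y - q^`(k).[y].
have HP k (y : R) : is_derive y 1 (H k) (H k.+1 y).
  rewrite /H derivnS; apply: is_deriveB.
have Hz z : z \in x :: xs -> H 0 z = 0.
  rewrite inE /H derivn0 hornerD hornerZ => /predU1P[->|zxs].
    by rewrite divfK// addrCA subrr addr0 subrr.
  rewrite pE// horner_prod.
  suff -> : \prod_(j <- xs) ('X - j%:P).[z] = 0 by rewrite mulr0 addr0 subrr.
  by apply/eqP; rewrite prodf_seq_eq0; apply/hasP; exists z => //=; rewrite hornerXsubC subrr.
have [xi Dxi Hxi] : exists2 xi, D xi & H N xi = 0.
  pose zs := sort <=%R (x :: xs).
  have szs : sorted <%R zs.
    rewrite lt_sorted_uniq_le sort_uniq/= xxs uxs/=.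
    exact: (sort_sorted le_total).
  have zzs z : (z \in zs) = (z \in x :: xs) by rewrite mem_sort.
  have : size zs = N.+1 by rewrite size_sort.
  case: zs szs zzs => // a zs /= pzs zzs [szs].
  have Dzs z : z \in a :: zs -> D z.
    by rewrite zzs inE => /predU1P[->//|]; exact: Dxs.
  have [|xi axi] := @Rolle_iter H 0 a zs HP pzs.
    by move=> z; rewrite zzs; exact: Hz.
  rewrite szs add0n => Hxi; exists xi => //.
  by apply: iD axi; apply: Dzs; [exact: mem_head|exact: mem_last].
have cE : `|c| <= M / N`!%:R.
  move: Hxi; rewrite /H derivn_size_le// hornerC qN => /subr0_eq E.
  rewrite ler_pdivlMr ?ltr0n ?fact_gt0//.
  by rewrite -[N`!%:R]ger0_norm// -normrM mulr_natr -E GM.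
have -> : G 0 x = p.[x] + c * w.[x] by rewrite divfK// addrCA subrr addr0.
apply: le_trans (ler_normD _ _) _; apply: lerD.
  rewrite horner_sum; apply: le_trans (ler_norm_sum _ _ _) _.
  apply: (@le_trans _ _ (\sum_(y <- xs) t * h^-1 ^+ N)); last first.
    by rewrite big_const_seq count_predT iter_addr_0 -mulrA mulr_natl.
  rewrite big_seq [leRHS]big_seq; apply: ler_sum => y yxs.
  rewrite hornerZ normrM ler_pM// ?Gt// horner_prod normr_prod big_mkcond/=.
  rewrite -[N]count_predT -iter_mulr_1 -big_const_seq/=.
  rewrite big_seq [leRHS]big_seq; apply: ler_prod => z zxs.
  case: ifPn => zy; last by rewrite ler01.
  rewrite normr_ge0/= hornerZ hornerXsubC normrM -[leRHS]mulr1.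
  rewrite ler_pM//; last exact: x1.
  by rewrite normfV lef_pV2 ?posrE ?sep// 1?eq_sym// normr_gt0 subr_eq0 eq_sym.
rewrite normrM -[leRHS]mulr1; apply: ler_pM => //.
rewrite horner_prod normr_prod -[leRHS](expr1n _ N).
rewrite -[N]count_predT -iter_mulr_1 -big_const_seq/=.
rewrite big_seq [leRHS]big_seq; apply: ler_prod => y yxs.
by rewrite normr_ge0/= hornerXsubC x1.
Qed.

(** Greedy choice from the left: the next point [x] is taken within [h] of the infimum of what is
    left. The points below [x + h], which are then dropped, lie in an interval of length [2 * h], so
    each choice costs at most that much measure. *)
Lemma separated_points (A : set R) (h : R) n : 0 < h ->
  measurable (A : set (measurableTypeR R)) -> has_lbound A ->
  ((n%:R * (2 * h))%:E <= lebesgue_measure A)%E ->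
  exists xs, [/\ size xs = n, pairwise (fun u v => u + h <= v) xs & {in xs, forall x, A x}].
Proof.
move=> h0; elim: n A => [|n ih] A mA lA An; first by exists [::].
have A0 : A !=set0.
  apply/set0P/negP => /eqP A0; move: An; rewrite A0 measure0 lee_fin leNgt.
  by rewrite mulr_gt0// mulr_gt0.
have [x Ax xA] := inf_adherent h0 (conj A0 lA).
pose A' := A `&` `[x + h, +oo[%classic.
have mA' : measurable (A' : set (measurableTypeR R)).
  by apply: measurableI => //; exact: measurable_itv.
have [||xs [sxs pxs xsA]] := ih A' mA'.
- by case: lA => l lA; exists l => y [/lA].
- pose J := `[inf A, inf A + 2 * h[%classic.
  have AA' : A `<=` A' `|` J.
    move=> y Ay; have [xy|xy] := leP (x + h) y; [left|right].
      by split => //=; rewrite in_itv/= xy.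
    rewrite /J/= in_itv/= ge_inf//= (lt_trans xy)//.
    by rewrite mulr_natl mulr2n addrA ltrD2r.
  have mmJ : measurable (J : set (measurableTypeR R)) by exact: measurable_itv.
  have mJ : lebesgue_measure J = (2 * h)%:E.
    by rewrite /J lebesgue_measure_itv/= lte_fin ltrDl mulr_gt0// -EFinB addrAC subrr add0r.
  have : (lebesgue_measure A <= lebesgue_measure A' + (2 * h)%:E)%E.
    apply: (@le_trans _ _ (lebesgue_measure (A' `|` J))).
      apply: le_measure => //; rewrite inE//; exact: measurableU.
    by rewrite -mJ; apply: measureU2.
  move=> /(le_trans An); rewrite -leeBlDr// -EFinB; apply: le_trans.
  by rewrite lee_fin -[n.+1%:R]natr1; lra.
exists (x :: xs); split; first by rewrite /= sxs.
- rewrite /= pxs andbT; apply/allP => y /xsA[_] /=.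
  by rewrite in_itv/= andbT.
- by move=> y; rewrite inE => /predU1P[->//|/xsA[]].
Qed.

Lemma sublevel_interpolation G n (D A : set R) (x t sigma M : R) :
  (forall k (x : R), is_derive x 1 (G k) (G k.+1 x)) ->
  is_interval D -> D `<=` `[0, 1]%classic -> D x -> A `<=` D ->
  measurable (A : set (measurableTypeR R)) ->
  0 < sigma <= 1 -> (sigma%:E <= lebesgue_measure A)%E -> 0 <= t ->
  (forall y, A y -> `|G 0 y| <= t) -> (forall y, D y -> `|G n y| <= M) ->
  `|G 0 x| <= n%:R * t * (2 * n%:R / sigma) ^+ n + M / n`!%:R.
Proof.
move=> GP iD D01 Dx AD mA /andP[s0 s1] sA t0 At DM.
case: n DM => [|n] DM.
  by rewrite !mul0r add0r fact0 divr1 DM.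
(* This [h] makes the measure required for [n.+1] separated points equal to [sigma]. Order zero is
   split off above; there the claim is the bound by [M]. *)
pose h := sigma / (2 * n.+1%:R).
have h0 : 0 < h by rewrite divr_gt0// mulr_gt0.
have [||xs [sxs pxs xsA]] := @separated_points A h n.+1 h0 mA.
- by exists 0 => y /AD/D01 /=; rewrite in_itv/= => /andP[].
- have -> // : n.+1%:R * (2 * h) = sigma.
  by rewrite /h mulrCA mulrA [LHS]mulrC divfK// mulf_neq0.
rewrite -[2 * _ / _]invrK invf_div -/h -{1 2 3}sxs.
apply: (@interpolation_bound G xs D) => //.
- rewrite h0 ler_pdivrMr ?mulr_gt0// mul1r (le_trans s1)//.
  by rewrite -natrM ler1n.
- by move=> y /xsA/AD.
- move=> y /xsA/AD/D01; move: (D01 _ Dx); rewrite /= !in_itv/=.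
  by move=> /andP[? ?] /andP[? ?]; rewrite ler_norml; lra.
- by move=> y /xsA/At.
- by rewrite sxs.
Qed.

End interpolation.

(** * Smooth functions along lines *)

Section smooth_functions.
Context {R : realType} {d : nat}.
Implicit Types (f : 'rV[R]_d -> R) (x y z v : 'rV[R]_d).

Local Notation e_ i := (delta_mx 0 i : 'rV[R]_d).

Lemma is_derive_line f x v (t : R) : derivable f (x + t *: v) v ->
  is_derive t 1 (fun t : R => f (x + t *: v)) ('D_v f (x + t *: v)).
Proof.
have E : (fun h : R => h^-1 *: (((fun t : R => f (x + t *: v)) \o shift t) (h *: 1) - f (x + t *: v)))
    = (fun h : R => h^-1 *: ((f \o shift (x + t *: v)) (h *: v) - f (x + t *: v))).
  apply/funext => h /=; congr (_ *: (f _ - _)).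
  by rewrite scaler1 scalerDl addrA addrAC addrC.
by move=> df; split; rewrite /derivable /derive E.
Qed.

Lemma MVT_line f x v (c : R) : (forall y, derivable f y v) ->
  exists2 t : R, `|t| <= `|c| & f (x + c *: v) - f x = c * 'D_v f (x + t *: v).
Proof.
move=> df; pose g (t : R) := f (x + t *: v); pose dg (t : R) := 'D_v f (x + t *: v).
have gP (t : R) : is_derive t 1 g (dg t) by exact: is_derive_line.
have cg : continuous g.
  by move=> t; apply: differentiable_continuous; apply/derivable1_diffP; have [] := gP t.
have g0 : g 0 = f x by rewrite /g scale0r addr0.
have [c0|c0] := leP 0 c.
  have [t tc] := MVT_segment c0 (fun t _ => gP t) (continuous_subspaceT cg).
  rewrite g0 subr0 mulrC => gE; exists t => //.
  by rewrite !ger0_norm// (itvP tc).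
have [t tc] := MVT_segment (ltW c0) (fun t _ => gP t) (continuous_subspaceT cg).
rewrite g0 sub0r mulrN => gE; exists t.
  by rewrite !ler0_norm ?(itvP tc)// ?lerN2 ?(itvP tc)// ltW.
by rewrite mulrC -[RHS]opprK -gE opprB.
Qed.

(** Meant for the intermediate points of the mean value theorem: their dependence on [h] is
    arbitrary, only their size is controlled. *)
Lemma cvg0_le_norm (F : set_system R) {FF : Filter F} (t : R -> R) (c : R) :
  F --> (0 : R) -> (forall h, `|t h| <= `|h * c|) -> t @ F --> (0 : R).
Proof.
move=> F0 th; apply/cvgr0Pnorm_lt => e e0.
have /cvgr0Pnorm_lt/(_ _ e0) : (fun h : R => h * c) @ F --> (0 : R).
  by rewrite -(mul0r c); apply: cvgM; [exact: F0|exact: cvg_cst].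
by apply: filterS => h; exact: le_lt_trans.
Qed.

Lemma cvg_shift2 (F : set_system R) {FF : Filter F} f (r s : R -> R) x v w :
  {for x, continuous f} -> r @ F --> (0 : R) -> s @ F --> (0 : R) ->
  f (x + r h *: v + s h *: w) @[h --> F] --> f x.
Proof.
move=> cf r0 s0; apply: cvg_comp; last exact: cf.
have : x + r h *: v + s h *: w @[h --> F] --> x + 0 *: v + 0 *: w.
  apply: cvgD; last by apply: cvgZ s0 _; exact: cvg_cst.
  by apply: cvgD; [exact: cvg_cst|apply: cvgZ r0 _; exact: cvg_cst].
by rewrite !scale0r !addr0.
Qed.

Definition C1 f := forall i,
  (forall x, derivable f x (e_ i)) /\ continuous (partial i f).

(** The increment [h *: z] is made one coordinate at a time, through the truncations [tr k] of [z].
    Each step is a mean value of one partial derivative, and continuity of that derivative lets the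
    intermediate point tend to [p]. *)
Lemma C1_is_derive f x z (t : R) : C1 f ->
  is_derive t 1 (fun t : R => f (x + t *: z)) (\sum_i z 0 i * partial i f (x + t *: z)).
Proof.
move=> fC1; set p := x + t *: z.
pose tr k := \row_(i < d) if (i < k)%N then z 0 i else 0.
have main k : (k <= d)%N ->
    h^-1 * (f (p + h *: tr k) - f p) @[h --> (0 : R)^'] -->
      \sum_(i < d | (i < k)%N) z 0 i * partial i f p.
  elim: k => [|k ih] kd.
    have -> : tr 0 = 0 by apply/rowP => i; rewrite !mxE ltn0.
    rewrite big_pred0//; apply: cvg_near_cst; apply: nearW => h.
    by rewrite scaler0 addr0 subrr mulr0.
  pose ik := Ordinal kd.
  have trS : tr k.+1 = tr k + z 0 ik *: e_ ik.
    apply/rowP => i; rewrite !mxE eqxx/= ltnS leq_eqVlt.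
    have -> : (i == k :> nat) = (i == ik) by [].
    by case: eqVneq => [->|_] /=; rewrite ?ltnn ?mulr1 ?add0r// mulr0 addr0.
  have /choice[s sP] (h : R) : exists s : R, `|s| <= `|h * z 0 ik| /\
      f (p + h *: tr k.+1) - f (p + h *: tr k) =
      (h * z 0 ik) * partial ik f (p + h *: tr k + s *: e_ ik).
    have [s sh E] := MVT_line (p + h *: tr k) (h * z 0 ik) (fC1 ik).1.
    by exists s; split=> //; rewrite -E trS scalerDr addrA scalerA.
  rewrite (bigD1 ik)//= (eq_bigl (fun i : 'I_d => (i < k)%N)); last first.
    move=> i; rewrite ltnS leq_eqVlt.
    have -> : (i == k :> nat) = (i == ik) by [].
    by case: eqVneq => [->|_] /=; rewrite ?ltnn ?andbT.
  apply: (@cvg_trans _ ((z 0 ik * partial ik f (p + h *: tr k + s h *: e_ ik) +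
      h^-1 * (f (p + h *: tr k) - f p)) @[h --> (0 : R)^'])).
    apply: near_eq_cvg; near=> h.
    rewrite -[f (p + h *: tr k.+1)](subrK (f (p + h *: tr k))) (sP h).2.
    have h0 : h != 0 by near: h; exact: nbhs_dnbhs_neq.
    by field.
  apply: cvgD; last exact: ih (ltnW kd).
  apply: cvgM; first exact: cvg_cst.
  apply: cvg_shift2; first exact: (fC1 ik).2.
    exact: nbhs_dnbhs.
  by apply: (@cvg0_le_norm _ _ s (z 0 ik)) => [|h]; [exact: nbhs_dnbhs|have [] := sP h].
have := main d (leqnn d).
have -> : tr d = z by apply/rowP => i; rewrite !mxE ltn_ord.
rewrite (eq_bigl xpredT) => [|i]; last by rewrite ltn_ord.
set S := \sum_i _ => cS.
have dfp : derivable f p z /\ 'D_z f p = S.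
  have E : (fun h : R => h^-1 *: ((f \o shift p) (h *: z) - f p)) =
      (fun h : R => h^-1 * (f (p + h *: z) - f p)).
    by apply/funext => h /=; rewrite [h *: z + p]addrC.
  rewrite /derivable /derive E; split; last exact: cvg_lim.
  by apply/cvg_ex; exists S.
by rewrite -dfp.2; apply: is_derive_line; exact: dfp.1.
Unshelve. all: by end_near. Qed.

(** Schwarz's theorem. The second difference of [f] over a square of side [h] equals, by two mean
    values taken in either order, [h * h] times either mixed derivative at a nearby point; then [h]
    tends to 0 from the right. *)
Lemma partialC f i j : C1 f -> C1 (partial i f) -> C1 (partial j f) ->
  partial i (partial j f) = partial j (partial i f).
Proof.
have key k l (g : 'rV[R]_d -> R) x h : C1 g -> C1 (partial k g) -> exists st : R * R,
    [/\ `|st.1| <= `|h|, `|st.2| <= `|h| &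
    g (x + h *: e_ l + h *: e_ k) - g (x + h *: e_ k) - (g (x + h *: e_ l) - g x) =
    h * h * partial l (partial k g) (x + st.1 *: e_ k + st.2 *: e_ l)].
  move=> gC gkC; pose G y := g (y + h *: e_ l) - g y.
  have GP (y : 'rV[R]_d) : is_derive y (e_ k) G (partial k g (y + h *: e_ l) - partial k g y).
    apply: is_deriveB; last by split => //; exact: (gC k).1.
    have E : (fun h0 : R => h0^-1 *: (((fun y => g (y + h *: e_ l)) \o shift y) (h0 *: e_ k)
          - g (y + h *: e_ l)))
        = (fun h0 : R => h0^-1 *: ((g \o shift (y + h *: e_ l)) (h0 *: e_ k) - g (y + h *: e_ l))).
      by apply/funext => h0 /=; rewrite addrA.
    by split; rewrite /derivable /derive ?E//; exact: ((gC k).1 (y + h *: e_ l)).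
  have [s sh] := MVT_line x h (fun y => @ex_derive _ _ _ _ _ _ _ (GP y)).
  rewrite derive_val.
  have [t th ->] := MVT_line (x + s *: e_ k) h (gkC l).1.
  rewrite /G mulrA => E; exists (s, t); split => //=.
  by rewrite -E; congr (_ - _ - _); rewrite addrAC.
move=> fC fiC fjC; apply/funext => x.
have [st1 st1P] := choice (fun h => key j i f x h fC fjC).
have [st2 st2P] := choice (fun h => key i j f x h fC fiC).
have lim (g : 'rV[R]_d -> R) (s t : R -> R) k l : continuous g ->
    (forall h, `|s h| <= `|h|) -> (forall h, `|t h| <= `|h|) ->
    g (x + s h *: e_ k + t h *: e_ l) @[h --> (0 : R)^'+] --> g x.
  move=> cg sh th; have F0 : (0 : R)^'+ --> (0 : R) by exact: cvg_within.
  apply: cvg_shift2; first exact: cg.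
    by apply: (cvg0_le_norm (c := 1)) => // h; rewrite mulr1.
  by apply: (cvg0_le_norm (c := 1)) => // h; rewrite mulr1.
have l1 := lim _ (fun h => (st1 h).1) (fun h => (st1 h).2) j i (fjC i).2
  (fun h => let: And3 a _ _ := st1P h in a) (fun h => let: And3 _ a _ := st1P h in a).
have l2 := lim _ (fun h => (st2 h).1) (fun h => (st2 h).2) i j (fiC j).2
  (fun h => let: And3 a _ _ := st2P h in a) (fun h => let: And3 _ a _ := st2P h in a).
rewrite -(cvg_lim (@Rhausdorff R) l1); apply: (cvg_lim (@Rhausdorff R)).
apply: cvg_trans l2; apply: near_eq_cvg; near=> h.
have h0 : 0 < h by near: h; exact: nbhs_right_gt.
have hh : h * h != 0 by rewrite mulf_neq0// gt_eqF.
have [_ _ E1] := st1P h; have [_ _] := st2P h; move: E1.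
rewrite (addrAC x (h *: e_ j)).
move: (partial i (partial j f) _) (partial j (partial i f) _) => a b E1 E2.
by apply: (mulfI hh); rewrite -E1 -E2; ring.
Unshelve. all: by end_near. Qed.

Lemma smooth_partials f s : smooth f -> smooth (partials s f).
Proof. by move=> sf s'; rewrite /partials -foldr_cat; exact: sf. Qed.

Lemma smooth_C1 f : smooth f -> C1 f.
Proof.
by move=> sf i; split; [by move=> x; exact: (sf [::]).2|exact: (sf [:: i]).1].
Qed.

Lemma partials_rcons f i s : smooth f ->
  partial i (partials s f) = partials s (partial i f).
Proof.
move=> sf; elim: s => //= j s <-.
have sC t : C1 (partials t f) by apply: smooth_C1; exact: smooth_partials.
by apply: partialC; [exact: (sC s)|exact: (sC (i :: s))|exact: (sC (j :: s))].
Qed.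

Lemma partials_perm f s s' : smooth f -> perm_eq s s' -> partials s f = partials s' f.
Proof.
move=> sf; elim: s s' => [|i s ih] s' ss'.
  by move: ss'; rewrite perm_sym => /perm_nilP ->.
have is' : i \in s' by rewrite -(perm_mem ss') mem_head.
case/splitPr : is' ss' => s1 s2.
rewrite perm_sym -[i :: s2]cat1s perm_catCA/= perm_cons perm_sym => /ih /= ->.
rewrite /partials !foldr_cat/= -!/(partials _ _).
by rewrite partials_rcons//; exact: smooth_partials.
Qed.

(** Interpolation and Sobolev's inequality produce derivatives indexed by words of coordinates,
    whereas the hypotheses on [f] are indexed by multi-indices; counting letters translates one into
    the other. *)
Lemma mpartial_partials f s : smooth f ->
  partials s f = mpartial (fun i => count_mem i s) f /\
  mdeg (fun i => count_mem i s) = size s.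
Proof.
move=> sf; set b := fun i => _.
have ps : perm_eq s (flatten [seq nseq (b i) i | i <- enum 'I_d]).
  apply/allP => i _ /=; apply/eqP; rewrite count_flatten -map_comp sumnE big_map big_enum/=.
  rewrite (bigD1 i)//= big1 ?addn0 ?count_nseq/= ?eqxx ?mul1n// => j /negbTE ij.
  by rewrite count_nseq/= ij.
split; first exact: partials_perm.
rewrite (perm_size ps) size_flatten /shape -map_comp sumnE big_map big_enum/=.
by apply: eq_bigr => i _ /=; rewrite size_nseq.
Qed.

(** The k-th derivative along [z] of [partials s f], expanded over words of length [k]. The
    accumulator [s] keeps every summand an iterated coordinate derivative, the only kind on which
    bounds are available. *)
Fixpoint dirpartials z k s f : 'rV[R]_d -> R :=
  if k is k'.+1 then fun x => \sum_i z 0 i * dirpartials z k' (i :: s) f x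
  else partials s f.

Lemma is_derive_dirpartials f x z k s (t : R) : smooth f ->
  is_derive t 1 (fun t : R => dirpartials z k s f (x + t *: z))
    (dirpartials z k.+1 s f (x + t *: z)).
Proof.
move=> sf; elim: k s => [|k ih] s /=.
  by apply: C1_is_derive; apply: smooth_C1; exact: smooth_partials.
have <- : \sum_i (fun t : R => z 0 i * dirpartials z k (i :: s) f (x + t *: z)) =
    (fun t : R => \sum_i z 0 i * dirpartials z k (i :: s) f (x + t *: z)).
  by apply/funext => u; rewrite fct_sumE.
have iP i : is_derive t 1 (fun t : R => z 0 i * dirpartials z k (i :: s) f (x + t *: z))
    (z 0 i * dirpartials z k.+1 (i :: s) f (x + t *: z)) by exact: is_deriveZ.
exact: is_derive_sum.
Qed.

Lemma dirpartials_le f x z (c B : R) k s : (forall i, `|z 0 i| <= c) ->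
  (forall s', size s' = (k + size s)%N -> `|partials s' f x| <= B) ->
  `|dirpartials z k s f x| <= (d%:R * c) ^+ k * B.
Proof.
move=> zc; elim: k s => [|k ih] s H /=; first by rewrite mul1r H.
apply: le_trans (ler_norm_sum _ _ _) _.
rewrite exprS -!mulrA mulr_natl -[d in _ *+ d]card_ord -sumr_const.
apply: ler_sum => i _; rewrite normrM ler_pM// ih// => s' ss'.
by apply: H; rewrite ss' /= addnS.
Qed.

End smooth_functions.

(** * Lebesgue measure on row vectors *)

Section lebesgue_rows.
Context {R : realType}.
Local Notation T := (measurableTypeR R).

(** [lebesgue R d] lives on row vectors with all Lebesgue measurable sets, while Fubini's theorem is
    applied on tuples with the product of Borel sigma-algebras. Measurability of a preimage under
    [rowt] says that a set of row vectors is Borel. *)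
Definition rowt d (t : d.-tuple T) : 'rV[R]_d := \row_i tnth t i.
Definition trow d (x : 'rV[R]_d) : d.-tuple T := [tuple (x 0 i : T) | i < d].

Lemma rowtK d : cancel (@rowt d) (@trow d).
Proof. by move=> t; apply: eq_from_tnth => i; rewrite tnth_mktuple mxE. Qed.

Lemma trowK d : cancel (@trow d) (@rowt d).
Proof. by move=> x; apply/rowP => i; rewrite mxE tnth_mktuple. Qed.

Lemma rowtE d (t : d.-tuple T) i : rowt t 0 i = tnth t i.
Proof. by rewrite mxE. Qed.

Lemma lebesgue_rowt d (A : set 'rV[R]_d) : measurable (@rowt d @^-1` A) ->
  lebesgue R d A = lebesgue_tuple R d (@rowt d @^-1` A).
Proof. by move=> mA; rewrite /lebesgue /lebesgue_outer measurable_mu_extE. Qed.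

Lemma measurable_trow d : measurable_fun [set: Rd R d] (@trow d : Rd R d -> _).
Proof.
move=> _ A mA; rewrite setTI; apply: lebesgue_measurable_row.
by have -> : [set t | (@trow d @^-1` A) (\row_i tnth t i)] = A
  by apply/funext => t /=; rewrite -/(rowt t) rowtK.
Qed.

Lemma measurable_fun_rowt d d' (T' : measurableType d') (f : 'rV[R]_d -> T') :
  measurable_fun setT (f \o @rowt d) -> measurable_fun [set: Rd R d] (f : Rd R d -> T').
Proof.
move=> mf; have -> : f = (f \o @rowt d) \o @trow d by apply/funext => x /=; rewrite trowK.
exact: measurableT_comp mf (@measurable_trow d).
Qed.

Lemma ge0_integral_rowt d (A : set 'rV[R]_d) (f : 'rV[R]_d -> \bar R) :
  measurable (@rowt d @^-1` A) -> measurable_fun [set: d.-tuple T] (f \o @rowt d : d.-tuple T -> \bar R) ->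
  (forall x, 0 <= f x)%E ->
  (\int[lebesgue R d]_(x in A) f x =
   \int[lebesgue_tuple R d]_(t in @rowt d @^-1` A) f (rowt t))%E.
Proof.
move=> mA mf f0; pose B := @rowt d @^-1` A.
have AE : A = @trow d @^-1` B by apply/funext => x; rewrite /B /preimage /mkset trowK.
transitivity (\int[pushforward (lebesgue R d) (@trow d : Rd R d -> _)]_(t in B) (f \o @rowt d) t)%E.
  rewrite (ge0_integral_pushforward (@measurable_trow d))//.
  - by rewrite -AE; apply: eq_integral => x _ /=; rewrite trowK.
  - exact: measurable_funTS.
  - by move=> t _; exact: f0.
apply: eq_measure_integral => [|mt C mC _]; first exact: measurable_trow.
rewrite /= /pushforward.
have E : @rowt d @^-1` (@trow d @^-1` C) = C.
  by apply/funext => t; rewrite /preimage /mkset rowtK.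
by apply: etrans (lebesgue_rowt _) _; rewrite E.
Qed.

(** [U] is the union of the cubes with rational centre and half-side [k.+1%:R^-1] that it contains,
    a countable family. If [2 / k.+1] is below [e], such a cube around a point stays inside the ball
    of radius [e] about that point. *)
Lemma open_measurable_rowt d (U : set 'rV[R]_d) : open U -> measurable (@rowt d @^-1` U).
Proof.
move=> oU.
pose box (q : {ffun 'I_d -> rat} * nat) : set (d.-tuple T) :=
  [set t | forall i, `]ratr (q.1 i) - q.2.+1%:R^-1, ratr (q.1 i) + q.2.+1%:R^-1[%classic (tnth t i)].
pose F q := if `[< box q `<=` @rowt d @^-1` U >] then box q else set0.
have -> : @rowt d @^-1` U = \bigcup_q F q.
  apply/seteqP; split => [t Ut|t [q _]]; last first.
    by rewrite /F; case: ifPn => // /asboolP; exact.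
  have /nbhs_ballP[e /= e0 etU] : nbhs (rowt t) U by exact: open_nbhs_nbhs.
  have [k ke] : exists k : nat, 2 * k.+1%:R^-1 < e.
    exists (Num.truncn (2 / e)); rewrite ltr_pdivrMr// mulrC -ltr_pdivrMr//.
    exact: truncnS_gt.
  have k0 : 0 < k.+1%:R^-1 :> R by rewrite invr_gt0.
  have /choice[q qP] (i : 'I_d) : exists q : rat,
      ratr q \in `]tnth t i - k.+1%:R^-1, tnth t i + k.+1%:R^-1[.
    by apply: rat_in_itvoo; rewrite ltrD2l (lt_trans _ k0)// oppr_lt0.
  have tq : box ([ffun i => q i], k) t.
    by move=> i /=; have := qP i; rewrite ffunE !in_itv/=; move: (_^-1) => r /andP[? ?]; apply/andP; split; lra.
  exists ([ffun i => q i], k) => //; rewrite /F; case: ifPn => // /asboolP[] u ub.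
  apply: etU; rewrite /ball/= /mx_ball/=; split => // j i; rewrite ord1 /ball/= !mxE.
  move: ke (ub i) (qP i); rewrite /= ffunE !in_itv/=.
  move: (_^-1) => r ke /andP[? ?] /andP[? ?].
  by rewrite ltr_norml; apply/andP; split; lra.
apply: countable_bigcupT_measurable => // q; rewrite /F; case: ifPn => // _.
exact: (lebesgue_tuple_box (fun i => measurable_itv _)).1.
Qed.

Lemma continuous_measurable_rowt d (f : 'rV[R]_d -> R) : continuous f ->
  measurable_fun [set: d.-tuple T] (f \o @rowt d : d.-tuple T -> T).
Proof.
move=> cf; apply: (measurability _ (RGenOInfty.measurableE R)) => //.
move=> /= _ [_ [a ->] <-]; rewrite setTI preimage_itvoy.
apply: (@open_measurable_rowt d (f @^-1` [set y | a < y])).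
by apply: open_comp; [move=> x _; exact: cf|exact: open_gt].
Qed.

Definition affinet d (y : 'I_d -> R) (c : R) (t : d.-tuple T) : d.-tuple T :=
  [tuple (y i + c * tnth t i : T) | i < d].

Lemma measurable_affinet d (y : 'I_d -> R) c : measurable_fun setT (affinet y c).
Proof.
apply/measurable_fun_tnthP => i.
have -> : (@tnth d T)^~ i \o affinet y c = (fun t => y i + c * tnth t i).
  by apply/funext => t /=; rewrite tnth_mktuple.
apply: measurable_funD => //; apply: measurable_funM => //.
exact: measurable_tnth.
Qed.

(** The push-forward of Lebesgue measure under the affine map, multiplied by [c], agrees with
    Lebesgue measure on half-open intervals, hence everywhere. *)
Lemma lebesgue_measure_affine (y c : R) (A : set T) : 0 < c -> measurable A ->
  lebesgue_measure ((fun x => y + c * x) @^-1` A) = (c^-1%:E * lebesgue_measure A)%E.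
Proof.
move=> c0 mA; pose phi (x : T) : T := y + c * x.
have mphi : measurable_fun setT phi.
  by apply: measurable_funD => //; apply: measurable_funM.
pose cn := NngNum (ltW c0).
have /(_ mphi) : lebesgue_measure A = mscale cn (pushforward lebesgue_measure phi) A.
  move=> mphi'; apply: lebesgue_measure_unique => // _ [[a b]] _ <-.
  rewrite /= /mscale /= /pushforward.
  have -> : phi @^-1` `]a, b] = `](a - y) / c, (b - y) / c]%classic.
    apply/seteqP; split => x /=; rewrite !in_itv/= ltr_pdivrMr// ler_pdivlMr// ltrBlDl lerBrDl.
      by rewrite mulrC.
    by rewrite mulrC.
  rewrite !lebesgue_measure_itv/= !lte_fin ltr_pM2r ?invr_gt0// ltrD2r.
  case: ifP => _; last by rewrite mule0.
  by rewrite -!EFinB -EFinM; congr EFin; field; rewrite gt_eqF.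
rewrite /= /mscale /= /pushforward => {1}->; by rewrite muleA -EFinM mulVf ?gt_eqF// mul1e.
Qed.

Lemma lebesgue_tuple_affine d (y : 'I_d -> R) (c : R) (A : set (d.-tuple T)) :
  0 < c -> measurable A ->
  lebesgue_tuple R d (affinet y c @^-1` A) = ((c^-1 ^+ d)%:E * lebesgue_tuple R d A)%E.
Proof.
move=> c0; elim: d y A => [|d ih] y A mA.
  rewrite expr0 mul1e; congr (lebesgue_tuple R 0 _).
  by apply/funext => t; rewrite /preimage /mkset [affinet _ _ _]tuple0 [t]tuple0.
pose phi (p : T * d.-tuple T) : T * d.-tuple T :=
  (y ord0 + c * p.1, affinet (fun i => y (lift ord0 i)) c p.2).
have mphi : measurable_fun setT phi.
  apply/measurable_fun_pair => /=.
    by apply: measurable_funD => //; apply: measurable_funM.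
  exact: measurableT_comp (measurable_affinet _ _) measurable_snd.
have E : tcons @^-1` (affinet y c @^-1` A) = phi @^-1` (tcons @^-1` A).
  apply/funext => -[x t]; rewrite /preimage /mkset /=; congr (A _); apply: eq_from_tnth => i.
  rewrite tnth_mktuple; case: (unliftP ord0 i) => [j|] -> //.
  by rewrite !tnthS tnth_mktuple.
have mtA : measurable ((@tcons _ T d : T * d.-tuple T -> _) @^-1` A).
  by rewrite -[X in measurable X]setTI; exact: measurable_tcons.
rewrite /= /prod_tcons E.
have cd0 : 0 <= c ^+ d.+1 by rewrite exprn_ge0// ltW.
pose cn := NngNum cd0.
have /(_ mphi) -> : (lebesgue_measure \x lebesgue_tuple R d)%E (tcons @^-1` A) =
    mscale cn (pushforward (lebesgue_measure \x lebesgue_tuple R d)%E phi) (tcons @^-1` A).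
  move=> mphi'; apply: product_measure_unique => // B C mB mC.
  rewrite /= /mscale /= /pushforward.
  have -> : phi @^-1` (B `*` C) = ((fun x => y ord0 + c * x) @^-1` B) `*`
     (affinet (fun i => y (lift ord0 i)) c @^-1` C) by [].
  have mB' : measurable ((fun x : T => y ord0 + c * x : T) @^-1` B).
    have mf : measurable_fun setT (fun x : T => y ord0 + c * x : T).
      by apply: measurable_funD => //; apply: measurable_funM.
    by rewrite -[X in measurable X]setTI; exact: mf.
  have mC' : measurable (affinet (fun i => y (lift ord0 i)) c @^-1` C).
    by rewrite -[X in measurable X]setTI; exact: measurable_affinet.
  rewrite product_measure1E//.
  apply: etrans (congr1 (mule (c ^+ d.+1)%:E) (congr2 mule
    (lebesgue_measure_affine (y ord0) c0 mB) (ih _ _ mC))) _.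
  move: (lebesgue_measure B) (lebesgue_tuple R d C) => u v.
  transitivity ((c ^+ d.+1 * (c^-1 * c^-1 ^+ d))%:E * (u * v))%E.
    by rewrite !EFinM -!muleA; congr (_ * (_ * _))%E; rewrite muleCA.
  rewrite -exprS exprVn divff ?mul1e//.
  by rewrite expf_neq0// gt_eqF.
by rewrite /= /mscale /= muleA -EFinM -exprMn mulVf ?gt_eqF// expr1n mul1e.
Qed.

(** Fubini in place of polar coordinates. For [t] in [1/2, 1] the set of [z] with [y + t *: z] in
    [S] has [t^-d >= 1] times the measure of [S], so the pairs [(t, z)] have measure at least half
    that of [S]. Since [t >= 1/2], all these [z] lie in a cube of side [4 * b]; if every section in
    [t] were shorter than [sigma], the pairs would have measure at most [sigma * (4 * b) ^+ d], a
    contradiction. *)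
Lemma line_section d (S : set 'rV[R]_d) (y : 'rV[R]_d) (b sigma : R) :
  measurable (@rowt d @^-1` S) -> 0 < b -> 0 < sigma ->
  (forall s, S s -> forall i, `|s 0 i - y 0 i| <= b) ->
  ((2 * sigma * (4 * b) ^+ d)%:E < lebesgue R d S)%E ->
  exists z : 'rV[R]_d, (forall i, `|z 0 i| <= 2 * b) /\
    let A := [set t : R | 1 / 2 <= t <= 1 /\ S (y + t *: z)] in
    measurable (A : set T) /\ (sigma%:E <= lebesgue_measure A)%E.
Proof.
move=> mS b0 s0 Sb; rewrite lebesgue_rowt// => Sm.
pose S' := @rowt d @^-1` S.
pose J : set T := `[1 / 2, 1]%classic.
pose E : set (T * d.-tuple T) :=
  [set p | J p.1 /\ S' [tuple (y 0 i + p.1 * tnth p.2 i : T) | i < d]].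
have mJ : measurable J by exact: measurable_itv.
have mE : measurable E.
  have -> : E = (J `*` setT) `&` ((fun p => [tuple (y 0 i + p.1 * tnth p.2 i : T) | i < d]) @^-1` S').
    by apply/seteqP; split => p; rewrite /E/=; tauto.
  apply: measurableI; first exact: measurableX.
  rewrite -[X in measurable X]setTI; apply: (_ : measurable_fun _ _) => //.
  apply/measurable_fun_tnthP => i.
  rewrite [X in measurable_fun _ X](_ : _ = (fun p => y 0 i + p.1 * tnth p.2 i)).
    apply: measurable_funD => //; apply: measurable_funM => //.
    exact: measurableT_comp (measurable_tnth i) measurable_snd.
  by apply/funext => p /=; rewrite tnth_mktuple.
have xsE t : J t -> xsection E t = affinet (fun i => y 0 i) t @^-1` S'.
  move=> Jt; apply/seteqP; split => u; rewrite /xsection/= inE /E/=; last by [].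
  by case.
have ysE u : ysection E u = [set t : R | 1 / 2 <= t <= 1 /\ S (y + t *: rowt u)].
  have rE t : rowt [tuple (y 0 i + t * tnth u i : T) | i < d] = y + t *: rowt u.
    by apply/rowP => i; rewrite !mxE tnth_mktuple.
  by apply/seteqP; split => t;
    rewrite /ysection/= inE /E /J/= in_itv/= /S' /preimage/= rE.
pose Z : set (d.-tuple T) := [set u | forall i, `[- (2 * b), 2 * b]%classic (tnth u i)].
have EZ u t : ysection E u t -> Z u.
  rewrite ysE/= => -[/andP[t1 t2] /Sb H' i]; rewrite /= in_itv/= -ler_norml.
  move: (H' i); rewrite !mxE addrAC subrr add0r normrM => H2.
  rewrite mulrC -ler_pdivrMr// mulrC; apply: le_trans H2; apply: ler_wpM2r => //.
  by rewrite ger0_norm; lra.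
have [u uP] : exists u, (sigma%:E <= lebesgue_measure (ysection E u))%E.
  apply: contrapT => /forallNP H.
  have [mZ Zm] := @lebesgue_tuple_box R d (fun=> `[- (2 * b), 2 * b]%classic)
    (fun=> measurable_itv _).
  have Zm' : lebesgue_tuple R d Z = ((4 * b) ^+ d)%:E.
    rewrite Zm (eq_bigr (fun=> (4 * b)%:E)) => [|i _].
      by rewrite prodEFin prodr_const card_ord.
    rewrite lebesgue_measure_itv/= lte_fin ifT; last by lra.
    by rewrite -EFinB; congr EFin; lra.
  have := indic_fubini_tonelli lebesgue_measure (lebesgue_tuple R d) mE.
  rewrite indic_fubini_tonelli_FE// indic_fubini_tonelli_GE//.
  apply/eqP; rewrite gt_eqF//.
  apply: (@le_lt_trans _ _ (sigma * (4 * b) ^+ d)%:E).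
    apply: (@le_trans _ _ (\int[lebesgue_tuple R d]_(u in Z) sigma%:E)%E); last first.
      by rewrite integral_cst//= Zm' -EFinM.
    rewrite [leRHS]integral_mkcond; apply: ge0_le_integral => //.
    - exact: measurable_fun_ysection.
    - by apply/(measurable_restrictT _ _).1.
    - move=> u _; rewrite patchE; case: ifPn => [_|uZ] /=.
        by apply: ltW; rewrite ltNge; apply/negP; exact: H.
      rewrite (_ : ysection E u = set0) ?measure0//.
      by apply/seteqP; split => // t /EZ Zu; move: uZ; rewrite notin_setE.
  apply: (@lt_le_trans _ _ (\int[lebesgue_measure]_(t in J) lebesgue_tuple R d S')%E).
    rewrite integral_cst//= lebesgue_measure_itv/= lte_fin ifT; last by lra.
    rewrite -EFinB (_ : 1 - 1 / 2 = 1 / 2); last by lra.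
    rewrite (_ : sigma * _ = (2 * sigma * (4 * b) ^+ d) * (1 / 2)); last by lra.
    by rewrite EFinM lte_pmul2r// lte_fin; lra.
  apply: (@le_trans _ _ (\int[lebesgue_measure]_(t in J) lebesgue_tuple R d (xsection E t))%E).
    apply: ge0_le_integral => //.
    - by apply: measurable_funTS; exact: measurable_fun_xsection.
    - move=> t Jt; rewrite xsE// lebesgue_tuple_affine//; last first.
        by move: Jt; rewrite /J/= in_itv/= => /andP[]; lra.
      rewrite -[leLHS]mul1e lee_wpmul2r// lee_fin.
      move: Jt; rewrite /J/= in_itv/= => /andP[t1 t2].
      by rewrite exprn_ege1// invf_ge1//; lra.
  apply: ge0_subset_integral => //.
  by apply: measurable_fun_xsection.
exists (rowt u); split.
  have [t tE] : ysection E u !=set0.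
    apply/set0P/negP => /eqP E0; move: uP; rewrite E0 measure0 lee_fin.
    by rewrite leNgt s0.
  by move=> i; have := EZ _ _ tE i; rewrite /= in_itv/= -ler_norml mxE.
by rewrite /= -ysE; split => //; apply: measurable_ysection.
Qed.

End lebesgue_rows.

(** * Sobolev inequality on the unit cube *)

Section sobolev.
Context {R : realType}.
Local Notation T := (measurableTypeR R).

Lemma sobolev1 (g dg : R -> R) (a : R) :
  (forall x : R, is_derive x 1 g (dg x)) -> continuous dg ->
  ((g a ^+ 2)%:E <=
   \int[lebesgue_measure]_(x in `[a, (a + 1)%R]) (2 * (g x ^+ 2 + dg x ^+ 2))%:E)%E.
Proof.
move=> gP cdg.
have cg : continuous g.
  by move=> x; apply: differentiable_continuous; apply/derivable1_diffP; have [] := gP x.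
(* The linear factor is [-1] at [a] and vanishes at [a + 1], so [dk], the derivative of [k],
   integrates to [g a ^+ 2]; in between the factor has modulus at most 1. *)
pose k (x : R) := (x - (a + 1)) * (g x * g x).
pose dk (x : R) := g x * g x + (x - (a + 1)) * (2 * (g x * dg x)).
have kP (x : R) : is_derive x 1 k (dk x).
  have := is_deriveM (f := fun x => x - (a + 1)) (g := fun x => g x * g x) (x := x) (v := 1)
    (df := 1) (dg := 2 * (g x * dg x)).
  move=> H; have {H} : is_derive x 1 k ((x - (a + 1)) *: (2 * (g x * dg x)) + (g x * g x) *: 1).
    apply: H.
      by rewrite -[X in is_derive _ _ _ X]subr0; apply: is_deriveB.
    have -> : 2 * (g x * dg x) = g x *: dg x + g x *: dg x.
      by rewrite mulr_natl mulr2n.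
    exact: is_deriveM.
  by move=> /is_derive_eq; apply; rewrite /dk/= /GRing.scale/=; ring.
have cdk : continuous dk.
  move=> x; apply: cvgD; first by apply: cvgM; exact: cg.
  apply: cvgM; first by apply: cvgB; [exact: cvg_id|exact: cvg_cst].
  apply: cvgM; first exact: cvg_cst.
  by apply: cvgM; [exact: cg|exact: cdg].
have ck : continuous k.
  by move=> x; apply: differentiable_continuous; apply/derivable1_diffP; have [] := kP x.
have aa : a < a + 1 by rewrite ltrDl.
have <- : (\int[lebesgue_measure]_(x in `[a, (a + 1)%R]) (dk x)%:E = (g a ^+ 2)%:E)%E.
  rewrite (@continuous_FTC2 _ dk k)//.
  - by rewrite /k subrr mul0r -EFinB; congr EFin; rewrite expr2; ring.
  - exact: continuous_subspaceT.
  - split.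
    + by move=> x _; have [] := kP x.
    + by apply: cvg_at_right_filter; exact: ck.
    + by apply: cvg_at_left_filter; exact: ck.
  - by move=> x _; rewrite derive1E; have [_ ->] := kP x.
have cpt : compact `[a, a + 1] by exact: segment_compact.
apply: le_integral => //.
- by apply: continuous_compact_integrable => //; exact: continuous_subspaceT.
- apply: (@continuous_compact_integrable _ (fun x => 2 * (g x ^+ 2 + dg x ^+ 2))) => //.
  apply: continuous_subspaceT => x; apply: cvgM; first exact: cvg_cst.
  by apply: cvgD; apply: cvgM; (exact: cg || exact: cdg).
move=> x; rewrite inE/= in_itv/= => /andP[ax xa]; rewrite lee_fin /dk.
have : (x - (a + 1)) * (2 * (g x * dg x)) <= g x ^+ 2 + dg x ^+ 2; last first.
  by have := sqr_ge0 (dg x); rewrite !expr2; lra.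
apply: le_trans (ler_norm _) _; rewrite normrM.
have : `|2 * (g x * dg x)| <= g x ^+ 2 + dg x ^+ 2.
  have := sqr_ge0 (g x + dg x); have := sqr_ge0 (g x - dg x).
  rewrite !expr2 ler_norml; move: (g x) (dg x) => u v ? ?.
  by apply/andP; split; lra.
apply: le_trans; rewrite -[leRHS]mul1r ler_wpM2r//.
by rewrite ler_norml; lra.
Qed.

Lemma ge0_integral_tcons n (h : n.+1.-tuple T -> \bar R) :
  measurable_fun setT h -> (forall t, 0 <= h t)%E ->
  (\int[lebesgue_tuple R n.+1]_t h t =
   \int[lebesgue_measure]_x \int[lebesgue_tuple R n]_t h (tcons (x, t)))%E.
Proof.
move=> mh h0.
transitivity (\int[pushforward (lebesgue_measure \x lebesgue_tuple R n)%E
   (@tcons _ T n : T * n.-tuple T -> _)]_t h t)%E.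
  apply: eq_measure_integral => [|mt A mA _] //; exact: measurable_tcons.
rewrite (ge0_integral_pushforward (@measurable_tcons _ T n))//.
rewrite fubini_tonelli1//.
  exact: measurableT_comp mh (@measurable_tcons _ T n).
by move=> t; exact: h0.
Qed.

Definition ubox n (p : n.-tuple T) : set (n.-tuple T) :=
  [set t | forall i, `[tnth p i, tnth p i + 1]%classic (tnth t i)].

Lemma measurable_ubox n (p : n.-tuple T) : measurable (ubox p).
Proof.
by have [] := lebesgue_tuple_box (fun i => measurable_itv `[tnth p i, tnth p i + 1]).
Qed.

(** For the induction on the number of integrated variables: [f] stays a function on the whole
    space, [t] moves the base point [w] in the coordinates [iota], and derivatives remain words over
    the indices of the whole space. *)
Definition embed D n (w : 'rV[R]_D) (iota : 'I_n -> 'I_D) (t : 'rV[R]_n) : 'rV[R]_D :=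
  w + \sum_i t 0 i *: delta_mx 0 (iota i).

Lemma cvg_embed D n (w : 'rV[R]_D) (iota : 'I_n -> 'I_D) (F : set_system 'rV[R]_n)
    (FF : Filter F) (x : 'rV[R]_n) :
  (forall i, t 0 i @[t --> F] --> x 0 i) -> embed w iota t @[t --> F] --> embed w iota x.
Proof.
move=> Fx; apply: cvgD; first exact: cvg_cst.
apply: cvg_big => [|i _]; first exact: add_continuous.
by apply: cvgZ; [exact: Fx|exact: cvg_cst].
Qed.

Lemma continuous_embed D n (w : 'rV[R]_D) (iota : 'I_n -> 'I_D) : continuous (embed w iota).
Proof.
move=> x; apply: (@cvg_embed _ _ w iota (nbhs x) (nbhs_filter x) x) => i.
exact: coord_continuous.
Qed.

Lemma measurable_sum_partials D n (w : 'rV[R]_D) (iota : 'I_n -> 'I_D)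
    (f : 'rV[R]_D -> R) (W : seq (seq 'I_D)) : smooth f ->
  measurable_fun [set: n.-tuple T]
    (fun t => \sum_(s <- W) (partials s f (embed w iota (rowt t))) ^+ 2 : T).
Proof.
move=> sf; apply: measurable_sum => s; apply: measurable_funX.
apply: (@continuous_measurable_rowt R n (partials s f \o embed w iota)) => x.
by apply: continuous_comp; [exact: continuous_embed|exact: (sf s).1].
Qed.

(** Each step applies [sobolev1] in the first coordinate, which is then absorbed into the base
    point. The list of words doubles: each word occurs without and with the derivative in that
    coordinate. It is appended by [rcons] because the induction hypothesis is applied to the
    function already differentiated. *)
Lemma sobolev_embed D n (iota : 'I_n -> 'I_D) :
  exists W : seq (seq 'I_D), [/\ size W = (2 ^ n)%N, forall s, s \in W -> (size s <= n)%N &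
  forall (f : 'rV[R]_D -> R) (w : 'rV[R]_D) (p : n.-tuple T), smooth f ->
  ((f (embed w iota (rowt p)) ^+ 2)%:E <= (2 ^+ n)%:E *
   \int[lebesgue_tuple R n]_(t in ubox p)
     (\sum_(s <- W) (partials s f (embed w iota (rowt t))) ^+ 2)%:E)%E].
Proof.
elim: n iota => [|n ih] iota.
  exists [:: [::]]; split => // [s|f w p sf]; first by rewrite inE => /eqP ->.
  have E (x : 'rV[R]_0) : embed w iota x = w by rewrite /embed big_ord0 addr0.
  under eq_integral do rewrite big_seq1 /= E.
  rewrite E integral_cst//=; last exact: measurable_ubox.
  rewrite mul1e diracE mem_set ?mule1//.
  by move=> [].
have [W [sW Wn WP]] := ih (iota \o lift ord0).
exists (W ++ map (rcons^~ (iota ord0)) W); split.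
- by rewrite size_cat size_map sW expnS mul2n addnn.
- move=> s; rewrite mem_cat => /orP[/Wn/leqW//|/mapP[s' /Wn s'n ->]].
  by rewrite size_rcons.
move=> f w p sf; set W' := W ++ _.
pose e0 : 'rV[R]_D := delta_mx 0 (iota ord0).
have embedS (x : T) (t : n.-tuple T) : embed w iota (rowt (tcons (x, t))) =
    embed (w + x *: e0) (iota \o lift ord0) (rowt t).
  rewrite /embed big_ord_recl addrA rowtE (tnth_nth x)/=; congr (_ + _).
  by apply: eq_bigr => i _; rewrite !rowtE tnthS.
pose p0 : T := thead p; pose p' : n.-tuple T := [tuple of behead p].
have pE : p = tcons (p0, p') by rewrite [LHS]tuple_eta.
pose h t : \bar R := (\sum_(s <- W') (partials s f (embed w iota (rowt t))) ^+ 2)%:E.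
have mh : measurable_fun [set: n.+1.-tuple T] h.
  by apply/measurable_EFinP; exact: measurable_sum_partials.
have h0 t : (0 <= h t)%E by rewrite lee_fin sumr_ge0// => s _; exact: sqr_ge0.
pose H := h \_ (ubox p).
have mH : measurable_fun [set: n.+1.-tuple T] H.
  apply/(measurable_restrictT _ _).1; first exact: measurable_ubox.
  by apply: measurable_funTS; exact: mh.
have H0 t : (0 <= H t)%E by rewrite /H patchE; case: ifP.
have mHt : measurable_fun [set: (T * n.-tuple T)] (H \o @tcons _ T n).
  exact: measurableT_comp mH (@measurable_tcons _ T n).
pose I x := (\int[lebesgue_tuple R n]_t H (tcons (x, t)))%E.
have I0 x : (0 <= I x)%E by exact: integral_ge0.
have mI : measurable_fun [set: T] I.
  by apply: (measurable_fun_fubini_tonelli_F _ mHt) => x; exact: H0.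
pose J : set T := `[p0, p0 + 1]%classic.
have mJ : measurable J by exact: measurable_itv.
have IE x : J x -> I x = (\int[lebesgue_tuple R n]_(t in ubox p') h (tcons (x, t)))%E.
  move=> Jx; rewrite [RHS]integral_mkcond; apply: eq_integral => t _.
  rewrite /H !patchE; congr (if _ then _ else _); rewrite [in LHS]pE.
  apply/idP/idP; rewrite !inE => K i.
    by have := K (lift ord0 i); rewrite !tnthS.
  by case: (unliftP ord0 i) => [j|] -> //; rewrite !tnthS.
pose g (x : R) := f (embed w (iota \o lift ord0) (rowt p') + x *: e0).
pose dg (x : R) := partial (iota ord0) f (embed w (iota \o lift ord0) (rowt p') + x *: e0).
have gE x : g x = f (embed (w + x *: e0) (iota \o lift ord0) (rowt p')).
  by rewrite /g /embed addrAC.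
have dgE x : dg x = partial (iota ord0) f (embed (w + x *: e0) (iota \o lift ord0) (rowt p')).
  by rewrite /dg /embed addrAC.
have gP (x : R) : is_derive x 1 g (dg x).
  by apply: is_derive_line; exact: (sf [::]).2.
have cdg : continuous dg.
  move=> x; apply: (@continuous_comp _ _ _ (fun x : R => embed w (iota \o lift ord0) (rowt p') + x *: e0)).
    by apply: cvgD; [exact: cvg_cst|apply: cvgZ; [exact: cvg_id|exact: cvg_cst]].
  exact: (sf [:: iota ord0]).1.
rewrite [in leLHS]pE embedS -gE.
apply: le_trans (sobolev1 p0 gP cdg) _.
have hE : (\int[lebesgue_tuple R n.+1]_(t in ubox p) h t =
    \int[lebesgue_measure]_x I x)%E.
  by rewrite integral_mkcond -/H ge0_integral_tcons.
apply: (@le_trans _ _ ((2 ^+ n.+1)%:E * \int[lebesgue_measure]_(x in J) I x)%E); last first.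
  rewrite hE; apply: lee_wpmul2l; first by rewrite lee_fin exprn_ge0.
  by apply: ge0_subset_integral.
rewrite -ge0_integralZl//; last exact: measurable_funTS.
have cg : continuous g.
  by move=> x; apply: differentiable_continuous; apply/derivable1_diffP; have [] := gP x.
apply: ge0_le_integral => //.
- by move=> x _; rewrite lee_fin mulr_ge0// addr_ge0// sqr_ge0.
- apply: measurable_funTS; apply/measurable_EFinP; apply: measurable_funM => //.
  apply: measurable_funD; apply: measurable_funX; exact: continuous_measurable_fun.
- by apply: measurable_funTS; exact: measurable_funeM.
move=> x Jx; rewrite IE//.
have sdf : smooth (partial (iota ord0) f) by exact: (smooth_partials [:: iota ord0]).
have B1 := WP f (w + x *: e0) p' sf; have B2 := WP _ (w + x *: e0) p' sdf.
rewrite EFinM EFinD gE dgE.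
apply: (le_trans (lee_wpmul2l _ (leeD B1 B2))); first by rewrite lee_fin.
rewrite -muleDr; last 2 first.
- by [].
- by rewrite ge0_adde_def// inE; apply: integral_ge0 => t _; rewrite lee_fin sumr_ge0// => s _; exact: sqr_ge0.
rewrite muleA -EFinM -exprS -ge0_integralD//; last 5 first.
- exact: measurable_ubox.
- by move=> t _; rewrite lee_fin sumr_ge0// => s _; exact: sqr_ge0.
- by apply: measurable_funTS; apply/measurable_EFinP; exact: measurable_sum_partials.
- by move=> t _; rewrite lee_fin sumr_ge0// => s _; exact: sqr_ge0.
- by apply: measurable_funTS; apply/measurable_EFinP; exact: measurable_sum_partials.
rewrite le_eqVlt; apply/orP; left; apply/eqP; congr (_ * _)%E.
apply: eq_integral => t _; rewrite /h -EFinD; congr EFin.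
rewrite big_cat/= big_map embedS; congr (_ + _); apply: eq_bigr => s _.
by rewrite /partials foldr_rcons.
Qed.

Lemma sobolev_unit_cube d : exists W : seq (seq 'I_d),
  [/\ size W = (2 ^ d)%N, forall s, s \in W -> (size s <= d)%N &
  forall (f : 'rV[R]_d -> R) (p : 'rV[R]_d), smooth f ->
  ((f p ^+ 2)%:E <= (2 ^+ d)%:E * \sum_(s <- W)
   \int[lebesgue R d]_(x in [set x | forall i, (p 0 i <= x 0 i <= p 0 i + 1)%R])
     (partials s f x ^+ 2)%:E)%E].
Proof.
have [W [sW Wd WP]] := sobolev_embed (@id 'I_d).
exists W; split => // f p sf.
have embedE (x : 'rV[R]_d) : embed 0 (@id 'I_d) x = x by rewrite /embed add0r -row_sum_delta.
have := WP f 0 (trow p) sf; rewrite embedE trowK => /le_trans; apply.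
apply: lee_wpmul2l; first by rewrite lee_fin exprn_ge0.
under eq_integral do rewrite -sumEFin.
rewrite ge0_integral_sum//; last 3 first.
- exact: measurable_ubox.
- move=> s; apply: measurable_funTS; apply/measurable_EFinP; apply: measurable_funX.
  apply: (@continuous_measurable_rowt R d (partials s f \o embed 0 id)) => x.
  by apply: continuous_comp; [exact: continuous_embed|exact: (sf s).1].
- by move=> s t _; rewrite lee_fin sqr_ge0.
apply: lee_sum => s _.
have pE : ubox (trow p) = @rowt R d @^-1` [set x | forall i, p 0 i <= x 0 i <= p 0 i + 1].
  by apply/seteqP; split => t /= H i; have := H i; rewrite /= in_itv/= tnth_mktuple mxE.
rewrite ge0_integral_rowt -?pE.
- by under eq_integral do rewrite embedE.
- exact: measurable_ubox.
- apply/measurable_EFinP; apply: measurable_funX.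
  by apply: (@continuous_measurable_rowt R d (partials s f)); exact: (sf s).1.
- by move=> x; rewrite lee_fin sqr_ge0.
Qed.

End sobolev.

(** * Euclidean norm and Besicovitch covering *)

Section euclidean_norm.
Context {R : realType} {d : nat}.
Implicit Types x y z u v : 'rV[R]_d.

Definition dot x y : R := \sum_i x 0 i * y 0 i.

Lemma dotC x y : dot x y = dot y x.
Proof. by apply: eq_bigr => i _; rewrite mulrC. Qed.

Lemma dotDl x y z : dot (x + y) z = dot x z + dot y z.
Proof. by rewrite -big_split; apply: eq_bigr => i _; rewrite mxE mulrDl. Qed.

Lemma dotZl (c : R) x y : dot (c *: x) y = c * dot x y.
Proof. by rewrite mulr_sumr; apply: eq_bigr => i _; rewrite mxE mulrA. Qed.

Lemma dotDr x y z : dot z (x + y) = dot z x + dot z y.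
Proof. by rewrite dotC dotDl !(dotC z). Qed.

Lemma dotZr (c : R) x y : dot x (c *: y) = c * dot x y.
Proof. by rewrite dotC dotZl dotC. Qed.

Lemma dot_ge0 x : 0 <= dot x x.
Proof. by apply: sumr_ge0 => i _; rewrite -expr2 sqr_ge0. Qed.

Lemma enorm_sqr x : enorm x ^+ 2 = dot x x.
Proof.
rewrite sqr_sqrtr; first by apply: eq_bigr => i _; rewrite expr2.
by apply: sumr_ge0 => i _; exact: sqr_ge0.
Qed.

Lemma enorm_ge0 x : 0 <= enorm x. Proof. exact: sqrtr_ge0. Qed.

Lemma enorm_eq0 x : enorm x = 0 -> x = 0.
Proof.
move=> /(congr1 (fun t => t ^+ 2)); rewrite enorm_sqr expr0n/= => /eqP.
rewrite psumr_eq0 => [/allP H|i _]; last by rewrite -expr2 sqr_ge0.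
apply/rowP => i; have := H i (mem_index_enum i).
by rewrite /= -expr2 sqrf_eq0 mxE => /eqP.
Qed.

Lemma enorm_le x (c : R) : 0 <= c -> (enorm x <= c) = (dot x x <= c ^+ 2).
Proof. by move=> c0; rewrite -enorm_sqr ler_sqr// ?nnegrE ?enorm_ge0. Qed.

Lemma enormZ (c : R) x : enorm (c *: x) = `|c| * enorm x.
Proof.
apply/eqP; rewrite -(eqrXn2 (n := 2))// ?enorm_ge0 ?mulr_ge0 ?enorm_ge0//.
by rewrite enorm_sqr dotZl dotZr exprMn enorm_sqr mulrA -expr2 real_normK// num_real.
Qed.

Lemma enormN x : enorm (- x) = enorm x.
Proof. by rewrite -scaleN1r enormZ normrN1 mul1r. Qed.

Lemma enormB x y : enorm (x - y) = enorm (y - x).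
Proof. by rewrite -enormN opprB. Qed.

Lemma dot_le x y : dot x y <= enorm x * enorm y.
Proof.
have [/enorm_eq0 ->|x0] := eqVneq (enorm x) 0.
  by rewrite -[0 : 'rV_d](scale0r 0) dotZl mul0r mulr_ge0// enorm_ge0.
have [/enorm_eq0 ->|y0] := eqVneq (enorm y) 0.
  by rewrite -[0 : 'rV_d](scale0r 0) dotZr mul0r mulr_ge0// enorm_ge0.
have xp : 0 < enorm x by rewrite lt_neqAle eq_sym x0 enorm_ge0.
have yp : 0 < enorm y by rewrite lt_neqAle eq_sym y0 enorm_ge0.
have := dot_ge0 (enorm y *: x + - enorm x *: y).
rewrite dotDl !dotDr !dotZl !dotZr -!enorm_sqr (dotC y x).
move: (enorm x) (enorm y) (dot x y) xp yp => a b c a0 b0 H.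
have ab : 0 < 2 * (a * b) by rewrite mulr_gt0// mulr_gt0.
by rewrite -(ler_pM2l ab); nra.
Qed.

Lemma enormD x y : enorm (x + y) <= enorm x + enorm y.
Proof.
rewrite enorm_le ?addr_ge0 ?enorm_ge0// dotDl !dotDr (dotC y x) -!enorm_sqr.
have := dot_le x y; rewrite sqrrD -mulr_natl; lra.
Qed.

Lemma coord_le_enorm x i : `|x 0 i| <= enorm x.
Proof.
rewrite -(ler_pXn2r (n := 2))// ?nnegrE ?enorm_ge0// enorm_sqr real_normK ?num_real//.
by rewrite /dot (bigD1 i)//= expr2 lerDl sumr_ge0// => j _; rewrite -expr2 sqr_ge0.
Qed.

Lemma enorm_le_coord x (c : R) : 0 <= c -> (forall i, `|x 0 i| <= c) -> enorm x <= d%:R * c.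
Proof.
move=> c0 xc; rewrite enorm_le ?mulr_ge0//.
apply: (@le_trans _ _ (\sum_(i < d) c ^+ 2)).
  apply: ler_sum => i _; rewrite -expr2 -[_ ^+ 2]real_normK ?num_real//.
  by rewrite ler_pXn2r ?nnegrE.
rewrite sumr_const card_ord -[_ ^+ 2 *+ _]mulr_natl exprMn ler_wpM2r ?sqr_ge0//.
by rewrite -natrX ler_nat; case: (d) => // n; rewrite leq_pmulr.
Qed.

Lemma continuous_enorm : continuous (@enorm R d).
Proof.
move=> x; apply: (@continuous_comp _ _ _ (fun x => \sum_i x 0 i ^+ 2) Num.sqrt); last exact: sqrt_continuous.
suff H (F : set_system 'rV[R]_d) : Filter F -> (forall i, t 0 i @[t --> F] --> x 0 i) ->
    \sum_i t 0 i ^+ 2 @[t --> F] --> \sum_i x 0 i ^+ 2.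
  by apply: (H (nbhs x) (nbhs_filter x)) => i; exact: coord_continuous.
move=> FF Fx; apply: cvg_big => [|i _]; first exact: add_continuous.
by rewrite expr2; under eq_fun do rewrite expr2; apply: cvgM; exact: Fx.
Qed.

Lemma open_eball x (r : R) : open (eball x r).
Proof.
rewrite (_ : eball x r = (fun y => enorm (y - x)) @^-1` [set t | t < r])//.
apply: open_comp; last exact: open_lt.
move=> y _; apply: (@continuous_comp _ _ _ (fun y => y - x)); last exact: continuous_enorm.
by have := @continuousB _ _ _ id (cst x) y; apply; [exact: cvg_id|exact: cst_continuous].
Qed.

Lemma measurable_eball x (r : R) : measurable (@rowt R d @^-1` eball x r).
Proof. by apply: open_measurable_rowt; exact: open_eball. Qed.

Lemma compact_closed_eball (r : R) : compact [set x : 'rV[R]_d | enorm x <= r].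
Proof.
apply: (@subclosed_compact _ _ [set x : 'rV[R]_d | forall i, `[- r, r]%classic (x 0 i)]).
- rewrite (_ : [set x | _] = @enorm R d @^-1` [set t | t <= r])//.
  apply: closed_comp; last exact: closed_le.
  by move=> y _; exact: continuous_enorm.
- apply: (@rV_compact R d (fun=> `[- r, r]%classic)) => i; exact: segment_compact.
- move=> x /= xr i; rewrite in_itv/= -ler_norml.
  exact: le_trans (coord_le_enorm _ _) xr.
Qed.

(* The hypothesis forces an angle of less than 60 degrees between [u] and [v]. *)
Lemma close_directions u v : u != 0 -> v != 0 ->
  (forall i, `|(enorm u)^-1 * u 0 i - (enorm v)^-1 * v 0 i| < d.+1%:R^-1) ->
  (enorm (u - v) < enorm u) || (enorm (u - v) < enorm v).
Proof.
move=> u0 v0 uv.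
have up : 0 < enorm u by rewrite lt_neqAle enorm_ge0 andbT eq_sym; apply: contraNneq u0 => /enorm_eq0 ->.
have vp : 0 < enorm v by rewrite lt_neqAle enorm_ge0 andbT eq_sym; apply: contraNneq v0 => /enorm_eq0 ->.
pose w := (enorm u)^-1 *: u - (enorm v)^-1 *: v.
have w1 : dot w w < 1.
  have : enorm w <= d%:R * d.+1%:R^-1.
    apply: enorm_le_coord; first by rewrite invr_ge0.
    by move=> i; rewrite /w !mxE; exact/ltW/uv.
  have : d%:R * d.+1%:R^-1 < 1 :> R by rewrite ltr_pdivrMr// mul1r ltr_nat.
  move=> H /le_lt_trans/(_ H) {}H.
  by rewrite -enorm_sqr expr_lt1// enorm_ge0.
have dE : dot u v > 2^-1 * (enorm u * enorm v).
  move: w1; rewrite /w -scaleNr dotDl !dotDr !dotZl !dotZr (dotC v u) -!enorm_sqr.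
  move: (enorm u) (enorm v) (dot u v) up vp => a b t a0 b0.
  have -> : a^-1 * (a^-1 * a ^+ 2) + a^-1 * (- b^-1 * t) +
      (- b^-1 * (a^-1 * t) + - b^-1 * (- b^-1 * b ^+ 2))
     = 2 - 2 * (t / (a * b)) by field; rewrite !gt_eqF.
  by rewrite -ltr_pdivlMr ?mulr_gt0//; lra.
have dd : enorm (u - v) ^+ 2 = enorm u ^+ 2 + enorm v ^+ 2 - 2 * dot u v.
  by rewrite !enorm_sqr -scaleN1r dotDl !dotDr !dotZl !dotZr (dotC v u); lra.
have [vu|vu] := leP (enorm v) (enorm u); apply/orP; [left|right].
  rewrite -(ltr_pXn2r (n := 2))// ?nnegrE ?enorm_ge0// dd.
  by move: (enorm u) (enorm v) up vp dE vu => a b; nra.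
rewrite -(ltr_pXn2r (n := 2))// ?nnegrE ?enorm_ge0// dd.
by move: (enorm u) (enorm v) up vp dE vu => a b; nra.
Qed.

(** If [z] lies in two of the balls, the centres are farther from each other than either is from
    [z]. By [close_directions] the unit vectors from [z] to them then differ by at least
    [d.+1%:R^-1] in some coordinate, so distinct centres have directions in distinct cells. *)
Lemma card_separated (I : finType) (S : {set I}) (c : I -> 'rV[R]_d) (rho : I -> R) z :
  {in S &, forall i j, i != j -> rho i <= enorm (c i - c j)} ->
  (#|[set i in S | `[< eball (c i) (rho i) z >]]| <= (2 * d).+4 ^ d)%N.
Proof.
move=> sep; set A := [set i in S | _].
have AP i : i \in A -> i \in S /\ enorm (z - c i) < rho i.
  by rewrite inE => /andP[iS /asboolP].
pose u i := c i - z.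
have uP i : i \in A -> enorm (u i) < rho i by rewrite /u enormB => /AP[].
have uij i j : i \in A -> j \in A -> i != j ->
    enorm (u i) < enorm (u i - u j) /\ enorm (u j) < enorm (u i - u j).
  move=> iA jA ij; have -> : u i - u j = c i - c j by rewrite /u opprB addrA subrK.
  split; first by rewrite (lt_le_trans (uP _ iA))// sep//; have [] := AP _ iA; have [] := AP _ jA.
  rewrite enormB (lt_le_trans (uP _ jA))// sep// 1?eq_sym//.
    by have [] := AP _ jA.
  by have [] := AP _ iA.
(* The coordinates of a unit vector, shifted by 1, lie in [0, 2]. Cells of width [d.+1%:R^-1] then
   have indices up to [2 * d + 2], below the modulus, so [inZp] does not wrap around. *)
pose cell i : {ffun 'I_d -> 'I_(2 * d).+4} :=
  [ffun k => inZp (Num.truncn (d.+1%:R * ((enorm (u i))^-1 * u i 0 k + 1)))].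
have cell_inj : {in A &, injective cell}.
  move=> i j iA jA ij; apply/eqP; apply: contraT => neij.
  have [ui uj] := uij _ _ iA jA neij.
  have nz a b : enorm (a : 'rV[R]_d) < enorm (a - b) -> enorm b < enorm (a - b) -> a != 0 /\ b != 0.
    move=> a1 b1; split; apply/eqP => z0; move: a1 b1; rewrite z0.
      by rewrite sub0r enormN ltxx.
    by rewrite subr0 ltxx.
  have [ui0 uj0] := nz _ _ ui uj.
  suff /(close_directions ui0 uj0) : forall k,
      `|(enorm (u i))^-1 * u i 0 k - (enorm (u j))^-1 * u j 0 k| < d.+1%:R^-1.
    by rewrite !ltNge (ltW ui) (ltW uj).
  move=> k.
  have bnd v : v != 0 -> 0 <= (enorm v)^-1 * v 0 k + 1 <= 2.
    move=> v0; have vp : 0 < enorm v.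
      by rewrite lt_neqAle enorm_ge0 andbT eq_sym; apply: contraNneq v0 => /enorm_eq0 ->.
    have : `|(enorm v)^-1 * v 0 k| <= 1.
      by rewrite normrM normfV (ger0_norm (enorm_ge0 _)) mulrC ler_pdivrMr// mul1r coord_le_enorm.
    by rewrite ler_norml => /andP[? ?]; apply/andP; split; lra.
  have /andP[i0 i2] := bnd _ ui0; have /andP[j0 j2] := bnd _ uj0.
  have := congr1 (fun h : {ffun 'I_d -> 'I_(2 * d).+4} => val (h k)) ij.
  rewrite !ffunE.
  move: ((enorm (u i))^-1 * u i 0 k) ((enorm (u j))^-1 * u j 0 k) i0 i2 j0 j2 => a b a0 a2 b0 b2.
  have bd (t : R) : 0 <= t + 1 -> t + 1 <= 2 -> (Num.truncn (d.+1%:R * (t + 1)) < (2 * d).+4)%N.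
    move=> t0 t2; rewrite -(ltr_nat R); apply: (@le_lt_trans _ _ (d.+1%:R * (t + 1))).
      by rewrite truncn_le mulr_ge0.
    apply: (@le_lt_trans _ _ (d.+1%:R * 2)); first by rewrite ler_wpM2l.
    by rewrite -natrM ltr_nat mulnC mulnS -addn4 addnC ltn_add2l.
  rewrite /= !modn_small ?bd// => E.
  have dp : 0 < d.+1%:R :> R by rewrite ltr0n.
  have := truncn_itv (mulr_ge0 (ltW dp) a0); have := truncn_itv (mulr_ge0 (ltW dp) b0).
  rewrite E; move: (Num.Def.trunc _) => m; rewrite -[m.+1%:R]natr1.
  have -> : a - b = (d.+1%:R * (a + 1) - d.+1%:R * (b + 1)) / d.+1%:R.
    by field; rewrite gt_eqF.
  rewrite normrM (ger0_norm (_ : 0 <= d.+1%:R^-1)) ?invr_ge0 ?(ltW dp)//.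
  rewrite ltr_pdivrMr// mulVf ?gt_eqF// ltr_norml.
  move: (d.+1%:R * _) (d.+1%:R * _) => x y /andP[? ?] /andP[? ?].
  by apply/andP; split; lra.
rewrite -(card_in_imset cell_inj); apply: leq_trans (max_card _) _.
by rewrite card_ffun !card_ord.
Qed.

(** Take the largest radius, discard the centres inside its ball, and repeat. A later centre lies
    outside the earlier and larger balls, which gives the separation in both orders of the
    indices. *)
Lemma greedy_selection (I : finType) (A : {set I}) (c : I -> 'rV[R]_d) (rho : I -> R) :
  (forall i, 0 < rho i) -> exists S : {set I},
  {in S &, forall i j, i != j -> rho i <= enorm (c i - c j)} /\
  forall i, i \in A -> exists j, [/\ j \in S, rho i <= rho j & enorm (c i - c j) < rho j].
Proof.
move=> rho0.
suff : exists S : {set I}, [/\ S \subset A,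
  {in S &, forall i j, i != j -> rho i <= enorm (c i - c j)} &
  forall i, i \in A -> exists j, [/\ j \in S, rho i <= rho j & enorm (c i - c j) < rho j]].
  by move=> [S [_ ? ?]]; exists S.
move En : #|A| => n; elim/ltn_ind: n => n ih in A En *.
have [->|/finset.set0Pn[i0 i0A]] := eqVneq A finset.set0.
  by exists finset.set0; split => // i; rewrite inE.
pose j := [arg max_(j > i0 in A) rho j]%O.
have [jA jmax] : j \in A /\ forall i, i \in A -> rho i <= rho j.
  by rewrite /j; case: arg_maxP.
pose A' := [set i in A | rho j <= enorm (c i - c j)].
have jA' : j \notin A' by rewrite inE jA/= subrr -(scale0r 0) enormZ normr0 mul0r -ltNge.
have A'A : A' \subset A by apply/fintype.subsetP => i; rewrite inE => /andP[].
have cA' : (#|A'| < n)%N.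
  by rewrite -En proper_card// properE A'A/=; apply/fintype.subsetPn; exists j.
have [S [SA' Ssep Scov]] := ih _ cA' A' erefl.
have SP i : i \in S -> i \in A /\ rho j <= enorm (c i - c j).
  by move=> /(fintype.subsetP SA'); rewrite inE => /andP[].
exists (j |: S); split.
- by rewrite finset.subUset finset.sub1set jA (fintype.subset_trans SA').
- move=> i k; rewrite !inE => /predU1P[->|iS] /predU1P[->|kS] ik.
  + by rewrite eqxx in ik.
  + by rewrite enormB; have [] := SP _ kS.
  + by have [iA jc] := SP _ iS; rewrite (le_trans (jmax _ iA)).
  + exact: Ssep.
- move=> i iA; have [iA'|] := boolP (i \in A').
    by have [k [kS ? ?]] := Scov _ iA'; exists k; rewrite inE kS orbT.
  rewrite inE iA/= -ltNge => ij; exists j; split => //; first by rewrite !inE eqxx.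
  exact: jmax.
Qed.

(** The greedy selection needs finitely many centres and covers only centres. Compactness supplies a
    finite set of them such that every [y] is within [tau * rho x] of some [x] in it; the selected
    ball containing [x] has a radius at least [rho x], so enlarging it by [tau] reaches [y]. The
    overlap is counted before the enlargement. *)
Lemma besicovitch_ball (rho : 'rV[R]_d -> R) (r tau : R) :
  (forall x, 0 < rho x) -> 0 < tau -> exists (I : finType) (S : {set I}) (c : I -> 'rV[R]_d),
  [/\ forall i, enorm (c i) <= r,
   forall z, (#|[set i in S | `[< eball (c i) (rho (c i)) z >]]| <= (2 * d).+4 ^ d)%N &
   forall y, enorm y <= r -> exists2 i, i \in S & enorm (y - c i) < (1 + tau) * rho (c i)].
Proof.
move=> rho0 tau0.
have : compact [set x : 'rV[R]_d | enorm x <= r] by exact: compact_closed_eball.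
rewrite compact_cover => /(_ _ [set x | enorm x <= r]
  (fun x => eball x (tau * rho x))) [].
- by move=> x _; exact: open_eball.
- move=> x xr; exists x => //; rewrite /eball/= subrr -(scale0r 0) enormZ normr0 mul0r.
  by rewrite mulr_gt0.
move=> D' D'r cov.
pose I := seq_sub (finmap.enum_fset D').
have [S [Ssep Scov]] := greedy_selection (finset.setT : {set I}) (fun i : I => val i)
  (fun i : I => rho0 (val i)).
exists I, S, (fun i : I => val i); split.
- by move=> i; have := D'r _ (valP i); rewrite inE.
- by move=> z; exact: (card_separated (rho := fun i : I => rho (val i))).
- move=> y /cov[x /= xD' yx].
  have [j [jS xj jc]] := Scov (SeqSub xD') (finset.in_setT _).
  exists j => //; have -> : y - val j = (x - val j) + (y - x).
    by rewrite [RHS]addrC addrA subrK.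
  apply: le_lt_trans (enormD _ _) _; rewrite mulrDl mul1r; apply: ltrD; first exact: jc.
  by apply: lt_le_trans yx _; rewrite ler_pM2l.
Qed.

End euclidean_norm.

Lemma sum_integral_overlap (R : realType) (dT : measure_display) (T : measurableType dT)
    (mu : {measure set T -> \bar R}) (I : finType) (S : {set I}) (B : I -> set T) (m : nat)
    (h : T -> \bar R) :
  (forall i, measurable (B i)) -> measurable_fun setT h -> (forall x, 0 <= h x)%E ->
  (forall z, #|[set i in S | `[< B i z >]]| <= m)%N ->
  (\sum_(i in S) \int[mu]_(x in B i) h x <= m%:R%:E * \int[mu]_x h x)%E.
Proof.
move=> mB mh h0 card_m.
have E i : (\int[mu]_(x in B i) h x = \int[mu]_x ((\1_(B i) x)%:E * h x))%E.
  rewrite integral_mkcond; apply: eq_integral => x _.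
  by rewrite patchE indicE; case: ifP; rewrite ?mul1e ?mul0e.
under eq_bigr do rewrite E.
have m1 i : measurable_fun setT (fun x : T => ((\1_(B i) x)%:E * h x)%E).
  by apply: emeasurable_funM => //; apply/measurable_EFinP; exact: measurable_indic.
have n1 i x : (0 <= (\1_(B i) x)%:E * h x)%E by rewrite mule_ge0// lee_fin.
rewrite -big_enum/= -ge0_integral_sum//.
rewrite -ge0_integralZl//.
apply: ge0_le_integral => //.
- by move=> x _; apply: sume_ge0.
- exact: emeasurable_sum.
- exact: measurable_funeM.
move=> x _; rewrite big_enum/=.
have -> : (\sum_(i in S) (\1_(B i) x)%:E * h x = \sum_(i in [set i in S | `[< B i x >]]%SET) h x)%E.
  rewrite [RHS]big_mkcond [LHS]big_mkcond; apply: eq_bigr => i _.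
  rewrite inE indicE; case: (i \in S) => //=.
  by case: asboolP => Bx; [rewrite mem_set// mul1e|rewrite memNset// mul0e].
rewrite big_const; have -> k : iter k (+%E (h x)) 0%E = (k%:R%:E * h x)%E.
  elim: k => [|k ih]; first by rewrite mul0e.
  by rewrite /= ih -[k.+1%:R]nat1r EFinD ge0_muleDl// mul1e.
by apply: lee_wpmul2r => //; rewrite lee_fin ler_nat.
Qed.

(** * Weighted pointwise bounds *)

Lemma poweR2 (R : realType) (x : \bar R) : (0 <= x -> x `^ 2 = x ^+ 2)%E.
Proof.
case: x => [x|_|//]; last by rewrite poweRyr// expe2 mulyy.
by rewrite lee_fin => x0; rewrite poweR_EFin powR_mulrn// -EFin_expe.
Qed.

Section l2norm.
Context {R : realType} {d : nat}.
Implicit Types (F : 'rV[R]_d -> R[i]) (A : set 'rV[R]_d).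
Local Notation normc := ComplexField.Normc.normc.

Lemma normc_ge0 (z : R[i]) : 0 <= normc z.
Proof. by case: z => a b; exact: sqrtr_ge0. Qed.

Lemma sqr_normc (z : R[i]) : normc z ^+ 2 = complex.Re z ^+ 2 + complex.Im z ^+ 2.
Proof. by case: z => a b /=; rewrite sqr_sqrtr// addr_ge0// sqr_ge0. Qed.

Lemma l2norm_sqr A F :
  (l2norm A F ^+ 2 = \int[lebesgue R d]_(x in A) (normc (F x) ^+ 2)%:E)%E.
Proof.
rewrite -poweR2; last exact: Lnorm_ge0.
rewrite poweR_Lnorm ?pnatr_eq0// [RHS]integral_mkcond.
apply: eq_integral => x _; rewrite !patchE; case: ifP => _.
  by rewrite abse_EFin poweR_EFin powR_mulrn// ger0_norm// normc_ge0.
by rewrite abse0 poweR0r// pnatr_eq0.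
Qed.

Lemma sqr_norm_weighted (n : nat) (w : R) (z : R[i]) : 0 <= w ->
  normc ((w `^ (n%:R / 2))%:C%C * z) ^+ 2 = w ^+ n * normc z ^+ 2.
Proof.
move=> w0; rewrite !sqr_normc; case: z => a b /=.
rewrite !mul0r subr0 addr0 !exprMn -mulrDr; congr (_ * _).
by rewrite -[LHS]powR_mulrn ?powR_ge0// -powRrM divfK ?pnatr_eq0// powR_mulrn.
Qed.

End l2norm.

(** Serves twice: to bring the weight at a point under the integral over its unit cube, and, with
    [K = 1], as Chebyshev's inequality outside a ball. *)
Lemma le_integral_weight (R : realType) (dT : measure_display) (T : measurableType dT)
    (mu : {measure set T -> \bar R}) (Q : set T) (h w : T -> R) (c K : R) :
  measurable Q -> measurable_fun setT h -> measurable_fun setT w ->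
  (forall x, 0 <= h x) -> (forall x, 0 <= w x) -> 0 <= c -> 0 <= K ->
  (forall x, Q x -> c <= K * w x) ->
  (c%:E * \int[mu]_(x in Q) (h x)%:E <= K%:E * \int[mu]_x (w x * h x)%:E)%E.
Proof.
move=> mQ mh mw h0 w0 c0 K0 cK.
have mwh : measurable_fun setT (fun x => (w x * h x)%:E).
  by apply/measurable_EFinP; exact: measurable_funM.
apply: (@le_trans _ _ (K%:E * \int[mu]_(x in Q) (w x * h x)%:E)%E); last first.
  apply: lee_wpmul2l; first by rewrite lee_fin.
  by apply: ge0_subset_integral => // x _; rewrite lee_fin mulr_ge0.
have m1 : measurable_fun Q (fun x => (w x * h x)%:E) by exact: measurable_funTS.
have m2 : measurable_fun Q (fun x => (h x)%:E).
  by apply: measurable_funTS; exact/measurable_EFinP.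
have n1 x : Q x -> (0 <= (w x * h x)%:E)%E by rewrite lee_fin mulr_ge0.
have n2 x : Q x -> (0 <= (h x)%:E)%E by rewrite lee_fin.
rewrite -!ge0_integralZl//.
apply: ge0_le_integral => //.
- by move=> x _; rewrite mule_ge0 ?lee_fin.
- by apply: measurable_funTS; apply: measurable_funeM; exact/measurable_EFinP.
- by apply: measurable_funTS; exact: measurable_funeM.
by move=> x Qx; rewrite -!EFinM lee_fin mulrA ler_wpM2r// cK.
Qed.

Section weighted_sup.
Context {R : realType} {d : nat}.
Implicit Types (u : 'rV[R]_d -> R) (p x : 'rV[R]_d).

Lemma weight_shift p x : (forall i, p 0 i <= x 0 i <= p 0 i + 1) ->
  1 + enorm p ^+ 2 <= (2 + 2 * d%:R ^+ 2) * (1 + enorm x ^+ 2).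
Proof.
move=> px.
have H : enorm p <= enorm x + d%:R.
  have -> : p = x + (p - x) by rewrite addrCA subrr addr0.
  apply: le_trans (enormD _ _) _; rewrite lerD2l -[leRHS]mulr1.
  apply: enorm_le_coord => // i; rewrite !mxE; have /andP[? ?] := px i.
  by rewrite ler_norml; lra.
have := enorm_ge0 p; have := enorm_ge0 x; have : 0 <= d%:R :> R by [].
move: (enorm p) (enorm x) (d%:R : R) H => a b c H c0 b0 a0.
have : a ^+ 2 <= (b + c) ^+ 2 by rewrite ler_sqr ?nnegrE ?addr_ge0.
have := sqr_ge0 (b - c); have := sqr_ge0 (b * c); rewrite !expr2; nra.
Qed.

Lemma continuous_measurable_Rd u : continuous u ->
  measurable_fun [set: Rd R d] (u : Rd R d -> measurableTypeR R).
Proof. by move=> cu; apply: measurable_fun_rowt; exact: continuous_measurable_rowt. Qed.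

Lemma measurable_cube p :
  measurable (@rowt R d @^-1` [set x | forall i, p 0 i <= x 0 i <= p 0 i + 1]).
Proof.
have [+ _] := lebesgue_tuple_box (fun i : 'I_d => measurable_itv `[p 0 i, p 0 i + 1]).
by congr measurable; apply/seteqP; split => t /= H i; have := H i; rewrite /= in_itv/= mxE.
Qed.

Lemma continuous_weight n : continuous (fun x => (1 + enorm x ^+ 2) ^+ n).
Proof.
move=> x; apply: (@continuous_comp _ _ _ (@enorm R d) (fun t => (1 + t ^+ 2) ^+ n)).
  exact: continuous_enorm.
apply: (@continuous_comp _ _ _ (fun t : R => 1 + t ^+ 2) (fun t => t ^+ n)).
  by apply: cvgD; [exact: cvg_cst|exact: exprn_continuous].
exact: exprn_continuous.
Qed.

(** Sobolev's inequality for [partials s u] on the unit cube with corner [p], on which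
    [weight_shift] compares the weights. [4 ^+ d] is the Sobolev constant [2 ^+ d] times the number
    of words; these have at most [d] letters, hence the orders up to [k + d]. *)
Lemma weighted_sup u (n k : nat) (M : R) (s : seq 'I_d) p : smooth u -> size s = k ->
  (forall s', (k <= size s' <= k + d)%N ->
    (\int[lebesgue R d]_x ((1 + enorm x ^+ 2) ^+ n * partials s' u x ^+ 2)%:E <= (M ^+ 2)%:E)%E) ->
  (1 + enorm p ^+ 2) ^+ n * partials s u p ^+ 2 <=
    4 ^+ d * (2 + 2 * d%:R ^+ 2) ^+ n * M ^+ 2.
Proof.
move=> su sk H.
have [W [sW Wd WP]] := @sobolev_unit_cube R d.
have := WP (partials s u) p (smooth_partials _ su).
set Kd : R := 2 + 2 * d%:R ^+ 2; set Q := [set x | _].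
have wp0 : 0 <= (1 + enorm p ^+ 2) ^+ n by rewrite exprn_ge0// addr_ge0// sqr_ge0.
have Kd0 : 0 <= Kd by rewrite addr_ge0// mulr_ge0// sqr_ge0.
have bnd s' : s' \in W ->
  (((1 + enorm p ^+ 2) ^+ n)%:E * \int[lebesgue R d]_(x in Q) (partials s' (partials s u) x ^+ 2)%:E
   <= (Kd ^+ n * M ^+ 2)%:E)%E.
  move=> s'W.
  have -> : partials s' (partials s u) = partials (s' ++ s) u by rewrite /partials foldr_cat.
  have H' : (\int[lebesgue R d]_x ((1 + enorm x ^+ 2) ^+ n * partials (s' ++ s) u x ^+ 2)%:E <=
      (M ^+ 2)%:E)%E.
    by apply: H; rewrite size_cat sk leq_addl addnC leq_add2l Wd.
  rewrite EFinM; apply: le_trans (lee_wpmul2l _ H'); last by rewrite lee_fin exprn_ge0.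
  apply: (@le_integral_weight R _ _ (lebesgue R d) Q (fun x => partials (s' ++ s) u x ^+ 2)
    (fun x => (1 + enorm x ^+ 2) ^+ n)).
  - exact: lebesgue_measurable_row (measurable_cube p).
  - by apply: measurable_funX; apply: continuous_measurable_Rd; exact: (su _).1.
  - by apply: continuous_measurable_Rd; exact: continuous_weight.
  - by move=> x; exact: sqr_ge0.
  - by move=> x; rewrite exprn_ge0// addr_ge0// sqr_ge0.
  - by [].
  - by rewrite exprn_ge0.
  - move=> x Qx; rewrite -exprMn lerXn2r ?nnegrE ?mulr_ge0 ?addr_ge0 ?sqr_ge0//.
    exact: weight_shift.
move=> /(lee_wpmul2l (_ : (0 <= ((1 + enorm p ^+ 2) ^+ n)%:E)%E)) => /(_ _) H1.
rewrite -lee_fin EFinM; apply: le_trans (H1 _) _; first by rewrite lee_fin.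
rewrite muleCA ge0_sume_distrr//; last first.
  by move=> s' _; apply: integral_ge0 => x _; rewrite lee_fin sqr_ge0.
apply: (@le_trans _ _ ((2 ^+ d)%:E * \sum_(s' <- W) (Kd ^+ n * M ^+ 2)%:E)%E).
  apply: lee_wpmul2l; first by rewrite lee_fin exprn_ge0.
  by rewrite big_seq [leRHS]big_seq; apply: lee_sum => s'; exact: bnd.
rewrite sumEFin -EFinM lee_fin big_const_seq count_predT iter_addr_0 sW -[X in _ * X]mulr_natl.
by rewrite natrX mulrA -exprMn -natrM mulrA.
Qed.

End weighted_sup.

(** * Local and global estimates *)

Section cover_integrals.
Context {R : realType} {dT : measure_display} {T : measurableType dT}.
Context (mu : {measure set T -> \bar R}).

Lemma le_measure_sublevel (D : set T) (h : T -> R) (c j m : R) :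
  measurable D -> measurable_fun setT h -> (forall x, 0 <= h x) -> 0 < c ->
  (\int[mu]_(x in D) (h x)%:E <= j%:E)%E -> (m%:E <= mu D)%E ->
  ((m - j / c)%:E <= mu (D `&` [set x | (h x <= c)%R]))%E.
Proof.
move=> mD mh h0 c0 Dj mm.
have mle : measurable [set x | h x <= c].
  by rewrite -[X in measurable X]setTI -preimage_itvNyc; exact: mh.
have mgt : measurable [set x | c < h x].
  by rewrite -[X in measurable X]setTI -preimage_itvoy; exact: mh.
have mDle := measurableI _ _ mD mle; have mDgt := measurableI _ _ mD mgt.
have gtj : (mu (D `&` [set x | (c < h x)%R]) <= (j / c)%:E)%E.
  rewrite EFinM lee_pdivlMr// muleC; apply: le_trans Dj.
  rewrite -integral_cst//.
  apply: (@le_trans _ _ (\int[mu]_(x in D `&` [set x | (c < h x)%R]) (h x)%:E)%E).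
    apply: ge0_le_integral => //.
    - by move=> x _; rewrite lee_fin ltW.
    - by apply: measurable_funTS; exact/measurable_EFinP.
    - by move=> x [_ /ltW]; rewrite lee_fin.
  apply: ge0_subset_integral => //.
  - by apply: measurable_funTS; exact/measurable_EFinP.
  - by move=> x _; rewrite lee_fin.
have DU : D = (D `&` [set x | h x <= c]) `|` (D `&` [set x | c < h x]).
  rewrite -setIUr; apply/seteqP; split => [x Dx|x []//].
  by split => //=; case: (leP (h x) c); [left|right].
rewrite EFinB leeBlDr//; apply: (le_trans mm).
rewrite {1}DU; apply: le_trans (measureU2 mu mDle mDgt) _.
exact: leeD2l.
Qed.

Lemma le_integral_cover (I : finType) (S : {set I}) (B : I -> set T) (A : set T) (h : T -> \bar R) :
  measurable A -> (forall i, measurable (B i)) -> measurable_fun setT h -> (forall x, 0 <= h x)%E ->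
  (forall x, A x -> exists2 i, i \in S & B i x) ->
  (\int[mu]_(x in A) h x <= \sum_(i in S) \int[mu]_(x in B i) h x)%E.
Proof.
move=> mA mB mh h0 AB.
under eq_bigr do rewrite integral_mkcond.
have m1 i : measurable_fun setT (h \_ (B i)).
  by apply/(measurable_restrictT _ (mB i)).1; exact: measurable_funTS.
have n1 i x : (0 <= (h \_ (B i)) x)%E by rewrite patchE; case: ifP.
rewrite -big_enum/= -ge0_integral_sum// integral_mkcond.
apply: ge0_le_integral => //.
- by move=> x _; rewrite patchE; case: ifP.
- by apply/(measurable_restrictT _ mA).1; exact: measurable_funTS.
- exact: emeasurable_sum.
move=> x _; rewrite patchE; case: ifPn => [|_]; last exact: sume_ge0.
rewrite inE => /AB[i iS Bx]; rewrite big_enum/= (bigD1 i)//= patchE mem_set//.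
by rewrite leeDl// sume_ge0.
Qed.

End cover_integrals.

Section local_estimate.
Context {R : realType} {d : nat}.
Implicit Types (u : 'rV[R]_d -> R) (x y z p : 'rV[R]_d).
Local Notation normc := ComplexField.Normc.normc.

Lemma eball_convex x (r t : R) p q : 0 <= t <= 1 -> enorm (p - x) <= r -> enorm (q - x) <= r ->
  enorm (t *: p + (1 - t) *: q - x) <= r.
Proof.
move=> /andP[t0 t1] pr qr.
have -> : t *: p + (1 - t) *: q - x = t *: (p - x) + (1 - t) *: (q - x).
  rewrite !scalerBr addrACA -opprD -scalerDl.
  by rewrite [t + _]addrCA subrr addr0 scale1r.
apply: le_trans (enormD _ _) _; rewrite !enormZ !ger0_norm ?subr_ge0//.
have -> : r = t * r + (1 - t) * r by ring.
by rewrite lerD// ler_wpM2l// subr_ge0.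
Qed.

(** The points of [S] are within [rho + kappa * rho <= 3 * rho] of [y], so [line_section] is used
    with [b = 3 * rho]. This is the origin of [12 * rho] and of the bound [6 * rho] for the
    coordinates of the direction [z]. *)
Lemma local_estimate u x y (rho kappa t sigma B : R) (N : nat) (S : set 'rV[R]_d) :
  smooth u -> 0 < rho -> 1 <= kappa <= 2 -> enorm (y - x) <= kappa * rho ->
  0 < sigma <= 1 -> 0 <= t -> measurable (@rowt R d @^-1` S) -> S `<=` eball x rho ->
  (forall p, S p -> `|u p| <= t) ->
  ((2 * sigma * (12 * rho) ^+ d)%:E < lebesgue R d S)%E ->
  (forall p s, enorm (p - x) <= kappa * rho -> size s = N -> `|partials s u p| <= B) ->
  `|u y| <= N%:R * t * (2 * N%:R / sigma) ^+ N + (d%:R * (6 * rho)) ^+ N * B / N`!%:R.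
Proof.
move=> su rho0 /andP[k1 k2] yx s01 t0 mS Sx Su Sm uB.
have krho : rho <= kappa * rho by rewrite ler_peMl// ltW.
have Sy s : S s -> forall i, `|s 0 i - y 0 i| <= 3 * rho.
  move=> Ss i; have -> : s 0 i - y 0 i = (s - y) 0 i by rewrite !mxE.
  apply: le_trans (coord_le_enorm _ _) _.
  have -> : s - y = (s - x) + (x - y) by rewrite addrA subrK.
  apply: le_trans (enormD _ _) _; rewrite (enormB x y).
  have /ltW : enorm (s - x) < rho by exact: Sx.
  have k2r : kappa * rho <= 2 * rho by rewrite ler_wpM2r// ltW.
  by move: yx k2r; lra.
have s0 : 0 < sigma by case/andP: s01.
have b0 : 0 < 3 * rho by rewrite mulr_gt0.
have [|z [z6 [mA sA]]] := line_section mS b0 s0 Sy.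
  by have -> : 4 * (3 * rho) = 12 * rho by ring.
set A := [set t0 : R | _] in mA sA.
(* The derivative bounds hold only in the enlarged ball. The parameters of the segment that stay in
   it form an interval by convexity, which contains 0 and [A]. *)
pose D : set R := [set t : R | 0 <= t <= 1 /\ enorm (y + t *: z - x) <= kappa * rho].
have := @sublevel_interpolation R (fun k (t : R) => dirpartials z k [::] u (y + t *: z))
  N D A 0 t sigma ((d%:R * (6 * rho)) ^+ N * B).
rewrite scale0r addr0 /=; apply => //.
- by move=> k v; apply: is_derive_dirpartials.
- move=> a b [/andP[a0 a1] aD] [/andP[b0' b1] bD] v /andP[av vb].
  split; first by apply/andP; split; lra.
  have [ab|ab] := eqVneq a b.
    by have -> : v = a by apply/eqP; rewrite eq_le av ab vb.
  have ab' : a < b by rewrite lt_neqAle ab (le_trans av).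
  pose th := (b - v) / (b - a).
  have th01 : 0 <= th <= 1.
    rewrite /th divr_ge0 ?subr_ge0 ?(ltW ab')//= ler_pdivrMr ?subr_gt0//.
    by rewrite mul1r lerD2l lerN2.
  have -> : y + v *: z = th *: (y + a *: z) + (1 - th) *: (y + b *: z).
    rewrite !scalerDr addrACA -scalerDl !scalerA -scalerDl.
    rewrite [th + (1 - th)]addrCA subrr addr0 scale1r; congr (_ + _ *: _); rewrite /th; field.
    by rewrite subr_eq0 gt_eqF.
  exact: eball_convex.
- by move=> v [].
- by rewrite /D/= scale0r addr0 lexx ler01.
- move=> v [/andP[v1 v2] /Sx/ltW vS]; split; last exact: le_trans vS krho.
  by apply/andP; split; lra.
- by move=> v [_ /Su].
- move=> v [_ vD]; apply: dirpartials_le.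
    by move=> i; rewrite (le_trans (z6 i))//; lra.
  by move=> s' ss'; apply: uB; rewrite ?ss' ?addn0.
Qed.

Lemma lebesgue_eball_ge x (rho : R) : 0 < rho ->
  (((rho / d.+1%:R) ^+ d)%:E <= lebesgue R d (eball x rho))%E.
Proof.
move=> rho0; pose h := rho / (2 * d.+1%:R).
have h0 : 0 < h by rewrite divr_gt0// mulr_gt0.
have xx i : x 0 i - h <= x 0 i + h by lra.
have [mQ QE] := lebesgue_box xx.
have -> : ((rho / d.+1%:R) ^+ d)%:E = lebesgue R d [set z | forall i, x 0 i - h < z 0 i <= x 0 i + h].
  rewrite QE (eq_bigr (fun=> rho / d.+1%:R)) ?prodr_const ?card_ord// => i _.
  by rewrite /h; field.
apply: le_outer_measure => z zQ; rewrite /eball/=.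
apply: (@le_lt_trans _ _ (d%:R * h)).
  apply: enorm_le_coord; first exact: ltW.
  by move=> i; rewrite !mxE; have /andP[? ?] := zQ i; rewrite ler_norml; apply/andP; split; lra.
rewrite /h mulrA ltr_pdivrMr ?mulr_gt0// mulrC ltr_pM2l//.
by rewrite -[d.+1%:R]natr1; have : 0 <= d%:R :> R by []; lra.
Qed.

Lemma lebesgue_eball_le x (rho : R) : 0 < rho ->
  (lebesgue R d [set z | (enorm (z - x) <= rho)%R] <= ((4 * rho) ^+ d)%:E)%E.
Proof.
move=> rho0.
have xx i : x 0 i - 2 * rho <= x 0 i + 2 * rho by lra.
have [mQ QE] := lebesgue_box xx.
have -> : ((4 * rho) ^+ d)%:E = lebesgue R d [set z | forall i, x 0 i - 2 * rho < z 0 i <= x 0 i + 2 * rho].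
  rewrite QE (eq_bigr (fun=> 4 * rho)) ?prodr_const ?card_ord// => i _; by ring.
apply: le_outer_measure => z /= zx i.
have := le_trans (coord_le_enorm (z - x) i) zx; rewrite !mxE ler_norml => /andP[? ?].
by apply/andP; split; lra.
Qed.

Lemma continuous_sqr_normc (F : 'rV[R]_d -> R[i]) : smoothC F ->
  continuous (fun z => normc (F z) ^+ 2).
Proof.
move=> [sRe sIm].
have -> : (fun z => normc (F z) ^+ 2) =
    (fun z => (@complex.Re R \o F) z ^+ 2 + (@complex.Im R \o F) z ^+ 2).
  by apply/funext => z; rewrite sqr_normc.
move=> z; apply: (@continuousD _ _ _ (fun z => (@complex.Re R \o F) z ^+ 2)
  (fun z => (@complex.Im R \o F) z ^+ 2)).
  apply: (@continuous_comp _ _ _ (@complex.Re R \o F) (fun t => t ^+ 2)).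
    exact: (sRe [::]).1.
  exact: exprn_continuous.
apply: (@continuous_comp _ _ _ (@complex.Im R \o F) (fun t => t ^+ 2)).
  exact: (sIm [::]).1.
exact: exprn_continuous.
Qed.

Lemma local_mass_estimate (F : 'rV[R]_d -> R[i]) x y (rho kappa gamma j B : R) (N : nat)
    (omega : set 'rV[R]_d) :
  let sigma := gamma / (8 * (12 * d.+1%:R) ^+ d) in
  let v := (rho / d.+1%:R) ^+ d in
  smoothC F -> 0 < rho -> 1 <= kappa <= 2 -> enorm (y - x) <= kappa * rho ->
  0 < gamma <= 1 -> measurable (omega : set (Rd R d)) ->
  (gamma%:E * lebesgue R d (eball x rho) <= lebesgue R d (eball x rho `&` omega))%E ->
  (\int[lebesgue R d]_(z in eball x rho `&` omega) (normc (F z) ^+ 2)%:E <= j%:E)%E ->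
  (forall p s, enorm (p - x) <= kappa * rho -> size s = N ->
    `|partials s (@complex.Re R \o F) p| <= B /\ `|partials s (@complex.Im R \o F) p| <= B) ->
  normc (F y) ^+ 2 <= 8 * (N%:R * (2 * N%:R / sigma) ^+ N) ^+ 2 * j / (gamma * v) +
    4 * ((d%:R * (6 * rho)) ^+ N * B / N`!%:R) ^+ 2.
Proof.
move=> sigma v [sRe sIm] rho0 k12 yx /andP[g0 g1] mom gom Jj FB.
set A := N%:R * _; set E := _ / N`!%:R.
have v0 : 0 < v by rewrite exprn_gt0// divr_gt0.
have d12 : 1 <= (12 * d.+1%:R : R) ^+ d by rewrite exprn_ege1// -natrM ler1n.
have s01 : 0 < sigma <= 1.
  rewrite divr_gt0 ?mulr_gt0 ?(lt_le_trans ltr01 d12)//= ler_pdivrMr ?mulr_gt0 ?(lt_le_trans ltr01 d12)//.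
  by lra.
(* [sigma] is defined for this identity. [v] is a lower bound for the volume of the ball; [omega]
   guarantees measure [gamma * v], Chebyshev's inequality keeps half of it, and a quarter stays
   strictly below that. *)
have sv : 2 * sigma * (12 * rho) ^+ d = gamma * v / 4.
  rewrite /sigma /v !exprMn; rewrite exprVn.
  have : d.+1%:R ^+ d != 0 :> R by rewrite expf_neq0.
  have : 12 ^+ d != 0 :> R by rewrite expf_neq0.
  by move: (d.+1%:R ^+ d) (12 ^+ d : R) (rho ^+ d) => a b c b0 a0; field; rewrite a0 b0.
have j0 : 0 <= j.
  rewrite -lee_fin; apply: le_trans Jj; apply: integral_ge0 => z _.
  by rewrite lee_fin sqr_ge0.
have cF := continuous_sqr_normc (conj sRe sIm).
(* A threshold [c] above [2 * j / (gamma * v)] loses at most half of the measure. The extra [zeta]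
   keeps [c] positive when [j] is 0; it is made arbitrarily small at the end. *)
have main zeta : 0 < zeta -> normc (F y) ^+ 2 <=
    4 * A ^+ 2 * (2 * j / (gamma * v) + zeta) + 4 * E ^+ 2.
  move=> z0; set c := 2 * j / (gamma * v) + zeta.
  have c0 : 0 < c by rewrite ltr_wpDl// !mulr_ge0// invr_ge0 mulr_ge0// ltW.
  (* [S] is not intersected with [omega], which is only Lebesgue measurable: [line_section] needs a
     Borel set, and a sublevel set of a continuous function in an open ball is one. [omega] enters
     through the lower bound for the measure of [S]. *)
  pose S := eball x rho `&` [set z | normc (F z) ^+ 2 <= c].
  have mS : measurable (@rowt R d @^-1` S).
    apply: measurableI; first exact: measurable_eball.
    have := @continuous_measurable_rowt R d _ cF.
    move=> /(_ measurableT `]-oo, c]%classic (measurable_itv _)).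
    by rewrite setTI preimage_itvNyc.
  have Sm : ((2 * sigma * (12 * rho) ^+ d)%:E < lebesgue R d S)%E.
    rewrite sv; apply: (@lt_le_trans _ _ (gamma * v - j / c)%:E).
      rewrite lte_fin.
      have : j / c <= gamma * v / 2.
        rewrite ler_pdivrMr// -ler_pdivrMl ?divr_gt0 ?mulr_gt0//.
        rewrite invf_div /c mulrAC; lra.
      by have : 0 < gamma * v by [rewrite mulr_gt0|]; lra.
    apply: (@le_trans _ _ (lebesgue R d ((eball x rho `&` omega) `&` [set z | (normc (F z) ^+ 2 <= c)%R]))).
      have mB : measurable (eball x rho : set (Rd R d)).
        exact: lebesgue_measurable_row (measurable_eball _ _).
      have mD : measurable (eball x rho `&` omega : set (Rd R d)) by exact: measurableI.
      have gv : ((gamma * v)%:E <= lebesgue R d (eball x rho `&` omega))%E.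
        apply: le_trans gom; rewrite EFinM; apply: lee_wpmul2l; first by rewrite lee_fin ltW.
        exact: lebesgue_eball_ge.
      exact: (@le_measure_sublevel R _ (Rd R d) (lebesgue R d) _ _ c j _ mD
        (continuous_measurable_Rd cF) (fun z => sqr_ge0 _) c0 Jj gv).
    by apply: le_outer_measure => z [[]].
  have t0 : 0 <= Num.sqrt c by exact: sqrtr_ge0.
  have Sx : S `<=` eball x rho by move=> z [].
  have SR z : S z -> `|(@complex.Re R \o F) z| <= Num.sqrt c /\ `|(@complex.Im R \o F) z| <= Num.sqrt c.
    move=> [_ /=]; rewrite sqr_normc => zc.
    rewrite -!sqrtr_sqr !ler_sqrt ?(ltW c0)//.
    by split; apply: le_trans zc; rewrite ?lerDl ?lerDr sqr_ge0.
  have R1 := @local_estimate _ x y rho kappa (Num.sqrt c) sigma B N S sRe rho0 k12 yx s01 t0 mS Sx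
    (fun z Sz => (SR z Sz).1) Sm (fun p s ps ss => (FB p s ps ss).1).
  have R2 := @local_estimate _ x y rho kappa (Num.sqrt c) sigma B N S sIm rho0 k12 yx s01 t0 mS Sx
    (fun z Sz => (SR z Sz).2) Sm (fun p s ps ss => (FB p s ps ss).2).
  have AE : N%:R * Num.sqrt c * (2 * N%:R / sigma) ^+ N = A * Num.sqrt c by rewrite mulrAC.
  rewrite AE -/E in R1 R2; rewrite sqr_normc.
  have cE : c = Num.sqrt c ^+ 2 by rewrite sqr_sqrtr// ltW.
  have sq (a : R) : `|a| <= A * Num.sqrt c + E -> a ^+ 2 <= (A * Num.sqrt c + E) ^+ 2.
    by move=> H; rewrite -[a ^+ 2]real_normK ?num_real// ler_pXn2r// nnegrE// (le_trans _ H).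
  apply: le_trans (lerD (sq _ R1) (sq _ R2)) _.
  rewrite [in leRHS]cE; move: (Num.sqrt c) => w.
  have := sqr_ge0 (A * w - E); rewrite !expr2; lra.
apply/ler_addgt0Pr => e e0.
have z0 : 0 < e / (4 * A ^+ 2 + 1).
  by rewrite divr_gt0// ltr_wpDl// mulr_ge0// sqr_ge0.
apply: le_trans (main _ z0) _.
have : 4 * A ^+ 2 * (e / (4 * A ^+ 2 + 1)) <= e.
  rewrite mulrCA ler_piMr ?(ltW e0)// ler_pdivrMr; last by rewrite ltr_wpDl// mulr_ge0// sqr_ge0.
  by rewrite mul1r lerDl.
rewrite mulrDr [8 * _ * j / _](_ : _ = 4 * A ^+ 2 * (2 * j / (gamma * v))); last by ring.
by lra.
Qed.

End local_estimate.

Lemma integral_le_cst (R : realType) (dT : measure_display) (T : measurableType dT)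
    (mu : {measure set T -> \bar R}) (D : set T) (h : T -> R) (c : R) :
  measurable D -> measurable_fun setT h -> (forall x, 0 <= h x) -> (forall x, D x -> h x <= c) ->
  (\int[mu]_(x in D) (h x)%:E <= c%:E * mu D)%E.
Proof.
move=> mD mh h0 hc; rewrite -integral_cst//; apply: ge0_le_integral => //.
- by move=> x _; rewrite lee_fin.
- by apply: measurable_funTS; exact/measurable_EFinP.
Qed.

Lemma le_sum_measure_overlap (R : realType) (dT : measure_display) (T : measurableType dT)
    (mu : {measure set T -> \bar R}) (I : finType) (S : {set I}) (B : I -> set T) (m : nat) (Q : set T) :
  measurable Q -> (forall i, measurable (B i)) -> (forall i, B i `<=` Q) ->
  (forall z, #|[set i in S | `[< B i z >]]| <= m)%N ->
  (\sum_(i in S) mu (B i) <= m%:R%:E * mu Q)%E.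
Proof.
move=> mQ mB BQ Bm.
have mQ1 : measurable_fun setT (fun x => (\1_Q x)%:E : \bar R).
  by apply/measurable_EFinP; exact: measurable_indic.
have := @sum_integral_overlap R _ T mu I S B m (fun x => (\1_Q x)%:E) mB mQ1 _ Bm.
rewrite integral_indic// setIT; under eq_bigr do rewrite integral_indic// (setIidr (BQ _)).
by apply => x; rewrite lee_fin.
Qed.

Lemma sum_integral_overlapI (R : realType) (dT : measure_display) (T : measurableType dT)
    (mu : {measure set T -> \bar R}) (I : finType) (S : {set I}) (B : I -> set T) (m : nat)
    (D : set T) (h : T -> \bar R) :
  (forall i, measurable (B i)) -> measurable D -> measurable_fun setT h -> (forall x, 0 <= h x)%E ->
  (forall z, #|[set i in S | `[< B i z >]]| <= m)%N ->
  (\sum_(i in S) \int[mu]_(x in B i `&` D) h x <= m%:R%:E * \int[mu]_(x in D) h x)%E.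
Proof.
move=> mB mD mh h0 Bm.
under eq_bigr do rewrite integral_mkcondr; rewrite [X in (_ <= _ * X)%E]integral_mkcond.
apply: sum_integral_overlap => //.
- by apply/(measurable_restrictT _ mD).1; exact: measurable_funTS.
- by move=> x; rewrite patchE; case: ifP.
Qed.

Section global_estimate.
Context {R : realType} {d : nat}.
Implicit Types (x y z p : 'rV[R]_d).
Local Notation normc := ComplexField.Normc.normc.

Lemma enorm0 : enorm (0 : 'rV[R]_d) = 0.
Proof. by rewrite -[0 in LHS](scale0r 0) enormZ normr0 mul0r. Qed.

Lemma measurable_closed_eball x (r : R) :
  measurable ([set z | enorm (z - x) <= r] : set (Rd R d)).
Proof.
apply: lebesgue_measurable_row.
have -> : [set t : d.-tuple (measurableTypeR R) | [set z : 'rV[R]_d | enorm (z - x) <= r] (\row_i tnth t i)]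
   = ~` (@rowt R d @^-1` [set z | r < enorm (z - x)]).
  apply/seteqP; split => t /=; first by rewrite -/(rowt t) leNgt => /negP.
  by move=> /negP; rewrite -leNgt.
apply: measurableC; apply: open_measurable_rowt.
apply: (@open_comp _ _ (fun z => enorm (z - x)) [set t | r < t]); last exact: open_gt.
move=> y _; apply: (@continuous_comp _ _ _ (fun y => y - x)); last exact: continuous_enorm.
by have := @continuousB _ _ _ id (cst x) y; apply; [exact: cvg_id|exact: cst_continuous].
Qed.

(** The pointwise bound on an enlarged ball contains the factor [1 / v i]; integration over that
    ball contributes a volume of at most [(8 * d.+1%:R) ^+ d * v i], so the radius cancels. Bounded
    overlap sums the local masses to the mass on [omega] and the errors to the volume of the ball of
    radius [r + P], independently of the number of balls. [cd] is the overlap number times the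
    volume ratio. *)
Lemma global_estimate (F : 'rV[R]_d -> R[i]) (rho B : 'rV[R]_d -> R) (omega : set 'rV[R]_d)
    (r kappa gamma P E : R) (N : nat) :
  let sigma := gamma / (8 * (12 * d.+1%:R) ^+ d) in
  let A := N%:R * (2 * N%:R / sigma) ^+ N in
  let cd : R := ((2 * d).+4 ^ d)%:R * (8 * d.+1%:R) ^+ d in
  smoothC F -> 0 < r -> 0 < P -> (forall x, 0 < rho x) -> 1 < kappa <= 2 -> 0 < gamma <= 1 ->
  measurable (omega : set (Rd R d)) ->
  (forall x, enorm x <= r ->
    (gamma%:E * lebesgue R d (eball x (rho x)) <= lebesgue R d (eball x (rho x) `&` omega))%E) ->
  (forall x, enorm x <= r -> rho x <= P) ->
  (forall x p s, enorm x <= r -> enorm (p - x) <= kappa * rho x -> size s = N ->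
    `|partials s (@complex.Re R \o F) p| <= B x /\ `|partials s (@complex.Im R \o F) p| <= B x) ->
  (forall x, enorm x <= r -> 0 <= (d%:R * (6 * rho x)) ^+ N * B x / N`!%:R <= E) ->
  (\int[lebesgue R d]_x (normc (F x) ^+ 2)%:E < +oo)%E ->
  (\int[lebesgue R d]_(x in [set x | (enorm x <= r)%R]) (normc (F x) ^+ 2)%:E <=
   (cd * 8 * A ^+ 2 / gamma)%:E * \int[lebesgue R d]_(x in omega) (normc (F x) ^+ 2)%:E +
   (4 * cd * E ^+ 2 * (4 * (r + P)) ^+ d)%:E)%E.
Proof.
move=> sigma A cd sF r0 P0 rho0 /andP[k1 k2] g01 mom gom rhoP FB FE Foo.
pose g x : R := normc (F x) ^+ 2.
have cg : continuous g by exact: continuous_sqr_normc.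
have mg : measurable_fun [set: Rd R d] (g : Rd R d -> measurableTypeR R).
  exact: continuous_measurable_Rd.
have mge : measurable_fun [set: Rd R d] (fun x : Rd R d => (g x)%:E).
  exact/measurable_EFinP.
have g0 x : 0 <= g x by exact: sqr_ge0.
have ge0 (x : Rd R d) : (0 <= (g x)%:E)%E by rewrite lee_fin.
have k0 : 0 < kappa - 1 by rewrite subr_gt0.
have [I [S [c [cr Sm Scov]]]] := besicovitch_ball r rho0 k0.
have cov z : enorm z <= r -> exists2 i, i \in S & enorm (z - c i) <= kappa * rho (c i).
  by move=> /Scov[i iS /ltW]; rewrite addrCA subrr addr0; exists i.
have mr : measurable ([set x | enorm x <= r] : set (Rd R d)).
  have := measurable_closed_eball 0 r.
  by congr measurable; apply/funext => x /=; rewrite subr0.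
have mBi i : measurable (eball (c i) (rho (c i)) : set (Rd R d)).
  exact: lebesgue_measurable_row (measurable_eball _ _).
have mkB i := measurable_closed_eball (c i) (kappa * rho (c i)).
apply: le_trans (@le_integral_cover R _ (Rd R d) (lebesgue R d) I S _ _ _ mr mkB mge ge0 cov) _.
pose J i := (\int[lebesgue R d]_(x in eball (c i) (rho (c i)) `&` omega) (g x)%:E)%E.
have Jfin i : (J i \is a fin_num)%E.
  rewrite ge0_fin_numE; last exact: integral_ge0.
  apply: le_lt_trans Foo; apply: ge0_subset_integral => //.
  exact: measurableI.
pose v i : R := (rho (c i) / d.+1%:R) ^+ d.
have v0 i : 0 < v i by rewrite exprn_gt0// divr_gt0.
pose D8 : R := (8 * d.+1%:R) ^+ d.
have gam0 : 0 < gamma by case/andP: g01.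
have each i : (\int[lebesgue R d]_(x in [set z | (enorm (z - c i) <= kappa * rho (c i))%R]) (g x)%:E <=
   (D8 * 8 * A ^+ 2 / gamma)%:E * J i + (4 * D8 * E ^+ 2)%:E * lebesgue R d (eball (c i) (rho (c i))))%E.
  have bnd z : enorm (z - c i) <= kappa * rho (c i) ->
      g z <= 8 * A ^+ 2 * fine (J i) / (gamma * v i) + 4 * E ^+ 2.
    move=> zi; have k12 : 1 <= kappa <= 2 by rewrite (ltW k1).
    have Jj : (J i <= (fine (J i))%:E)%E by rewrite fineK.
    apply: (le_trans (local_mass_estimate sF (rho0 (c i)) k12 zi g01 mom (gom _ (cr i)) Jj
      (fun p s ps ss => FB _ p s (cr i) ps ss))).
    rewrite lerD2l ler_wpM2l//; have /andP[E0 EE] := FE _ (cr i).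
    by rewrite lerXn2r// nnegrE (le_trans E0).
  apply: le_trans (@integral_le_cst R _ (Rd R d) (lebesgue R d) _ g _ (mkB i) mg g0 bnd) _.
  set X := (8 * A ^+ 2 * _ / _ + _).
  have cc : enorm (c i - c i) <= kappa * rho (c i).
    by rewrite subrr enorm0 ltW// mulr_gt0// (lt_trans ltr01).
  have X0 : 0 <= X := le_trans (g0 _) (bnd _ cc).
  apply: (@le_trans _ _ (X%:E * ((D8 * v i)%:E))%E).
    apply: lee_wpmul2l; first by rewrite lee_fin.
    have kr : 0 < kappa * rho (c i) by rewrite mulr_gt0// (lt_trans ltr01).
    apply: le_trans (lebesgue_eball_le (c i) kr) _.
    have E8 : 8 * d.+1%:R * (rho (c i) / d.+1%:R) = 4 * (2 * rho (c i)) by field.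
    have kle : 4 * (kappa * rho (c i)) <= 4 * (2 * rho (c i)) by rewrite ler_pM2l// ler_pM2r.
    have kp : 0 <= 4 * (kappa * rho (c i)) by rewrite mulr_ge0// ltW.
    rewrite lee_fin /D8 /v -exprMn E8; apply: lerXn2r => //.
    by rewrite nnegrE (le_trans kp).
  rewrite -EFinM -(fineK (Jfin i)) -EFinM.
  apply: (@le_trans _ _ ((D8 * 8 * A ^+ 2 / gamma * fine (J i))%:E + (4 * D8 * E ^+ 2)%:E * (v i)%:E)%E).
    rewrite -EFinM -EFinD lee_fin /X le_eqVlt; apply/orP; left; apply/eqP.
    by field; rewrite !gt_eqF.
  apply: leeD2l; apply: lee_wpmul2l.
    by rewrite lee_fin mulr_ge0 ?sqr_ge0// mulr_ge0// exprn_ge0.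
  exact: lebesgue_eball_ge.
apply: (@le_trans _ _ (\sum_(i in S) ((D8 * 8 * A ^+ 2 / gamma)%:E * J i + (4 * D8 * E ^+ 2)%:E * lebesgue R d (eball (c i) (rho (c i)))))%E).
  by apply: lee_sum => i _; exact: each.
rewrite big_split/= -!ge0_sume_distrr//; last first.
  by move=> i _; exact: integral_ge0.
apply: leeD.
  have H := @sum_integral_overlapI R _ (Rd R d) (lebesgue R d) I S _ _ omega _ mBi mom mge ge0 Sm.
  have -> : cd * 8 * A ^+ 2 / gamma = (D8 * 8 * A ^+ 2 / gamma) * ((2 * d).+4 ^ d)%:R.
    by rewrite /cd -/D8; ring.
  rewrite [X in (_ <= X * _)%E]EFinM -muleA; apply: lee_wpmul2l; last exact: H.
  by rewrite lee_fin divr_ge0 ?(ltW gam0)// mulr_ge0 ?sqr_ge0// mulr_ge0// exprn_ge0.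
pose Q : set (Rd R d) := [set x | (enorm (x - 0) <= r + P)%R].
have mQ : measurable Q by exact: measurable_closed_eball.
have BQ i : eball (c i) (rho (c i)) `<=` Q.
  move=> z /= /ltW zi; rewrite /Q/= subr0 -[z](subrK (c i)).
  apply: le_trans (enormD _ _) _; rewrite addrC lerD//.
  by apply: le_trans zi _; exact: rhoP.
have H := @le_sum_measure_overlap R _ (Rd R d) (lebesgue R d) I S _ _ Q mQ mBi BQ Sm.
have rP : 0 < r + P by rewrite addr_gt0.
apply: (@le_trans _ _ ((4 * D8 * E ^+ 2)%:E * (((2 * d).+4 ^ d)%:R%:E * ((4 * (r + P)) ^+ d)%:E))%E).
  apply: lee_wpmul2l; first by rewrite lee_fin mulr_ge0 ?sqr_ge0// mulr_ge0// exprn_ge0.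
  apply: le_trans H _; apply: lee_wpmul2l; first by rewrite lee_fin.
  exact: lebesgue_eball_le.
by rewrite -!EFinM lee_fin /cd -/D8 le_eqVlt; apply/orP; left; apply/eqP; ring.
Qed.

End global_estimate.

(** * Size of the remainder *)

Section factorials.
Context {R : realType}.
Implicit Types (n N d : nat) (x : R).

Lemma pow_le_fact_expR n x : 0 <= x -> x ^+ n <= n`!%:R * expR x.
Proof.
move=> x0; rewrite mulrC -ler_pdivrMr ?ltr0n ?fact_gt0//.
case: n => [|n]; first by rewrite fact0 divr1 expr0; have := expR_ge1Dx x; lra.
by apply: le_trans (expR_ge1Dxn n x0); rewrite lerDr.
Qed.

(** At [x = n] this is the lower Stirling bound; the freedom in [x] also serves for [N.+1] and
    [N + d]. *)
Lemma ln_pow_le_fact n x : 0 < x -> n%:R * ln x <= ln n`!%:R + x.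
Proof.
move=> x0; have f0 : 0 < n`!%:R :> R by rewrite ltr0n fact_gt0.
rewrite -[leRHS](_ : ln (n`!%:R * expR x) = _); last first.
  by rewrite lnM ?posrE ?expR_gt0// expRK.
by rewrite mulr_natl -lnXn// ler_ln ?posrE ?exprn_gt0 ?mulr_gt0 ?expR_gt0// pow_le_fact_expR// ltW.
Qed.

Lemma ln_fact_ge0 n : 0 <= ln n`!%:R :> R.
Proof. by rewrite ln_ge0// ler1n fact_gt0. Qed.

Lemma factD_le_pow N n m : (N + n <= m)%N -> ((N + n)`! <= N`! * m ^ n)%N.
Proof.
elim: n => [|n ih]; first by rewrite addn0 expn0 muln1.
rewrite addnS => nm; rewrite factS expnS mulnCA leq_mul//.
by apply: ih; exact: ltnW.
Qed.

(** Up to a factor [e^(O(N))], [n!] is at most [(N!)^delta]: one has [n! <= (N + 1)^n], with [n] at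
    most [delta * N + 1], and [(N + 1)^N <= N! * e^(N + 1)]. *)
Lemma ln_fact_le_fractional n N (delta : R) : 0 <= delta <= 1 -> (n <= N.+1)%N ->
  n%:R <= delta * N%:R + 1 ->
  ln n`!%:R <= 2 * N%:R + 1 + delta * ln N`!%:R.
Proof.
move=> /andP[d0 d1] nN nd.
have lN0 : 0 <= ln N.+1%:R :> R by rewrite ln_ge0// ler1n.
have lN : ln N.+1%:R <= N%:R :> R.
  by rewrite -[N.+1%:R]nat1r; apply: le_ln1Dx; apply: lt_le_trans (ltrN10 R) _.
have H1 : ln n`!%:R <= n%:R * ln N.+1%:R :> R.
  rewrite mulr_natl -lnXn ?ltr0n// ler_ln ?posrE ?ltr0n ?fact_gt0// -?natrX ?ltr0n ?expn_gt0//.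
  by rewrite ler_nat; have := @factD_le_pow 0 _ _ nN; rewrite mul1n.
have H2 := ln_pow_le_fact N (ltr0Sn R N).
apply: (le_trans H1); apply: (@le_trans _ _ ((delta * N%:R + 1) * ln N.+1%:R)).
  by rewrite ler_wpM2r.
have H3 : delta * (N%:R * ln N.+1%:R) <= delta * (ln N`!%:R + N.+1%:R) by rewrite ler_wpM2l.
rewrite -[N.+1%:R in X in _ <= X]natr1 in H3.
have H4 : delta * (N%:R + 1) <= N%:R + 1 by rewrite ler_piMl// addr_ge0.
move: H3 H4 lN; move: (ln N.+1%:R) (ln N`!%:R) (N%:R : R) => u v w; lra.
Qed.

Lemma ln_factD N d :
  ln (N + d)`!%:R <= ln N`!%:R + N%:R + d%:R + ln d`!%:R :> R.
Proof.
have f0 m : 0 < m`!%:R :> R by rewrite ltr0n fact_gt0.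
case: d => [|d]; first by rewrite addn0 fact0 ln1 !addr0 lerDl.
have H := factD_le_pow (leqnn (N + d.+1)).
have p0 : 0 < (N + d.+1)%:R :> R by rewrite ltr0n addnS.
have q0 : 0 < ((N + d.+1) ^ d.+1)%:R :> R by rewrite ltr0n expn_gt0 addnS.
have := ln_pow_le_fact d.+1 p0; rewrite mulr_natl -lnXn// -natrX.
have : ln (N + d.+1)`!%:R <= ln N`!%:R + ln ((N + d.+1) ^ d.+1)%:R :> R.
  by rewrite -lnM ?posrE// -natrM ler_ln ?posrE ?ler_nat.
rewrite natrD; lra.
Qed.

(** In the logarithm, [ln N!] has coefficient [delta * nu + mu - 1 = s - 1], which Stirling's bound
    turns into [- (1 - s) * N * ln N] plus at most [N]. The assumption on [ln N] absorbs all terms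
    linear in [N]. Of the 3 in it, one pays for [(N + d)!], one for Stirling, and the last leaves
    the decay [expR (- N)]; [2 * ln D2] reflects [n + N <= 2 * N + 1]. *)
Lemma error_bound (d N n : nat) (nu mu delta s b R0 C D1 D2 : R) :
  (0 < N)%N -> 0 < b -> 0 <= nu -> 0 <= mu <= 1 -> 0 <= delta <= 1 ->
  s = delta * nu + mu -> s < 1 -> 1 <= R0 -> 1 <= C -> 0 < D1 -> 1 <= D2 ->
  (n <= N.+1)%N -> n%:R <= delta * N%:R + 1 ->
  ln b + ln R0 + ln C + 2 * nu + 3 + 2 * ln D2 <= (1 - s) * ln N%:R ->
  b ^+ N * (R0 ^+ N * C ^+ n * 2 ^+ d *
    (D1 * D2 ^+ (n + N + d) * n`!%:R `^ nu * (N + d)`!%:R `^ mu)) / N`!%:R <=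
  D1 * expR (ln C + d%:R * ln 2 + nu + d%:R + ln d`!%:R + (d%:R + 1) * ln D2 - N%:R).
Proof.
move=> N0 p6 nu0 /andP[mu0 mu1] d01 sE s1 R01 C1 D10 D21 nN nd Nbig.
have /andP[de0 de1] := d01.
have f0 m : 0 < m`!%:R :> R by rewrite ltr0n fact_gt0.
have pR : 0 < R0 by rewrite (lt_le_trans ltr01).
have pC : 0 < C by rewrite (lt_le_trans ltr01).
have p2 : 0 < D2 by rewrite (lt_le_trans ltr01).
have pN : 0 < N%:R :> R by rewrite ltr0n.
have lC := ln_ge0 C1; have lR := ln_ge0 R01; have lD := ln_ge0 D21.
have F1 := ln_fact_le_fractional d01 nN nd.
have F2 := ln_factD N d.
have F3 := ln_pow_le_fact N pN.
have G1 := ln_fact_ge0 N; have G2 := ln_fact_ge0 d.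
set X := (X in X <= _).
have X0 : 0 < X by rewrite /X !(mulr_gt0, exprn_gt0, invr_gt0, powR_gt0).
have lnX : ln X = N%:R * ln b + (N%:R * ln R0 + n%:R * ln C + d%:R * ln 2 +
    (ln D1 + (n%:R + N%:R + d%:R) * ln D2 + nu * ln n`!%:R + mu * ln (N + d)`!%:R)) - ln N`!%:R.
  rewrite /X !(lnM, lnV, ln_powR, lnXn) ?posrE ?(exprn_gt0, mulr_gt0, invr_gt0, powR_gt0)//.
  by rewrite -!natrD !mulr_natl.
have -> : D1 = expR (ln D1) by rewrite lnK.
rewrite -expRD -[leLHS]lnK ?posrE// ler_expR lnX.
have nC : n%:R * ln C <= (N%:R + 1) * ln C by rewrite ler_wpM2r// natr1 ler_nat.
have nD : n%:R * ln D2 <= (N%:R + 1) * ln D2 by rewrite ler_wpM2r// natr1 ler_nat.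
have M1 : nu * ln n`!%:R <= nu * (2 * N%:R + 1 + delta * ln N`!%:R) by rewrite ler_wpM2l.
have M2 : mu * ln (N + d)`!%:R <= mu * ln N`!%:R + (N%:R + d%:R + ln d`!%:R).
  apply: (@le_trans _ _ (mu * (ln N`!%:R + (N%:R + d%:R + ln d`!%:R)))).
    by rewrite ler_wpM2l//; move: F2; lra.
  by rewrite mulrDr lerD2l ler_piMl// !addr_ge0.
have M3 : (1 - s) * (N%:R * ln N%:R) <= (1 - s) * (ln N`!%:R + N%:R).
  by rewrite ler_wpM2l// subr_ge0 ltW.
have M4 : (1 - s) * N%:R <= N%:R.
  by rewrite ler_piMl// lerBlDr lerDl sE addr_ge0// mulr_ge0.
have M5 := ler_wpM2l (ltW pN) Nbig.
have sl : s * ln N`!%:R = delta * nu * ln N`!%:R + mu * ln N`!%:R by rewrite sE mulrDl.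
move: nC nD M1 M2 M3 M4 M5 sl; clear.
move: (ln n`!%:R) (ln (N + d)`!%:R) (ln d`!%:R) (ln N`!%:R) (ln D2) (ln C) (ln R0)
  (ln b) (ln N%:R) (ln D1) (ln 2) => ln1 ln2 ld lf l2 lC lR l6 lN lD l02.
move: (N%:R : R) (n%:R : R) (d%:R : R) => N' n' d'.
lra.
Qed.

End factorials.

(** * Derivatives near a ball *)

Lemma le_integral_weightDl (R : realType) (dT : measure_display) (T : measurableType dT)
    (mu : {measure set T -> \bar R}) (w a b : T -> R) :
  measurable_fun setT w -> measurable_fun setT a -> measurable_fun setT b ->
  (forall x, 0 <= w x) ->
  (\int[mu]_x (w x * a x ^+ 2)%:E <= \int[mu]_x (w x * (a x ^+ 2 + b x ^+ 2))%:E)%E.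
Proof.
move=> mw ma mb w0.
have ma2 : measurable_fun setT (fun x => a x ^+ 2) by exact: measurable_funX.
have mb2 : measurable_fun setT (fun x => b x ^+ 2) by exact: measurable_funX.
apply: ge0_le_integral => //.
- by move=> x _; rewrite lee_fin mulr_ge0 ?sqr_ge0.
- by apply/measurable_EFinP; exact: (measurable_funM mw ma2).
- by apply/measurable_EFinP; exact: (measurable_funM mw (measurable_funD ma2 mb2)).
- by move=> x _; rewrite lee_fin ler_wpM2l// lerDl sqr_ge0.
Qed.

Section derivative_bounds.
Context {R : realType} {d : nat}.
Implicit Types (x p : 'rV[R]_d) (F : 'rV[R]_d -> R[i]) (u : 'rV[R]_d -> R).
Local Notation normc := ComplexField.Normc.normc.

Lemma weighted_partials_L2 F n (s : seq 'I_d) (c : R) : smoothC F -> 0 <= c ->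
  (l2norm setT (fun x => ((1 + enorm x ^+ 2) `^ (n%:R / 2))%:C%C
                         * mpartialC (fun i => count_mem i s) F x)%R <= c%:E)%E ->
  (\int[lebesgue R d]_x ((1 + enorm x ^+ 2) ^+ n * partials s (@complex.Re R \o F) x ^+ 2)%:E <= (c ^+ 2)%:E)%E /\
  (\int[lebesgue R d]_x ((1 + enorm x ^+ 2) ^+ n * partials s (@complex.Im R \o F) x ^+ 2)%:E <= (c ^+ 2)%:E)%E.
Proof.
move=> [sRe sIm] c0 Hc.
have w0 x : 0 <= 1 + enorm x ^+ 2 by rewrite addr_ge0// sqr_ge0.
pose w x := (1 + enorm x ^+ 2) ^+ n.
have wn x : 0 <= w x by exact: exprn_ge0.
pose a := partials s (@complex.Re R \o F); pose b := partials s (@complex.Im R \o F).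
have mw : measurable_fun [set: Rd R d] (w : Rd R d -> measurableTypeR R).
  by apply: continuous_measurable_Rd; exact: continuous_weight.
have ma : measurable_fun [set: Rd R d] (a : Rd R d -> measurableTypeR R).
  by apply: continuous_measurable_Rd; exact: (sRe s).1.
have mb : measurable_fun [set: Rd R d] (b : Rd R d -> measurableTypeR R).
  by apply: continuous_measurable_Rd; exact: (sIm s).1.
have H2 : (\int[lebesgue R d]_x (w x * (a x ^+ 2 + b x ^+ 2))%:E <= (c ^+ 2)%:E)%E.
  have := lee_pmul (Lnorm_ge0 _ _ _) (Lnorm_ge0 _ _ _) Hc Hc.
  rewrite -expe2 -EFinM -expr2 l2norm_sqr; apply: le_trans.
  rewrite le_eqVlt; apply/orP; left; apply/eqP; apply: eq_integral => x _.
  rewrite sqr_norm_weighted// sqr_normc /= /a /b.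
  by rewrite (mpartial_partials s sRe).1 (mpartial_partials s sIm).1.
split; apply: le_trans H2.
- exact: (@le_integral_weightDl R _ (Rd R d) (lebesgue R d) w a b mw ma mb wn).
- have -> : (fun x => (w x * (a x ^+ 2 + b x ^+ 2))%:E) = (fun x => (w x * (b x ^+ 2 + a x ^+ 2))%:E).
    by apply/funext => x; rewrite [X in _ * X]addrC.
  exact: (@le_integral_weightDl R _ (Rd R d) (lebesgue R d) w b a mw mb ma wn).
Qed.

(** If [r0 <= enorm x], then [enorm p] is at least [1 - eta * (3 - eta) / 2] times [enorm x], and
    this number factors as [(1 - eta) * (2 - eta) / 2 > 0]. For smaller [x] the weight is at most
    [1 + r0 ^+ 2]. *)
Lemma comparable_weights x p (rho eta r0 : R) : 0 < eta < 1 -> 1 <= r0 -> 0 < rho ->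
  (r0 <= enorm x -> rho <= eta * enorm x) -> enorm (p - x) <= (3 - eta) / 2 * rho ->
  1 + enorm x ^+ 2 <= (1 + r0 ^+ 2 + ((1 - eta) * (2 - eta) / 2) ^- 2) * (1 + enorm p ^+ 2).
Proof.
move=> /andP[e0 e1] r1 rho0 rhox px.
set ce := (1 - eta) * (2 - eta) / 2.
have ce0 : 0 < ce by rewrite divr_gt0// mulr_gt0 ?subr_gt0//; lra.
have ci : 0 <= ce ^- 2 by rewrite invr_ge0 sqr_ge0.
have pp : 0 <= enorm p ^+ 2 by exact: sqr_ge0.
have rr : 0 <= r0 ^+ 2 by exact: sqr_ge0.
have [xr|xr] := leP r0 (enorm x); last first.
  have x2 : enorm x ^+ 2 <= r0 ^+ 2.
    by apply: lerXn2r; rewrite ?nnegrE ?enorm_ge0 ?(ltW xr)//; lra.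
  apply: (@le_trans _ _ (1 + r0 ^+ 2)); first by rewrite lerD2l.
  have : 0 <= (1 + r0 ^+ 2 + ce ^- 2) * enorm p ^+ 2 by rewrite mulr_ge0// !addr_ge0.
  by rewrite mulrDr mulr1; lra.
have xp : ce * enorm x <= enorm p.
  have H1 : enorm x <= enorm p + enorm (p - x).
    rewrite enormB; have -> : enorm x = enorm (p + (x - p)) by rewrite addrCA subrr addr0.
    exact: enormD.
  have H2 : (3 - eta) / 2 * rho <= (3 - eta) / 2 * (eta * enorm x).
    by rewrite ler_wpM2l ?rhox// divr_ge0//; lra.
  by move: H1 H2 px; rewrite /ce; move: (enorm x) (enorm p) (enorm (p - x)) => a b c; nra.
have x2 : enorm x ^+ 2 <= ce ^- 2 * enorm p ^+ 2.
  rewrite mulrC ler_pdivlMr ?exprn_gt0// mulrC -exprMn ler_sqr ?nnegrE ?enorm_ge0//.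
  by rewrite mulr_ge0 ?enorm_ge0// ltW.
apply: (@le_trans _ _ (1 + ce ^- 2 * enorm p ^+ 2)); first by rewrite lerD2l.
have : 0 <= r0 ^+ 2 * enorm p ^+ 2 by rewrite mulr_ge0.
by rewrite mulrDr mulr1 !mulrDl; lra.
Qed.

(** Because [n >= delta * N], [rho ^+ N] is at most [R0 ^+ N] times the square root of the n-th
    power of the weight at [x]; moved to [p], this weight is the one that [weighted_sup] controls.
    The division by [rho ^+ N] will cancel the same power in the interpolation remainder. *)
Lemma partials_pointwise_bound u x p (n N : nat) (s : seq 'I_d) (rho delta R0 C1 M : R) :
  smooth u -> size s = N -> 0 < rho -> 1 <= R0 -> 1 <= C1 -> 0 <= M ->
  delta * N%:R <= n%:R ->
  rho <= R0 * (1 + enorm x ^+ 2) `^ (delta / 2) ->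
  1 + enorm x ^+ 2 <= C1 * (1 + enorm p ^+ 2) ->
  (forall s', (N <= size s' <= N + d)%N ->
    (\int[lebesgue R d]_x ((1 + enorm x ^+ 2) ^+ n * partials s' u x ^+ 2)%:E <= (M ^+ 2)%:E)%E) ->
  `|partials s u p| <= R0 ^+ N * (C1 * (2 + 2 * d%:R ^+ 2)) ^+ n * 2 ^+ d * M / rho ^+ N.
Proof.
move=> su sN rho0 R01 C11 M0 dn rhox xp HM.
have := @weighted_sup R d u n N M s p su sN HM.
set Kd : R := 2 + 2 * d%:R ^+ 2; set W := partials s u p => H.
have Kd1 : 1 <= Kd by have := sqr_ge0 (d%:R : R); rewrite /Kd; lra.
have x1 : 1 <= 1 + enorm x ^+ 2 by rewrite lerDl sqr_ge0.
have x0 : 0 <= 1 + enorm x ^+ 2 by rewrite (le_trans ler01).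
have p0 : 0 <= 1 + enorm p ^+ 2 by rewrite addr_ge0// sqr_ge0.
have CK : 1 <= C1 * Kd by rewrite -[1]mulr1 ler_pM.
have CK0 : 0 <= C1 * Kd by rewrite (le_trans ler01).
have CKn : 1 <= (C1 * Kd) ^+ n by exact: exprn_ege1.
have R00 : 0 <= R0 by rewrite (le_trans ler01).
rewrite ler_pdivlMr ?exprn_gt0//.
have T0 : 0 <= R0 ^+ N * (C1 * Kd) ^+ n * 2 ^+ d * M.
  by rewrite !mulr_ge0 ?exprn_ge0// (le_trans ler01).
rewrite -ler_sqr ?nnegrE ?mulr_ge0 ?exprn_ge0 ?(ltW rho0)//.
rewrite exprMn real_normK ?num_real//.
have r2 : (rho ^+ N) ^+ 2 <= (R0 ^+ N) ^+ 2 * (1 + enorm x ^+ 2) ^+ n.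
  apply: (@le_trans _ _ ((R0 ^+ N) ^+ 2 * (1 + enorm x ^+ 2) `^ (delta * N%:R))).
    have -> : (1 + enorm x ^+ 2) `^ (delta * N%:R) =
        (((1 + enorm x ^+ 2) `^ (delta / 2)) ^+ N) ^+ 2.
      rewrite -exprM -[RHS]powR_mulrn ?powR_ge0// -powRrM natrM.
      by congr (_ `^ _); field.
    rewrite -exprMn -exprMn ler_sqr ?nnegrE ?exprn_ge0 ?mulr_ge0 ?powR_ge0 ?(ltW rho0)//.
    by rewrite lerXn2r// nnegrE ?(ltW rho0)// mulr_ge0// powR_ge0.
  rewrite ler_wpM2l ?sqr_ge0//.
  by rewrite -[leRHS]powR_mulrn// ler_powR.
have xpn : (1 + enorm x ^+ 2) ^+ n <= C1 ^+ n * (1 + enorm p ^+ 2) ^+ n.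
  by rewrite -exprMn lerXn2r// nnegrE// mulr_ge0// (le_trans ler01).
have W0 := sqr_ge0 W.
apply: (@le_trans _ _ (W ^+ 2 * ((R0 ^+ N) ^+ 2 * (C1 ^+ n * (1 + enorm p ^+ 2) ^+ n)))).
  rewrite ler_wpM2l//; apply: (le_trans r2); by rewrite ler_wpM2l ?sqr_ge0.
have -> : W ^+ 2 * ((R0 ^+ N) ^+ 2 * (C1 ^+ n * (1 + enorm p ^+ 2) ^+ n)) =
   (R0 ^+ N) ^+ 2 * C1 ^+ n * ((1 + enorm p ^+ 2) ^+ n * W ^+ 2) by ring.
apply: (@le_trans _ _ ((R0 ^+ N) ^+ 2 * C1 ^+ n * (4 ^+ d * Kd ^+ n * M ^+ 2))).
  by rewrite ler_wpM2l// mulr_ge0 ?sqr_ge0// exprn_ge0// (le_trans ler01).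
have -> : (R0 ^+ N) ^+ 2 * C1 ^+ n * (4 ^+ d * Kd ^+ n * M ^+ 2) =
    (C1 * Kd) ^+ n * ((R0 ^+ N) ^+ 2 * (2 ^+ d) ^+ 2 * M ^+ 2).
  rewrite exprMn -[(2 ^+ d) ^+ 2]exprM mulnC exprM -[2 ^+ 2]natrX; ring.
have -> : (R0 ^+ N * (C1 * Kd) ^+ n * 2 ^+ d * M) ^+ 2 =
    ((C1 * Kd) ^+ n) ^+ 2 * ((R0 ^+ N) ^+ 2 * (2 ^+ d) ^+ 2 * M ^+ 2) by ring.
(* A square root of [(C1 * Kd) ^+ n] would suffice in the bound; the base is at least 1, so the full
   power is used instead. *)
rewrite ler_wpM2r ?mulr_ge0 ?sqr_ge0 ?exprn_ge0//.
by rewrite expr2 ler_peMl// (le_trans ler01).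
Qed.

End derivative_bounds.

(** * Tail and density *)

Lemma ge0_integral_split (R : realType) (dT : measure_display) (T : measurableType dT)
    (mu : {measure set T -> \bar R}) (A : set T) (g : T -> \bar R) :
  measurable A -> measurable_fun setT g -> (forall x, 0 <= g x)%E ->
  (\int[mu]_x g x = \int[mu]_(x in A) g x + \int[mu]_(x in ~` A) g x)%E.
Proof.
move=> mA mg g0.
rewrite -[in LHS](setUv A) ge0_integral_setU//; first exact: measurableC.
- exact: measurable_funTS.
- by apply/disj_setPS; rewrite setICr.
Qed.

Section weighted_tail.
Context {R : realType} {d : nat}.
Implicit Types (F : 'rV[R]_d -> R[i]).
Local Notation normc := ComplexField.Normc.normc.

Lemma weighted_L2 F n (c : R) : smoothC F ->
  (l2norm setT (fun x => ((1 + enorm x ^+ 2) `^ (n%:R / 2))%:C%C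
                         * mpartialC (fun=> 0%N) F x)%R <= c%:E)%E ->
  (\int[lebesgue R d]_x ((1 + enorm x ^+ 2) ^+ n * normc (F x) ^+ 2)%:E <= (c ^+ 2)%:E)%E.
Proof.
move=> [sRe sIm] Hc.
have w0 (x : 'rV[R]_d) : 0 <= 1 + enorm x ^+ 2 by rewrite addr_ge0// sqr_ge0.
have := lee_pmul (Lnorm_ge0 _ _ _) (Lnorm_ge0 _ _ _) Hc Hc.
rewrite -expe2 -EFinM -expr2 l2norm_sqr; apply: le_trans.
rewrite le_eqVlt; apply/orP; left; apply/eqP; apply: eq_integral => x _.
rewrite sqr_norm_weighted// !sqr_normc /=.
have := (@mpartial_partials R d _ [::] sRe).1; rewrite /= => <-.
by have := (@mpartial_partials R d _ [::] sIm).1; rewrite /= => <-.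
Qed.

Lemma tail_estimate F (r c : R) : smoothC F -> 0 <= r ->
  (\int[lebesgue R d]_x ((1 + enorm x ^+ 2) * normc (F x) ^+ 2)%:E <= c%:E)%E ->
  (\int[lebesgue R d]_(x in ~` [set x | (enorm x <= r)%R]) (normc (F x) ^+ 2)%:E
    <= (c / (1 + r ^+ 2))%:E)%E.
Proof.
move=> sF r0 Hc.
have q0 : 0 < 1 + r ^+ 2 by rewrite (lt_le_trans ltr01)// lerDl sqr_ge0.
have mQ : measurable (~` [set x | (enorm x <= r)%R] : set (Rd R d)).
  have := @measurable_closed_eball R d 0 r.
  under eq_set do rewrite subr0.
  exact: measurableC.
have mh : measurable_fun [set: Rd R d] ((fun x => normc (F x) ^+ 2) : Rd R d -> measurableTypeR R).
  by apply: continuous_measurable_Rd; exact: continuous_sqr_normc.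
have mw : measurable_fun [set: Rd R d] ((fun x => 1 + enorm x ^+ 2) : Rd R d -> measurableTypeR R).
  by apply: continuous_measurable_Rd; exact: (@continuous_weight R d 1).
have H := @le_integral_weight R _ (Rd R d) (lebesgue R d) _ _ _ (1 + r ^+ 2) 1 mQ mh mw.
have {}H : ((1 + r ^+ 2)%:E *
    \int[lebesgue R d]_(x in ~` [set x | (enorm x <= r)%R]) (normc (F x) ^+ 2)%:E <= c%:E)%E.
  apply: le_trans (H _ _ _ _ _) _.
  - by move=> x; exact: sqr_ge0.
  - by move=> x; rewrite addr_ge0// sqr_ge0.
  - exact: ltW.
  - exact: ler01.
  - move=> x /= /negP; rewrite -ltNge mul1r => xr.
    by rewrite lerD2l lerXn2r ?nnegrE ?enorm_ge0// ltW.
  - by rewrite mul1e.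
by rewrite EFinM muleC lee_pdivlMl.
Qed.

Lemma integral_ball_split F (r : R) : smoothC F ->
  (\int[lebesgue R d]_x (normc (F x) ^+ 2)%:E =
   \int[lebesgue R d]_(x in [set x | (enorm x <= r)%R]) (normc (F x) ^+ 2)%:E +
   \int[lebesgue R d]_(x in ~` [set x | (enorm x <= r)%R]) (normc (F x) ^+ 2)%:E)%E.
Proof.
move=> sF.
have mA : measurable ([set x | (enorm x <= r)%R] : set (Rd R d)).
  have := @measurable_closed_eball R d 0 r.
  by under eq_set do rewrite subr0.
have mh : measurable_fun [set: Rd R d] ((fun x => normc (F x) ^+ 2) : Rd R d -> measurableTypeR R).
  by apply: continuous_measurable_Rd; exact: continuous_sqr_normc.
apply: (@ge0_integral_split R _ (Rd R d) (lebesgue R d) _ (fun x => (normc (F x) ^+ 2)%:E) mA).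
  exact/measurable_EFinP.
by move=> x; rewrite lee_fin sqr_ge0.
Qed.

(** The density is a quotient of extended reals; the inner and outer cubes show that the denominator
    is positive and finite, so it can be cleared. *)
Lemma density_mass (x : 'rV[R]_d) (rho c gamma : R) (omega : set 'rV[R]_d) :
  0 < rho -> c <= gamma ->
  (gamma%:E <= lebesgue R d (eball x rho `&` omega) / lebesgue R d (eball x rho))%E ->
  (c%:E * lebesgue R d (eball x rho) <= lebesgue R d (eball x rho `&` omega))%E.
Proof.
move=> rho0 cg.
have lo := lebesgue_eball_ge x rho0.
have hi : (lebesgue R d (eball x rho) <= ((4 * rho) ^+ d)%:E)%E.
  apply: le_trans (lebesgue_eball_le x rho0).
  by apply: le_outer_measure => y /= /ltW.
move: lo hi; case: (lebesgue R d (eball x rho)) => [v| |] //; rewrite !lee_fin => lo _.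
have v0 : 0 < v by rewrite (lt_le_trans _ lo)// exprn_gt0// divr_gt0.
rewrite inver gt_eqF// lee_pdivlMr// => H; apply: le_trans H.
by rewrite -!EFinM lee_fin ler_wpM2r// ltW.
Qed.

End weighted_tail.

(** * Choice of the constants *)

Section constants.
Context {R : realType}.

Lemma le_expR (x : R) : x <= expR x.
Proof. by have := expR_ge1Dx x; lra. Qed.

(** By [x <= expR x] and [1 <= L], every factor is at most the exponential of a multiple of [L]. The
    square of [L] arises from the power [N <= c3 * L] of such a factor in [A]. *)
Lemma exponent_bound (N : nat) (L c3 a gamma0 q cd : R) :
  1 <= L -> 0 <= cd -> 0 <= q -> 0 < gamma0 -> 0 <= a -> N%:R <= c3 * L ->
  let gamma := gamma0 / 2 * expR (- (a * L)) in
  let A := N%:R * (2 * N%:R / (gamma / q)) ^+ N in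
  let c4 := a + 2 / gamma0 in
  let K := 1 + 8 * cd + 2 * (c3 + (c3 + 2 * q + c4) * c3) + c4 in
  is_true (cd * 8 * A ^+ 2 / gamma <= expR (K * L ^+ 2)).
Proof.
move=> L1 cd0 q0 g0 a0 NL gamma A c4 K.
have L0 : 0 <= L by lra.
have g20 : 0 <= 2 / gamma0 by rewrite divr_ge0// ltW.
have c40 : 0 <= c4 by rewrite addr_ge0.
have N0 : 0 <= N%:R :> R by [].
have c3L0 : 0 <= c3 * L by exact: le_trans NL.
have c30 : 0 <= c3 by rewrite -(pmulr_lge0 _ (lt_le_trans ltr01 L1)).
have NE : N%:R <= expR (c3 * L) by exact: le_trans (le_expR _).
have gE : gamma^-1 = 2 / gamma0 * expR (a * L).
  by rewrite /gamma invfM invf_div -expRN opprK.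
have gi : gamma^-1 <= expR (c4 * L).
  have -> : expR (c4 * L) = expR (2 / gamma0 * L) * expR (a * L).
    by rewrite -expRD; congr expR; rewrite /c4; move: (2 / gamma0) => y; ring.
  rewrite gE ler_wpM2r ?expR_ge0//.
  by apply: le_trans (le_expR _) _; rewrite ler_expR ler_peMr.
have gi0 : 0 <= gamma^-1 by rewrite gE mulr_ge0 ?expR_ge0.
have qE : 2 * q <= expR (2 * q * L).
  by apply: le_trans (le_expR _) _; rewrite ler_expR ler_peMr// mulr_ge0.
have s0 : 0 <= 2 * N%:R / (gamma / q) by rewrite invf_div !mulr_ge0.
have sE : 2 * N%:R / (gamma / q) <= expR ((c3 + 2 * q + c4) * L).
  have -> : 2 * N%:R / (gamma / q) = N%:R * (2 * q) * gamma^-1.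
    by rewrite invf_div; move: gamma^-1 (N%:R : R) => g' N'; ring.
  have -> : expR ((c3 + 2 * q + c4) * L) = expR (c3 * L) * expR (2 * q * L) * expR (c4 * L).
    by rewrite -!expRD; congr expR; ring.
  by rewrite !ler_pM// ?mulr_ge0.
set c5 := c3 + 2 * q + c4 in sE K *.
have c50 : 0 <= c5 by rewrite !addr_ge0// mulr_ge0.
have AE : A <= expR (c3 * L + c5 * L * (c3 * L)).
  rewrite expRD ler_pM// ?exprn_ge0//.
  apply: le_trans (lerXn2r N s0 (expR_ge0 _) sE) _.
  by rewrite -expRM_natr ler_expR ler_wpM2l// mulr_ge0.
have A0 : 0 <= A by rewrite mulr_ge0// exprn_ge0.
have A2 : A ^+ 2 <= expR ((c3 * L + c5 * L * (c3 * L)) * 2).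
  by rewrite expRM_natr lerXn2r// nnegrE expR_ge0.
have cdE : cd * 8 <= expR (8 * cd) by rewrite mulrC; exact: le_expR.
apply: (@le_trans _ _ (expR (8 * cd) * expR ((c3 * L + c5 * L * (c3 * L)) * 2) * expR (c4 * L))).
  by rewrite !ler_pM// ?mulr_ge0// ?exprn_ge0.
rewrite -!expRD ler_expR /K.
have L2 : L <= L ^+ 2 by rewrite expr2 ler_peMr.
have L21 : 1 <= L ^+ 2 by exact: le_trans L2.
have E1 : 8 * cd <= 8 * cd * L ^+ 2 by rewrite ler_peMr// mulr_ge0.
have E2 : c3 * L <= c3 * L ^+ 2 by rewrite ler_wpM2l.
have E3 : c4 * L <= c4 * L ^+ 2 by rewrite ler_wpM2l.
have E4 : c5 * L * (c3 * L) = c5 * c3 * L ^+ 2 by ring.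
rewrite E4; lra.
Qed.

Lemma density_lower_bound (gamma0 a L t : R) : 0 < gamma0 -> 0 <= a -> 0 <= L ->
  0 <= t <= expR L -> gamma0 / 2 * expR (- (a * L)) <= gamma0 / (1 + t `^ a).
Proof.
move=> g0 a0 L0 /andP[t0 tL].
have ta : t `^ a <= expR (a * L).
  apply: (@le_trans _ _ ((expR L) `^ a)).
    by apply: ge0_ler_powR; rewrite ?nnegrE ?expR_ge0.
  by rewrite /powR gt_eqF ?expR_gt0// expRK.
have e1 : 1 <= expR (a * L) by rewrite -expR0 ler_expR mulr_ge0.
have p0 : 0 < 1 + t `^ a by rewrite (lt_le_trans ltr01)// lerDl powR_ge0.
rewrite expRN -mulrA ler_wpM2l ?(ltW g0)// -invfM lef_pV2 ?posrE ?mulr_gt0 ?expR_gt0//.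
lra.
Qed.

(** Squaring [E] yields [expR (- 2 * N)]. With [N >= (d + 1 + H) * L] this outweighs the power of
    [D2], as [2 * ln D2 <= L], the volume of order [expR (d * L)] and the constant [H <= expR H],
    and still leaves a factor [expR (- L) <= eps]. *)
Lemma remainder_bound (d : nat) (N : nat) (E D1 D2 L eps h cd R0 : R) :
  0 <= E -> 0 <= D1 -> 1 <= D2 -> 0 <= cd -> 0 <= R0 -> 2 * ln D2 <= L -> expR (- L) <= eps ->
  E <= D1 * expR (h + (d%:R + 1) * ln D2 - N%:R) ->
  1 <= L ->
  (d%:R + 1 + 8 * cd * (expR h) ^+ 2 * (4 * (1 + 2 * R0)) ^+ d) * L <= N%:R ->
  4 * cd * E ^+ 2 * (4 * (expR L + 2 * R0 * expR L)) ^+ d <= eps / 2 * D1 ^+ 2.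
Proof.
move=> E0 D10 D21 cd0 R00 D2L eL HE L1 HN.
set H := 8 * cd * _ * _ in HN.
have b0 : 0 <= (4 * (1 + 2 * R0)) ^+ d by rewrite exprn_ge0// mulr_ge0// addr_ge0// mulr_ge0.
have H0 : 0 <= H by rewrite !mulr_ge0// exprn_ge0// expR_ge0.
have HE2 : E ^+ 2 <= D1 ^+ 2 * expR ((h + (d%:R + 1) * ln D2 - N%:R) * 2).
  rewrite expRM_natr -exprMn lerXn2r// nnegrE mulr_ge0 ?expR_ge0//.
have -> : 4 * (expR L + 2 * R0 * expR L) = 4 * (1 + 2 * R0) * expR L by ring.
rewrite exprMn -expRM_natr.
apply: (@le_trans _ _ (4 * cd * (D1 ^+ 2 * expR ((h + (d%:R + 1) * ln D2 - N%:R) * 2)) *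
    ((4 * (1 + 2 * R0)) ^+ d * expR (L * d%:R)))).
  by rewrite ler_wpM2r ?mulr_ge0 ?expR_ge0// ler_wpM2l// mulr_ge0.
have -> : (h + (d%:R + 1) * ln D2 - N%:R) * 2 = h * 2 + ((d%:R + 1) * (2 * ln D2) - 2 * N%:R) by ring.
rewrite expRD expRM_natr.
have -> : 4 * cd * (D1 ^+ 2 * (expR h ^+ 2 * expR ((d%:R + 1) * (2 * ln D2) - 2 * N%:R))) *
   ((4 * (1 + 2 * R0)) ^+ d * expR (L * d%:R)) =
   D1 ^+ 2 / 2 * (H * (expR ((d%:R + 1) * (2 * ln D2) - 2 * N%:R) * expR (L * d%:R))).
  rewrite /H; by field.
have -> : eps / 2 * D1 ^+ 2 = D1 ^+ 2 / 2 * eps by ring.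
rewrite ler_wpM2l ?divr_ge0 ?sqr_ge0//; apply: le_trans eL.
apply: le_trans (ler_wpM2r _ (le_expR H)) _; first by rewrite mulr_ge0 ?expR_ge0.
rewrite -!expRD ler_expR.
have d0 : 0 <= d%:R :> R by [].
have T1 : (d%:R + 1) * (2 * ln D2) <= (d%:R + 1) * L by rewrite ler_wpM2l// addr_ge0.
have T2 : H <= H * L by rewrite ler_peMr.
rewrite !mulrDl mul1r in HN T1.
have dL : L * d%:R = d%:R * L by rewrite mulrC.
have T3 : 0 <= H * L by rewrite mulr_ge0//; lra.
rewrite dL mulrDl mul1r; lra.
Qed.

Lemma scale_facts (D2 s eps : R) : 1 <= D2 -> 0 <= s < 1 -> 0 < eps <= 1 ->
  let L := 1 + ln (1 / eps) + D2 `^ (2 / (1 - s)) in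
  [/\ 2 <= L, D2 `^ (2 / (1 - s)) <= L, 2 * ln D2 <= L, expR (- L) <= eps &
      D2 ^+ 2 / (1 + (expR L) ^+ 2) <= eps / 2].
Proof.
move=> D21 /andP[s0 s1] /andP[e0 e1] L.
have D20 : 0 < D2 by lra.
have le0 : 0 <= ln (1 / eps) by rewrite ln_ge0// div1r invf_ge1.
have D2p : D2 ^+ 2 <= D2 `^ (2 / (1 - s)).
  rewrite -powR_mulrn ?(ltW D20)// ler_powR// ler_pdivlMr ?subr_gt0//; lra.
have D2s : 1 <= D2 ^+ 2 by exact: exprn_ege1.
have L2 : 2 <= L by rewrite /L; lra.
have eL : expR (- L) <= eps.
  have -> : eps = expR (- ln (1 / eps)).
    by rewrite expRN lnK ?posrE ?divr_gt0// div1r invrK.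
  by rewrite ler_expR /L; lra.
split => //; first by rewrite /L; lra.
- have : ln (D2 ^+ 2) <= D2 ^+ 2 by apply: le_trans (le_expR _) _; rewrite lnK ?posrE ?exprn_gt0.
  by rewrite lnXn// -mulr_natl /L; lra.
(* Of the two factors in [expR L ^+ 2], one beats [2 * D2 ^+ 2], since [2 / (1 - s) >= 2] puts
   [1 + D2 ^+ 2] below [L], and the other beats [1 / eps]. *)
- have eeL : 2 * D2 ^+ 2 <= expR L.
    have : expR (1 + D2 ^+ 2) <= expR L by rewrite ler_expR /L; lra.
    rewrite expRD; have := expR_ge1Dx (1 : R); have := expR_ge1Dx (D2 ^+ 2).
    move: (expR 1) (expR (D2 ^+ 2)) (D2 ^+ 2) D2s => p q t t1; nra.
  have H1 : 1 <= eps * expR L by rewrite -ler_pdivrMr ?expR_gt0// div1r -expRN.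
  have q0 : 0 < 1 + expR L ^+ 2 by rewrite (lt_le_trans ltr01)// lerDl sqr_ge0.
  rewrite ler_pdivrMr//.
  have E0 := expR_gt0 L.
  have H2 : expR L <= eps * expR L ^+ 2 by rewrite expr2 mulrA ler_peMl// ltW.
  by rewrite mulrDr; lra.
Qed.

(** Origin of the exponent [2 / (1 - s)]: the power [x^(1 - s)] has to exceed [e^g * D2^2], the cost
    per order in [error_bound]. *)
Lemma ln_lower_bound (s g D2 x : R) : s < 1 -> 0 < D2 ->
  expR (g / (1 - s)) * D2 `^ (2 / (1 - s)) <= x -> g + 2 * ln D2 <= (1 - s) * ln x.
Proof.
move=> s1 D20 Hx.
have p0 : 0 < expR (g / (1 - s)) * D2 `^ (2 / (1 - s)) by rewrite mulr_gt0 ?expR_gt0 ?powR_gt0.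
have : ln (expR (g / (1 - s)) * D2 `^ (2 / (1 - s))) <= ln x.
  by rewrite ler_ln ?posrE// (lt_le_trans p0).
rewrite lnM ?posrE ?expR_gt0 ?powR_gt0// expRK ln_powR => H.
rewrite [leRHS]mulrC -ler_pdivrMr ?subr_gt0//; apply: le_trans H.
by rewrite mulrDl [2 * ln D2 / _]mulrAC.
Qed.

End constants.

(** * Derivative bounds on the enlarged balls and size of the radii *)

Section derivative_near_ball.
Context {R : realType} {d : nat}.
Implicit Types (F : 'rV[R]_d -> R[i]).

Lemma partials_near_ball F (x p : 'rV[R]_d) (rho nu mu delta D1 D2 eta r0 R0 : R) (N n : nat)
    (s : seq 'I_d) :
  let C := (1 + r0 ^+ 2 + ((1 - eta) * (2 - eta) / 2) ^- 2) * (2 + 2 * d%:R ^+ 2) in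
  let T := R0 ^+ N * C ^+ n * 2 ^+ d *
    (D1 * D2 ^+ (n + N + d) * n`!%:R `^ nu * (N + d)`!%:R `^ mu) in
  smoothC F ->
  (forall (n : nat) (b : 'I_d -> nat),
    (l2norm setT (fun x => ((1 + enorm x ^+ 2) `^ (n%:R / 2))%:C%C
                           * mpartialC b F x)%R
     <= (D1 * D2 ^+ (n + mdeg b) * (n`!)%:R `^ nu
         * ((mdeg b)`!)%:R `^ mu)%:E)%E) ->
  0 <= D1 -> 1 <= D2 -> 0 <= mu -> 1 <= R0 -> 0 < eta < 1 -> 1 <= r0 ->
  0 < rho -> rho <= R0 * (1 + enorm x ^+ 2) `^ (delta / 2) ->
  (r0 <= enorm x -> rho <= eta * enorm x) ->
  delta * N%:R <= n%:R -> enorm (p - x) <= (3 - eta) / 2 * rho -> size s = N ->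
  `|partials s (@complex.Re R \o F) p| <= T / rho ^+ N /\
  `|partials s (@complex.Im R \o F) p| <= T / rho ^+ N.
Proof.
move=> C T sF HF D10 D21 mu0 R01 eta01 r01 rho0 rhox rhoe dn px sN.
pose C1 := 1 + r0 ^+ 2 + ((1 - eta) * (2 - eta) / 2) ^- 2.
have C11 : 1 <= C1.
  by rewrite /C1 -addrA lerDl addr_ge0 ?sqr_ge0// invr_ge0 sqr_ge0.
have f1 m : 1 <= m`!%:R :> R by rewrite ler1n fact_gt0.
pose M := D1 * D2 ^+ (n + N + d) * n`!%:R `^ nu * (N + d)`!%:R `^ mu.
have D20 : 0 <= D2 by rewrite (le_trans ler01).
have M0 : 0 <= M by rewrite !mulr_ge0 ?exprn_ge0 ?powR_ge0.
have HM s' : (N <= size s' <= N + d)%N ->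
    D1 * D2 ^+ (n + size s') * n`!%:R `^ nu * (size s')`!%:R `^ mu <= M.
  move=> /andP[_ sd].
  rewrite ler_pM ?mulr_ge0 ?exprn_ge0 ?powR_ge0//; last first.
    by rewrite ge0_ler_powR ?nnegrE// ler_nat; exact: leq_fact.
  rewrite ler_wpM2r ?powR_ge0// ler_wpM2l//.
  by rewrite ler_weXn2l// -addnA leq_add2l.
have L2 s' : (N <= size s' <= N + d)%N ->
  (\int[lebesgue R d]_x ((1 + enorm x ^+ 2) ^+ n * partials s' (@complex.Re R \o F) x ^+ 2)%:E
     <= (M ^+ 2)%:E)%E /\
  (\int[lebesgue R d]_x ((1 + enorm x ^+ 2) ^+ n * partials s' (@complex.Im R \o F) x ^+ 2)%:E
     <= (M ^+ 2)%:E)%E.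
  move=> sd; apply: weighted_partials_L2 => //.
  apply: le_trans (HF n _) _.
  by rewrite (mpartial_partials s' sF.1).2 lee_fin HM.
have xp := comparable_weights eta01 r01 rho0 rhoe px.
split.
- apply: (partials_pointwise_bound sF.1 sN rho0 R01 C11 M0 dn rhox xp) => s' sd.
  exact: (L2 s' sd).1.
- apply: (partials_pointwise_bound sF.2 sN rho0 R01 C11 M0 dn rhox xp) => s' sd.
  exact: (L2 s' sd).2.
Qed.

Lemma radius_le (x : 'rV[R]_d) (rho delta R0 r : R) : 0 <= delta <= 1 -> 0 <= R0 -> 1 <= r ->
  enorm x <= r -> rho <= R0 * (1 + enorm x ^+ 2) `^ (delta / 2) -> rho <= 2 * R0 * r.
Proof.
move=> /andP[d0 d1] R00 r1 xr H; apply: (le_trans H).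
rewrite [2 * _]mulrC -mulrA ler_wpM2l//.
have x2 : enorm x ^+ 2 <= r ^+ 2 by rewrite lerXn2r ?nnegrE ?enorm_ge0//; lra.
have x1 : 1 <= 1 + enorm x ^+ 2 by rewrite lerDl sqr_ge0.
have r2 : 1 <= r ^+ 2 by exact: exprn_ege1.
apply: (@le_trans _ _ ((1 + enorm x ^+ 2) `^ 2^-1)).
  by rewrite ler_powR//; lra.
apply: (@le_trans _ _ (((2 * r) ^+ 2) `^ 2^-1)).
  rewrite ge0_ler_powR ?nnegrE ?invr_ge0 ?sqr_ge0//; first lra.
  by rewrite exprMn; lra.
have r20 : 0 <= 2 * r by lra.
by rewrite -powR_mulrn// -powRrM mulfV ?powRr1.
Qed.

End derivative_near_ball.

(** * Choice of radius, order and weight exponent, and conclusion *)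

Theorem theorem2p5 (R : realType) (d : nat) (hd : (0 < d)%N)
    (gamma0 R0 r0 eta nu s a : R)
    (hgamma0 : 0 < gamma0 < 1) (hR0 : 1 <= R0) (hr0 : 1 <= r0)
    (heta : 0 < eta < 1) (hnu : 0 <= nu) (hs : s < 1) (ha : 0 < a) :
  exists2 K : R, 1 <= K &
  forall (D1 D2 mu delta : R) (f : 'rV[R]_d -> R[i])
      (rho : 'rV[R]_d -> R) (omega : set 'rV[R]_d),
    0 < D1 -> 1 <= D2 -> 0 <= mu < 1 -> 0 <= delta <= 1 ->
    s = delta * nu + mu ->
    smoothC f ->
    (forall (n : nat) (b : 'I_d -> nat),
      (l2norm setT (fun x => ((1 + enorm x ^+ 2) `^ (n%:R / 2))%:C%C
                             * mpartialC b f x)%R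
       <= (D1 * D2 ^+ (n + mdeg b) * (n`!)%:R `^ nu
           * ((mdeg b)`!)%:R `^ mu)%:E)%E) ->
    measurable_fun [set: Rd R d] (rho : Rd R d -> measurableTypeR R) ->
    (forall x, 0 < rho x) ->
    (forall x, rho x <= R0 * (1 + enorm x ^+ 2) `^ (delta / 2)) ->
    (forall x, r0 <= enorm x -> rho x <= eta * enorm x) ->
    measurable (omega : set (Rd R d)) ->
    (forall x, ((gamma0 / (1 + enorm x `^ a))%:E
      <= lebesgue R d (eball x (rho x) `&` omega)
         / lebesgue R d (eball x (rho x)))%E) ->
    forall eps : R, 0 < eps <= 1 ->
      (l2norm setT f ^+ 2
       <= (expR (K * (1 + ln (1 / eps) + D2 `^ (2 / (1 - s))) ^+ 2))%:E
          * l2norm omega f ^+ 2 + (eps * D1 ^+ 2)%:E)%E.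
Proof.
(* [c1] combines two lower bounds for [N]: the exponential serves [error_bound] through
   [ln_lower_bound], and [c2] serves [remainder_bound]; [c3] allows for rounding. [K] is the
   constant of [exponent_bound]. None of them involves [D1], [D2], [mu], [delta] or [eps]. *)
pose q : R := 8 * (12 * d.+1%:R) ^+ d.
pose cd : R := ((2 * d).+4 ^ d)%:R * (8 * d.+1%:R) ^+ d.
pose C : R := (1 + r0 ^+ 2 + ((1 - eta) * (2 - eta) / 2) ^- 2) * (2 + 2 * d%:R ^+ 2).
pose g : R := ln (6 * d%:R) + ln R0 + ln C + 2 * nu + 3.
pose h : R := ln C + d%:R * ln 2 + nu + d%:R + ln d`!%:R.
pose c2 : R := d%:R + 1 + 8 * cd * (expR h) ^+ 2 * (4 * (1 + 2 * R0)) ^+ d.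
pose c1 : R := expR (g / (1 - s)) + c2.
pose c3 : R := c1 + 1.
pose c4 : R := a + 2 / gamma0.
pose K : R := 1 + 8 * cd + 2 * (c3 + (c3 + 2 * q + c4) * c3) + c4.
have /andP[g0 g1] := hgamma0.
have /andP[e0 e1] := heta.
have q0 : 0 <= q by rewrite mulr_ge0// exprn_ge0// mulr_ge0.
have cd0 : 0 <= cd by rewrite mulr_ge0// exprn_ge0// mulr_ge0.
have R00 : 0 <= R0 by lra.
have C1 : 1 <= C.
  rewrite /C -[leLHS]mulr1 ler_pM//.
    by rewrite -addrA lerDl addr_ge0 ?sqr_ge0// invr_ge0 sqr_ge0.
  by have := sqr_ge0 (d%:R : R); lra.
have C0 : 0 <= C by exact: le_trans C1.
have c20 : 0 <= c2.
  by rewrite /c2 !addr_ge0// !mulr_ge0 ?sqr_ge0// exprn_ge0// mulr_ge0// addr_ge0// mulr_ge0.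
have c10 : 0 <= c1 by rewrite addr_ge0 ?expR_ge0.
have c30 : 0 <= c3 by rewrite addr_ge0.
have c40 : 0 <= c4 by rewrite addr_ge0 ?divr_ge0 ?(ltW ha) ?(ltW g0).
have k0 : 0 <= (c3 + 2 * q + c4) * c3 by apply: mulr_ge0 => //; lra.
exists K; first by rewrite /K; lra.
move=> D1 D2 mu delta f rho omega D10 D21 mu01 delta01 sE sf Hf mrho rho0 rhoR rhoe mom dens eps eps01.
have D20 : 0 < D2 by exact: lt_le_trans D21.
have /andP[mu0 mu1] := mu01.
have /andP[de0 de1] := delta01.
have s0 : 0 <= s by rewrite sE addr_ge0// mulr_ge0.
have s01 : 0 <= s < 1 by rewrite s0.
have [L2 DL lDL eL HtailL] := scale_facts D21 s01 eps01.
set L := 1 + ln (1 / eps) + D2 `^ (2 / (1 - s)) in L2 DL lDL eL HtailL *.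
have L1 : 1 <= L by lra.
have L0 : 0 <= L by lra.
have c1L : 0 <= c1 * L by rewrite mulr_ge0.
(* The successor makes [N] positive and at least [c1 * L]; the excess is at most 1, hence at most
   [L]. *)
pose N := (Num.truncn (c1 * L)).+1.
have Nlo : c1 * L <= N%:R.
  by apply: ltW; have /andP[] := truncn_itv c1L.
have Nhi : N%:R <= c3 * L.
  have /andP[+ _] := truncn_itv c1L.
  have -> : c3 * L = c1 * L + L by rewrite [LHS]mulrDl [1 * L]mul1r.
  by rewrite /N -natr1; lra.
have dN0 : 0 <= delta * N%:R by rewrite mulr_ge0.
(* Between [delta * N] and [delta * N + 1]: large enough for the weight to compensate [rho ^+ N],
   small enough to keep [n!] near [(N!)^delta]. *)
pose n := (Num.truncn (delta * N%:R)).+1.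
have /andP[nlo nhi] := truncn_itv dN0.
have n1 : delta * N%:R <= n%:R by exact: ltW.
have n2 : n%:R <= delta * N%:R + 1 by rewrite /n -natr1 lerD2r.
have n3 : (n <= N.+1)%N.
  rewrite -(ler_nat R) -[N.+1%:R]natr1; apply: (le_trans n2).
  by rewrite lerD2r ler_piMl.
pose r := expR L.
have r1 : 1 <= r by rewrite /r -expR0 ler_expR.
have r00 : 0 < r by exact: expR_gt0.
pose P := 2 * R0 * r.
have P0 : 0 < P by rewrite !mulr_gt0// (lt_le_trans ltr01).
pose gamma := gamma0 / 2 * expR (- (a * L)).
have gamma_gt0 : 0 < gamma by rewrite mulr_gt0 ?expR_gt0// divr_gt0.
have gamma_le1 : gamma <= 1.
  rewrite -[leRHS]mulr1 ler_pM ?expR_ge0// ?divr_ge0 ?(ltW g0)//.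
    by rewrite ler_pdivrMr// mul1r (le_trans (ltW g1))// ler1n.
  by rewrite -expR0 ler_expR oppr_le0 mulr_ge0// ltW.
pose T := R0 ^+ N * C ^+ n * 2 ^+ d *
    (D1 * D2 ^+ (n + N + d) * n`!%:R `^ nu * (N + d)`!%:R `^ mu).
(* The derivative bound depends on [x] only through [rho x ^+ N], so that the remainder on each ball
   becomes the same number [E]. *)
pose B x := T / rho x ^+ N.
pose E := (6 * d%:R) ^+ N * T / N`!%:R.
have d0 : 0 < d%:R :> R by rewrite ltr0n.
have T0 : 0 <= T.
  by rewrite !mulr_ge0 ?exprn_ge0 ?powR_ge0 ?(ltW D10) ?(ltW D20).
have E0 : 0 <= E by rewrite divr_ge0// mulr_ge0// exprn_ge0// mulr_ge0.
have g_le : g + 2 * ln D2 <= (1 - s) * ln N%:R.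
  apply: ln_lower_bound => //.
  apply: le_trans Nlo; rewrite ler_pM ?expR_ge0 ?powR_ge0//.
  by rewrite /c1 lerDl.
have HE : E <= D1 * expR (h + (d%:R + 1) * ln D2 - N%:R).
  have mu01' : 0 <= mu <= 1 by rewrite mu0 ltW.
  have b0 : 0 < 6 * d%:R :> R by rewrite mulr_gt0.
  exact: (error_bound d (ltn0Sn _) b0 hnu mu01' delta01 sE hs hR0 C1 D10 D21 n3 n2 g_le).
(* Half of [eps] is spent on the remainders, the other half on the tail. *)
have rem : 4 * cd * E ^+ 2 * (4 * (r + P)) ^+ d <= eps / 2 * D1 ^+ 2.
  apply: (remainder_bound E0 (ltW D10) D21 cd0 R00 lDL eL HE L1).
  apply: le_trans Nlo; rewrite ler_wpM2r// /c1 lerDr expR_ge0//.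
have Hmdeg0 : mdeg (fun _ : 'I_d => 0%N) = 0%N by rewrite /mdeg big1.
have weight k : (\int[lebesgue R d]_x ((1 + enorm x ^+ 2) ^+ k *
    ComplexField.Normc.normc (f x) ^+ 2)%:E <= ((D1 * D2 ^+ k * k`!%:R `^ nu) ^+ 2)%:E)%E.
  apply: weighted_L2 => //; have := Hf k (fun=> 0%N).
  by rewrite Hmdeg0 fact0 powR1 mulr1 addn0.
have f2fin : (\int[lebesgue R d]_x (ComplexField.Normc.normc (f x) ^+ 2)%:E < +oo)%E.
  apply: le_lt_trans (ltry ((D1 * D2 ^+ 0 * 0`!%:R `^ nu) ^+ 2)).
  apply: le_trans (weight 0%N).
  by under [leRHS]eq_integral do rewrite expr0 mul1r.
have tail : (\int[lebesgue R d]_(x in ~` [set x | (enorm x <= r)%R])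
    (ComplexField.Normc.normc (f x) ^+ 2)%:E <= (eps / 2 * D1 ^+ 2)%:E)%E.
  have := weight 1%N; under eq_integral do rewrite expr1.
  rewrite expr1 factS fact0 powR1 mulr1 => W.
  apply: le_trans (tail_estimate sf (ltW r00) W) _.
  have -> : (D1 * D2) ^+ 2 / (1 + r ^+ 2) = D2 ^+ 2 / (1 + r ^+ 2) * D1 ^+ 2.
    by move: (1 + r ^+ 2)^-1 => i; ring.
  by rewrite lee_fin; apply: ler_wpM2r; rewrite ?sqr_ge0.
have ball : (\int[lebesgue R d]_(x in [set x | (enorm x <= r)%R])
      (ComplexField.Normc.normc (f x) ^+ 2)%:E <=
   (cd * 8 * (N%:R * (2 * N%:R / (gamma / q)) ^+ N) ^+ 2 / gamma)%:E *
     \int[lebesgue R d]_(x in omega) (ComplexField.Normc.normc (f x) ^+ 2)%:E +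
   (4 * cd * E ^+ 2 * (4 * (r + P)) ^+ d)%:E)%E.
  have k12 : 1 < (3 - eta) / 2 <= 2 by rewrite ltr_pdivlMr// ler_pdivrMr//; clear -e0 e1; lra.
  have g01 : 0 < gamma <= 1 by rewrite gamma_gt0.
  apply: (@global_estimate R d f rho B omega r ((3 - eta) / 2) gamma P E N) => //.
  - move=> x xr; apply: density_mass (dens x) => //.
    by apply: density_lower_bound; rewrite ?enorm_ge0 ?(ltW ha).
  - by move=> x xr; apply: radius_le (rhoR x).
  - move=> x p t xr px tN.
    exact: (partials_near_ball sf Hf (ltW D10) D21 mu0 hR0 heta hr0 (rho0 x)
      (rhoR x) (rhoe x) n1 px tN).
  - move=> x xr.
    have -> : (d%:R * (6 * rho x)) ^+ N * B x / N`!%:R = E.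
      rewrite /E /B !exprMn.
      have u0 : rho x ^+ N != 0 by rewrite expf_neq0// gt_eqF.
      have cancel (u y w z : R) : u != 0 -> y * (w * u) * (z / u) = w * y * z.
        by move=> ?; field.
      by congr (_ / _); exact: cancel.
    by rewrite E0 lexx.
rewrite !l2norm_sqr (integral_ball_split r sf).
apply: le_trans (leeD ball tail) _.
rewrite -addeA -EFinD; apply: leeD.
  apply: lee_wpmul2r; first by apply: integral_ge0 => x _; rewrite lee_fin sqr_ge0.
  by rewrite lee_fin; exact: (exponent_bound L1 cd0 q0 g0 (ltW ha) Nhi).
by rewrite lee_fin; lra.
Qed.
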